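(* Let $a\in[0,1]$, $\gamma\in\mathbb C\setminus\{0\}$, let $q,\tilde q\in L_2(0,1)$ be complex-valued, and let $\{\lambda_n\}_{n\ge0}$ and $\{\tilde\lambda_n\}_{n\ge0}$ be the spectra of the boundary value problems $\mathcal L(q(x),a,\gamma)$ and $\mathcal L(\tilde q(x),a,\gamma)$, respectively. (1) Let $\gamma\ne\pm1$. Then $\{\lambda_n\}_{n\ge0}=\{\tilde\lambda_n\}_{n\ge0}$ implies $q(x)=\tilde q(x)$ a.e. on $(0,1)$. (2) Let $\gamma\in\{-1,1\}$. Assume that there exists an operator $K:L_2(0,1/2)\to L_2(0,1/2)$ with injective $I+\gamma K$, where $I$ is the identity operator, such that $$ q_a\Big(\frac12-x\Big)=K\Big(q_a\Big(\frac12+x\Big)\Big),\qquad \tilde q_a\Big(\frac12-x\Big)=K\Big(\tilde q_a\Big(\frac12+x\Big)\Big)\quad\text{a.e. on }\Big(0,\frac12\Big). $$ Then $\{\lambda_n\}_{n\ge0}=\{\tilde\lambda_n\}_{n\ge0}$ implies $q(x)=\tilde q(x)$ a.e. on $(0,1)$.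
   Context: For a complex-valued $q\in L_2(0,1)$, $a\in[0,1]$ and $\gamma\in\mathbb C\setminus\{0\}$, $\mathcal L(q(x),a,\gamma)$ denotes the boundary value problem $$-y''(x)+q(x)y(a)=\lambda y(x),\quad 0<x<1,\qquad y^{(\nu)}(0)=\gamma y^{(\nu)}(1),\quad \nu=0,1,$$ for $y\in W_2^2[0,1]$, with spectral parameter $\lambda\in\mathbb C$. Let $C(x,\lambda)$, $S(x,\lambda)$ be the solutions of the equation with $C(a,\lambda)=S'(a,\lambda)=1$, $S(a,\lambda)=C'(a,\lambda)=0$; with $\rho^2=\lambda$, $$C(x,\lambda)=\cos\rho(x-a)+\int_a^x\frac{\sin\rho(x-t)}{\rho}q(t)\,dt,\qquad S(x,\lambda)=\frac{\sin\rho(x-a)}{\rho}.$$ The eigenvalues are the zeros of the characteristic function $$\Delta(\lambda)=\begin{vmatrix} C(0,\lambda)-\gamma C(1,\lambda) & S(0,\lambda)-\gamma S(1,\lambda)\\ C'(0,\lambda)-\gamma C'(1,\lambda) & S'(0,\lambda)-\gamma S'(1,\lambda)\end{vmatrix},$$ and the spectrum is the collection of zeros of $\Delta$ counted with multiplicity (a multiset); equality of spectra is equality of multisets. The function $q_a$ is defined from $q$ (and $\tilde q_a$ likewise from $\tilde q$) by $$q_a(x)=\begin{cases} q(x+a), & x\in(0,1-a),\\ \frac1\gamma\, q(x+a-1), & x\in(1-a,1).\end{cases}$$ ''Operator'' here means an arbitrary map, not necessarily linear (e.g. constant maps are allowed). The notation $K(f(\tfrac12+x))$ means $K$ applied to the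 function $x\mapsto f(\tfrac12+x)$ on $(0,1/2)$, evaluated at $x$. *)

(* Defs.v *)
From mathcomp Require Import all_boot all_order all_algebra.
From mathcomp Require Import complex.
From mathcomp Require Import all_classical all_reals all_analysis.

Set Implicit Arguments.
Unset Strict Implicit.
Unset Printing Implicit Defensive.

Import Order.TTheory GRing.Theory Num.Theory.
Import numFieldNormedType.Exports.

Local Open Scope classical_set_scope.
Local Open Scope complex_scope.
Local Open Scope ring_scope.

Section FunctionSpaces.
Context {R : realType}.
Local Notation leb := (@lebesgue_measure R).
Implicit Types (D : set R) (f g : R -> R[i]).

Definition ae_eq_on D f g : Prop := {ae leb, forall x, D x -> f x = g x}.

Definition cmeasurable D f : Prop :=
  measurable_fun D (fun x => complex.Re (f x)) /\
  measurable_fun D (fun x => complex.Im (f x)).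

Definition L1 D f : Prop :=
  leb.-integrable D (fun x => (complex.Re (f x))%:E) /\
  leb.-integrable D (fun x => (complex.Im (f x))%:E).

(* The integrand is |f|^2. *)
Definition L2 D f : Prop :=
  cmeasurable D f /\
  leb.-integrable D
    (fun x => (complex.Re (f x) ^+ 2 + complex.Im (f x) ^+ 2)%:E).

Definition cintegral D f : R[i] :=
  (\int[leb]_(x in D) complex.Re (f x)) +i*
  (\int[leb]_(x in D) complex.Im (f x)).

(* Absolute continuity of y on [0, 1], in its integral form: y is the indefinite
   Lebesgue integral of y', which is determined up to a null set, and
   everywhere on [0, 1] once y' is known to be continuous there. *)
Definition AC_with_derivative (y y' : R -> R[i]) : Prop :=
  L1 `]0, 1[ y' /\
  forall x, 0 <= x <= 1 -> y x = y 0 + cintegral `]0, x[ y'.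

(* y belongs to W_2^2[0, 1], y' is its (continuous) first derivative, and y''
   its second derivative. *)
Definition W22_with_derivatives (y y' y'' : R -> R[i]) : Prop :=
  [/\ AC_with_derivative y y', AC_with_derivative y' y'' & L2 `]0, 1[ y''].

(* An operator on L_2(D), not necessarily linear.  Elements of L_2(D) are
   functions modulo equality a.e. on D, whence the second clause. *)
Definition L2_operator D (K : (R -> R[i]) -> (R -> R[i])) : Prop :=
  (forall f, L2 D f -> L2 D (K f)) /\
  (forall f g, L2 D f -> L2 D g -> ae_eq_on D f g -> ae_eq_on D (K f) (K g)).

Definition L2_injective D (T : (R -> R[i]) -> (R -> R[i])) : Prop :=
  forall f g, L2 D f -> L2 D g -> ae_eq_on D (T f) (T g) -> ae_eq_on D f g.

End FunctionSpaces.

(* z is a zero of order m of f (m = 0 when f z <> 0): near z,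
   f w = (w - z)^m g w with g holomorphic and g z <> 0. *)
Definition zero_of_order (K : numFieldType) (f : K -> K) (z : K) (m : nat)
    : Prop :=
  exists g : K -> K,
    [/\ \forall w \near z, derivable (g : K^o -> K^o) w 1,
        g z != 0
      & \forall w \near z, f w = (w - z) ^+ m * g w].

Section Problem.
Context {R : realType}.
Implicit Types (q : R -> R[i]) (a : R) (gam lam : R[i]).

(* y solves -y'' + q(x) y(a) = lam y on (0, 1), with y in W_2^2[0, 1]. *)
Definition solution q a lam (y y' : R -> R[i]) : Prop :=
  exists y'' : R -> R[i],
    W22_with_derivatives y y' y'' /\
    ae_eq_on `]0, 1[ (fun x => - y'' x + q x * y a) (fun x => lam * y x).

Definition characteristic_function q a gam (Delta : R[i] -> R[i]) : Prop :=
  forall lam, exists C C' S S' : R -> R[i],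
    [/\ solution q a lam C C' /\ (C a = 1 /\ C' a = 0),
        solution q a lam S S' /\ (S a = 0 /\ S' a = 1)
      & Delta lam =
          (C 0 - gam * C 1) * (S' 0 - gam * S' 1) -
          (S 0 - gam * S 1) * (C' 0 - gam * C' 1)].

(* The spectrum of L(q, a, gam) is a multiset of complex numbers, encoded by its
   multiplicity function m (m z = 0 when z is not an eigenvalue). *)
Definition spectrum q a gam (m : R[i] -> nat) : Prop :=
  exists Delta : R[i] -> R[i],
    characteristic_function q a gam Delta /\
    forall z, zero_of_order Delta z (m z).

(* The function q_a on (0, 1); its value at the point 1 - a is irrelevant. *)
Definition shifted q a gam : R -> R[i] :=
  fun x => if x < 1 - a then q (x + a) else gam^-1 * q (x + a - 1).

End Problem.

(* Main.v *)
Require Import Defs.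
From mathcomp Require Import all_boot all_order all_algebra.
From mathcomp Require Import complex.
From mathcomp Require Import all_classical all_reals all_analysis.
From mathcomp Require Import measurable_realfun.
From mathcomp Require Import ring lra.
Set Implicit Arguments.
Unset Strict Implicit.
Unset Printing Implicit Defensive.
Import Order.TTheory GRing.Theory Num.Theory.
Import numFieldNormedType.Exports.
Local Open Scope classical_set_scope.
Local Open Scope complex_scope.
Local Open Scope ring_scope.

(* With w = gam q_a + q_a(1 - .), the characteristic function is
     Delta(rho^2) = 1 + gam^2 - 2 gam cos rho
                    - gam int_0^1 (sin(rho x) / rho) w(x) dx.
   If Delta and Delta~ have the same zeros, the quotient
   (Delta - Delta~) / Delta~ has only removable singularities, and it is O(1/r)
   on the boundary of the squares |Re rho|, |Im rho| <= r, for suitable r tending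
   to infinity, because the unperturbed part equals
   (1 - gam e^(i rho)) (1 - gam e^(-i rho)).  The maximum principle gives
   Delta = Delta~, so the odd moments of w - w~, which are the coefficients in
   rho of int_0^1 sin(rho x) (w - w~)(x) dx, vanish and w = w~ a.e.
   If gam^2 <> 1, the values of w at x and 1 - x determine q_a at both points; if
   gam^2 = 1, w(1/2 + .) is gam (I + gam K) applied to q_a(1/2 + .). *)

(** [Delta] is a power series in lambda = rho^2, because cos rho and sin(rho x) / rho are even in
    rho. Holomorphy therefore enters through coefficient sequences that decay faster than every
    geometric one: dividing out a zero is an operation on coefficients, and neither Cauchy's formula
    nor a factorization theorem for entire functions is called upon. The quotient lives in lambda,
    while its size is read off in rho, where everything grows like e^|Im rho|; square roots lying
    near a given rho pass between the two planes. Squares are chosen for their sides: where |Im rho|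
    is large one exponential dominates, and the remaining piece of a vertical side only asks that
    gam e^(i rho) and gam e^(-i rho) keep a fixed angle from the real axis, which is a choice of r
    modulo 2 pi. For gam^2 = 1 the function w satisfies w(1 - x) = gam w(x), so the spectrum sees
    only half of q_a; the operator K supplies the other half. *)

Section Modulus.
Variable R : realType.
Implicit Types (z w : R[i]).

(** The norm [|z|] takes its values in R[i], whose order is partial; estimates are carried out with
    this real-valued version. *)
Definition modc z : R := Normc.normc z.

Lemma modcE z : (modc z)%:C = `|z|. Proof. by case: z. Qed.

Lemma modc_ge0 z : 0 <= modc z.
Proof. by case: z => x y; rewrite sqrtr_ge0. Qed.

Lemma modcD z w : modc (z + w) <= modc z + modc w.
Proof. exact: le_normcD. Qed.

Lemma modcN z : modc (- z) = modc z.
Proof. exact: normcN. Qed.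

Lemma modcB z w : modc (z - w) <= modc z + modc w.
Proof. by rewrite (le_trans (modcD _ _))// modcN. Qed.

Lemma modc_dist z w : modc (z - w) = modc (w - z).
Proof. by rewrite -modcN opprB. Qed.

Lemma modc_lower z w : modc z - modc w <= modc (z - w).
Proof. by rewrite lerBlDr (le_trans _ (modcD _ _))// subrK. Qed.

Lemma modcM z w : modc (z * w) = modc z * modc w.
Proof. exact: Normc.normcM. Qed.

Lemma modc0 : modc 0 = 0. Proof. exact: Normc.normc0. Qed.

Lemma modc1 : modc 1 = 1. Proof. exact: Normc.normc1. Qed.

Lemma modcX z n : modc (z ^+ n) = modc z ^+ n.
Proof. by elim: n => [|n IH]; rewrite ?modc1// !exprS modcM IH. Qed.

Lemma modcV z : modc z^-1 = (modc z)^-1.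
Proof. exact: Normc.normcV. Qed.

Lemma modc_eq0 z : (modc z == 0) = (z == 0).
Proof.
by apply/eqP/eqP => [/Normc.eq0_normc //|->]; exact: modc0.
Qed.

Lemma modc_gt0 z : (0 < modc z) = (z != 0).
Proof. by rewrite lt_def modc_ge0 andbT modc_eq0. Qed.

Lemma modc_real (x : R) : modc x%:C = `|x|.
Proof. by rewrite /modc /= expr0n addr0 sqrtr_sqr. Qed.

Lemma modc_i : modc 'i = 1.
Proof. by rewrite /modc /= expr0n add0r expr1n sqrtr1. Qed.

Lemma modc_sum (I : Type) (r : seq I) (P : pred I) (F : I -> R[i]) :
  modc (\sum_(i <- r | P i) F i) <= \sum_(i <- r | P i) modc (F i).
Proof.
elim/big_rec2: _ => [|i y x _ h]; first by rewrite modc0.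
by rewrite (le_trans (modcD _ _))// lerD2l.
Qed.

Lemma Re_le_modc z : `|complex.Re z| <= modc z.
Proof. by rewrite -lecR modcE normc_ge_Re. Qed.

Lemma Im_le_modc z : `|complex.Im z| <= modc z.
Proof.
case: z => x y /=; rewrite /modc /= -sqrtr_sqr ler_sqrt.
  by rewrite lerDr sqr_ge0.
by rewrite addr_ge0 ?sqr_ge0.
Qed.

Lemma modc_le_ReIm z : modc z <= `|complex.Re z| + `|complex.Im z|.
Proof.
rewrite {1}(complexE z) (le_trans (modcD _ _))//.
by rewrite modcM modc_i mul1r !modc_real.
Qed.

Lemma Re_le_modcB z w : `|complex.Re z - complex.Re w| <= modc (z - w).
Proof. by case: z w => [a b] [c d]; exact: (Re_le_modc (_ +i* _)). Qed.

Lemma Im_le_modcB z w : `|complex.Im z - complex.Im w| <= modc (z - w).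
Proof. by case: z w => [a b] [c d]; exact: (Im_le_modc (_ +i* _)). Qed.

End Modulus.
Arguments modc : simpl never.
#[global] Hint Extern 0 (is_true (0 <= modc _)) => solve [apply: modc_ge0] : core.

Lemma ler_expn (R : realDomainType) (x y : R) n :
  0 <= x -> x <= y -> x ^+ n <= y ^+ n.
Proof. by move=> x0 xy; rewrite lerXn2r// nnegrE// (le_trans x0). Qed.

(** * Limits of sequences with geometric increments *)

Section GeometricLimit.
Variable R : realType.

(** The intervals of centre [u n] and radius [d n] are nested, because [d n - d n.+1] is exactly
    [M / 2 ^+ n]; the limit is a point common to all of them, which keeps the rate explicit. *)
Lemma real_geometric_limit (u : nat -> R) (M : R) :
    (forall n, `|u n.+1 - u n| <= M / 2 ^+ n) ->
  exists l, forall n, `|l - u n| <= 2 * M / 2 ^+ n.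
Proof.
move=> hu.
pose d n : R := 2 * M / 2 ^+ n.
have dS n : d n = d n.+1 + M / 2 ^+ n.
  by rewrite /d exprS; field; rewrite expf_neq0.
pose a n := u n - d n; pose b n := u n + d n.
have aS n : a n <= a n.+1.
  by have := hu n; rewrite /a (dS n) ler_norml; lra.
have bS n : b n.+1 <= b n.
  by have := hu n; rewrite /b (dS n) ler_norml; lra.
have d0 n : 0 <= d n.
  rewrite /d -mulrA mulr_ge0//; exact: le_trans (hu n).
have amono m n : (m <= n)%N -> a m <= a n.
  elim: n => [|n IH]; first by rewrite leqn0 => /eqP->.
  rewrite leq_eqVlt => /orP[/eqP->//|]; rewrite ltnS => /IH h.
  exact: le_trans (aS n).
have bmono m n : (m <= n)%N -> b n <= b m.
  elim: n => [|n IH]; first by rewrite leqn0 => /eqP->.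
  rewrite leq_eqVlt => /orP[/eqP->//|]; rewrite ltnS => /IH h.
  exact: le_trans h.
have ab m n : a m <= b n.
  have h k : a k <= b k by rewrite /a /b; have := d0 k; lra.
  case: (leqP m n) => [mn|/ltnW nm].
    exact: le_trans (amono _ _ mn) (h n).
  exact: le_trans (h m) (bmono _ _ nm).
exists (sup (range a)) => n.
have hs : has_sup (range a).
  split; first by exists (a 0%N); exists 0%N.
  by exists (b 0%N) => _ [m _ <-].
have h1 : a n <= sup (range a) by apply: ub_le_sup; [case: hs|exists n].
have h2 : sup (range a) <= b n by apply: ge_sup; [case: hs|move=> _ [m _ <-]].
by rewrite -/(d n) ler_norml; move: h1 h2; rewrite /a /b; lra.
Qed.

Lemma complex_geometric_limit (u : nat -> R[i]) (M : R) :
    (forall n, modc (u n.+1 - u n) <= M / 2 ^+ n) ->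
  exists l, forall n, modc (l - u n) <= 4 * M / 2 ^+ n.
Proof.
move=> hu.
have [x hx] := @real_geometric_limit (fun n => complex.Re (u n)) M
  (fun n => le_trans (Re_le_modcB _ _) (hu n)).
have [y hy] := @real_geometric_limit (fun n => complex.Im (u n)) M
  (fun n => le_trans (Im_le_modcB _ _) (hu n)).
exists (x +i* y) => n; rewrite (le_trans (modc_le_ReIm _))//.
case: (u n) (hx n) (hy n) => a b /= ha hb; rewrite (le_trans (lerD ha hb))//.
by rewrite -mulrDl -mulrDl -natrD.
Qed.

End GeometricLimit.

(** * Entire functions as coefficient sequences *)

Section PowerSeries.
Variable R : realType.
Implicit Types (a b : nat -> R[i]) (z w v c d : R[i]) (M s : R).

Definition coef_bound a s M := forall k, modc (a k) * s ^+ k <= M.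

(** Infinite radius of convergence, in the form of Cauchy's estimates: these pass to quotients by w
    - z with an explicit constant. *)
Definition entire_coefs a := forall s, 0 < s -> exists M, coef_bound a s M.

Definition partial_sum a w n : R[i] := \sum_(k < n) a k * w ^+ k.

(** Convergence at the rate 2^-n, which a coefficient bound at a radius s >= 2 |w| always provides.
    With the rate built in, uniqueness and linearity of the sum are comparisons of constants. *)
Definition sums_to a w v :=
  exists M, forall n, modc (v - partial_sum a w n) <= M / 2 ^+ n.

Lemma half_expn_small (M e : R) : 0 < e -> exists n, M / 2 ^+ n < e.
Proof.
move=> e0.
have [n hn] : exists n : nat, M / e < n%:R.
  by exists (Num.bound `|M / e|); rewrite (le_lt_trans (ler_norm _))// archi_boundP.
exists n; rewrite ltr_pdivrMr ?exprn_gt0// mulrC -ltr_pdivrMr//.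
apply: (lt_le_trans hn); rewrite -natrX ler_nat ltnW//; exact: ltn_expl.
Qed.

Lemma le_half_expn_le0 (x M : R) : (forall n, x <= M / 2 ^+ n) -> x <= 0.
Proof.
move=> h; rewrite leNgt; apply/negP => x0.
by have [n] := half_expn_small M x0; rewrite ltNge h.
Qed.

Lemma sums_to_unique a w v v' : sums_to a w v -> sums_to a w v' -> v = v'.
Proof.
move=> [M hM] [M' hM']; apply/eqP; rewrite -subr_eq0 -modc_eq0 eq_le modc_ge0.
rewrite andbT (@le_half_expn_le0 _ (M + M'))// => n.
have -> : v - v' = (v - partial_sum a w n) - (v' - partial_sum a w n) by ring.
by rewrite (le_trans (modcB _ _))// mulrDl; exact: lerD.
Qed.

Lemma coef_bound_ge0 a s M : coef_bound a s M -> 0 <= M.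
Proof. by move=> /(_ 0%N); apply: le_trans; rewrite expr0 mulr1. Qed.

Lemma coef_bound_term a s M w k : 0 < s -> coef_bound a s M ->
  modc w * 2 <= s -> modc (a k * w ^+ k) <= M / 2 ^+ k.
Proof.
move=> s0 h ws; rewrite modcM modcX ler_pdivlMr ?exprn_gt0// -mulrA -exprMn.
apply: le_trans (h k); apply: ler_wpM2l => //.
by apply: ler_expn; rewrite ?mulr_ge0.
Qed.

Lemma sums_to_exists a w : entire_coefs a -> exists v, sums_to a w v.
Proof.
move=> ea; have s0 : 0 < modc w * 2 + 1 by rewrite ltr_wpDl ?mulr_ge0.
have [M hM] := ea _ s0.
have [n|l hl] := @complex_geometric_limit _ (partial_sum a w) M.
  rewrite /partial_sum big_ord_recr /= addrAC subrr add0r.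
  by apply: (@coef_bound_term _ (modc w * 2 + 1)) => //; rewrite lerDl.
by exists l, (4 * M).
Qed.

Fact entire_value_key : unit. Proof. exact: tt. Qed.

(** Locked, so that conversion does not unfold the choice of the sum. The default 0 is never taken
    when [entire_coefs a] holds. *)
Definition entire_value :=
  locked_with entire_value_key (fun a w => xget 0 [set v | sums_to a w v]).

Lemma entire_valueP a w : entire_coefs a -> sums_to a w (entire_value a w).
Proof.
move=> /(@sums_to_exists _ w) [v hv].
rewrite /entire_value locked_withE.
by apply: (@xgetPex _ _ [set v | sums_to a w v]); exists v.
Qed.

Lemma entire_valueE a w v : entire_coefs a -> sums_to a w v ->
  entire_value a w = v.
Proof. by move=> ea; apply: sums_to_unique; exact: entire_valueP. Qed.

Lemma sum_half_expn (n : nat) : \sum_(k < n) (2 ^+ k)^-1 <= 2 :> R.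
Proof.
suff -> : \sum_(k < n) (2 ^+ k)^-1 = 2 - 2 / 2 ^+ n :> R.
  by rewrite gerBl divr_ge0// exprn_ge0.
elim: n => [|n IH]; first by rewrite big_ord0 expr0 divr1 subrr.
by rewrite big_ord_recr /= IH exprS; field; rewrite expf_neq0.
Qed.

(** For |w| <= s / 2 the k-th term is at most M / 2^k, and these bounds sum to 2 M. *)
Lemma entire_value_bound a s M w : 0 < s -> entire_coefs a ->
  coef_bound a s M -> modc w * 2 <= s -> modc (entire_value a w) <= 2 * M.
Proof.
move=> s0 ea h ws; have [N hN] := entire_valueP w ea.
rewrite -subr_le0; apply: (@le_half_expn_le0 _ N) => n.
rewrite lerBlDr -(subrK (partial_sum a w n) (entire_value a w)).
rewrite (le_trans (modcD _ _))// lerD// (le_trans (modc_sum _ _ _))//.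
apply: (@le_trans _ _ (\sum_(k < n) M / 2 ^+ k)).
  by apply: ler_sum => k _; exact: coef_bound_term s0 h ws.
rewrite -mulr_sumr mulrC ler_wpM2r ?sum_half_expn//.
exact: coef_bound_ge0 h.
Qed.

Lemma entire_coefsD a b c d : entire_coefs a -> entire_coefs b ->
  entire_coefs (fun k => c * a k + d * b k).
Proof.
move=> ea eb s s0; have [M hM] := ea s s0; have [N hN] := eb s s0.
exists (modc c * M + modc d * N) => k.
apply: (@le_trans _ _ (modc c * (modc (a k) * s ^+ k) +
                       modc d * (modc (b k) * s ^+ k))).
  rewrite !mulrA -mulrDl; apply: ler_wpM2r; first by rewrite exprn_ge0 ?ltW.
  by rewrite -!modcM; exact: modcD.
by rewrite lerD// ler_wpM2l.
Qed.

Lemma entire_valueD a b c d w : entire_coefs a -> entire_coefs b ->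
  entire_value (fun k => c * a k + d * b k) w =
  c * entire_value a w + d * entire_value b w.
Proof.
move=> ea eb; apply: entire_valueE; first exact: entire_coefsD.
have [M hM] := entire_valueP w ea; have [N hN] := entire_valueP w eb.
exists (modc c * M + modc d * N) => n.
have -> : partial_sum (fun k => c * a k + d * b k) w n =
    c * partial_sum a w n + d * partial_sum b w n.
  rewrite /partial_sum !mulr_sumr -big_split /=; apply: eq_bigr => k _; ring.
set A := entire_value a w; set B := entire_value b w.
have -> : c * A + d * B - (c * partial_sum a w n + d * partial_sum b w n) =
  c * (A - partial_sum a w n) + d * (B - partial_sum b w n) by ring.
rewrite (le_trans (modcD _ _))// !modcM mulrDl -!mulrA.
by rewrite lerD// ler_wpM2l.
Qed.

Definition shift_coefs n a : nat -> R[i] := fun k => a (n + k)%N.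

Lemma shift_coef_bound n a s M : 0 < s ->
  coef_bound a s M -> coef_bound (shift_coefs n a) s (M / s ^+ n).
Proof.
move=> s0 h k; rewrite ler_pdivlMr ?exprn_gt0// -mulrA -exprD addnC; exact: h.
Qed.

Lemma entire_shift_coefs n a : entire_coefs a -> entire_coefs (shift_coefs n a).
Proof.
move=> ea s s0; have [M hM] := ea s s0; exists (M / s ^+ n).
exact: shift_coef_bound.
Qed.

(** Horner's rule for infinite sums. *)
Lemma entire_value_shift n a z : entire_coefs a ->
  entire_value (shift_coefs n a) z =
  a n + z * entire_value (shift_coefs n.+1 a) z.
Proof.
move=> ea; apply: entire_valueE; first exact: entire_shift_coefs.
have [M hM] := entire_valueP z (entire_shift_coefs n.+1 ea).
(* The first summand pays for the shift of the rate by one index, the second for n = 0, where the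
   partial sum is empty. *)
exists (2 * modc z * M + modc (a n + z * entire_value (shift_coefs n.+1 a) z)).
case=> [|k].
  rewrite /partial_sum big_ord0 subr0 expr0 divr1 lerDr !mulr_ge0//.
  by have := le_trans (modc_ge0 _) (hM 0%N); rewrite expr0 divr1.
have -> : partial_sum (shift_coefs n a) z k.+1 =
    a n + z * partial_sum (shift_coefs n.+1 a) z k.
  rewrite /partial_sum big_ord_recl expr0 mulr1 /shift_coefs addn0 mulr_sumr.
  congr (_ + _); apply: eq_bigr => i _.
  by rewrite lift0 exprS addnS addSn; ring.
set V := entire_value _ z; set P := partial_sum _ _ _.
have -> : a n + z * V - (a n + z * P) = z * (V - P) by ring.
rewrite modcM (le_trans (ler_wpM2l _ (hM k)))//.
have -> : modc z * (M / 2 ^+ k) = 2 * modc z * M / 2 ^+ k.+1.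
  by rewrite exprS; field; rewrite expf_neq0.
by rewrite ler_wpM2r ?invr_ge0 ?exprn_ge0// lerDl.
Qed.

(* The coefficients of (f w - f z) / (w - z), for f the sum of a. *)
Definition quotient_coefs a z : nat -> R[i] :=
  fun k => entire_value (shift_coefs k.+1 a) z.

(** The constant matters: each division by w - z gains a factor 2 / s, which in [entire_order] has
    to beat |w - z|. *)
Lemma quotient_coef_bound a z s M : 0 < s -> entire_coefs a ->
  coef_bound a s M -> modc z * 2 <= s ->
  coef_bound (quotient_coefs a z) s (2 * M / s).
Proof.
move=> s0 ea h zs k.
have hk := shift_coef_bound k.+1 s0 h.
have := entire_value_bound s0 (entire_shift_coefs _ ea) hk zs.
rewrite -(ler_pM2r (exprn_gt0 k s0)) => /le_trans; apply.
rewrite le_eqVlt; apply/orP; left; apply/eqP.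
by rewrite exprS; field; rewrite expf_neq0 ?gt_eqF.
Qed.

Lemma coef_bound_le a s t M : 0 < s -> s <= t -> coef_bound a t M ->
  coef_bound a s M.
Proof.
move=> s0 st h k; apply: le_trans (h k); apply: ler_wpM2l => //.
by apply: ler_expn => //; exact: ltW.
Qed.

Lemma entire_quotient_coefs a z : entire_coefs a ->
  entire_coefs (quotient_coefs a z).
Proof.
move=> ea s s0; have t0 : 0 < s + modc z * 2 by rewrite ltr_wpDr ?mulr_ge0.
have [M hM] := ea _ t0; exists (2 * M / (s + modc z * 2)).
apply: (coef_bound_le s0 _ (quotient_coef_bound t0 ea hM _)).
  by rewrite lerDl mulr_ge0.
by rewrite lerDr; exact: ltW.
Qed.

(** Horner's rule makes the identity [key] between partial sums exact. Its remainder w^n [e n] is at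
    most 2 M (|w| / s)^n, hence 2 M / 2^n as s >= 2 |w|. *)
Lemma entire_value_quotient a z w : entire_coefs a ->
  entire_value a w =
  entire_value a z + (w - z) * entire_value (quotient_coefs a z) w.
Proof.
move=> ea; pose e n := entire_value (shift_coefs n a) z.
have e0 : entire_value a z = e 0%N by [].
have key n : (w - z) * partial_sum (quotient_coefs a z) w n =
    partial_sum a w n + w ^+ n * e n - e 0%N.
  elim: n => [|n IH].
    by rewrite /partial_sum !big_ord0 mulr0 expr0 mul1r add0r subrr.
  rewrite /partial_sum !big_ord_recr /= mulrDr [X in X + _]IH.
  rewrite /quotient_coefs -/(e n.+1) [e n]entire_value_shift//.
  by rewrite -/(e n.+1) /partial_sum exprS; ring.
apply: entire_valueE => //.
have [N hN] := entire_valueP w (entire_quotient_coefs z ea).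
have s0 : 0 < (modc z + modc w) * 2 + 1.
  by rewrite ltr_wpDl// mulr_ge0// addr_ge0.
have [M hM] := ea _ s0; set s := _ + 1 in s0 hM.
have zs : modc z * 2 <= s.
  by rewrite /s; have := modc_ge0 z; have := modc_ge0 w; lra.
have ws : modc w * 2 <= s.
  by rewrite /s; have := modc_ge0 z; have := modc_ge0 w; lra.
exists (modc (w - z) * N + 2 * M) => n.
set V := entire_value (quotient_coefs a z) w.
have -> : entire_value a z + (w - z) * V - partial_sum a w n =
  (w - z) * (V - partial_sum (quotient_coefs a z) w n) + w ^+ n * e n.
  by rewrite mulrBr key e0; ring.
rewrite (le_trans (modcD _ _))// [leRHS]mulrDl lerD//.
  by rewrite modcM -mulrA ler_wpM2l.
have en : modc (e n) <= 2 * (M / s ^+ n).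
  exact: entire_value_bound s0 (entire_shift_coefs _ ea)
    (shift_coef_bound _ s0 hM) zs.
rewrite modcM modcX ler_pdivlMr ?exprn_gt0// mulrAC -exprMn.
apply: (@le_trans _ _ (s ^+ n * (2 * (M / s ^+ n)))); last first.
  rewrite le_eqVlt; apply/orP; left; apply/eqP; field.
  by rewrite expf_neq0 ?gt_eqF.
apply: ler_pM => //; first by rewrite exprn_ge0// mulr_ge0.
by apply: ler_expn; rewrite ?mulr_ge0.
Qed.

Lemma entire_value_lipschitz a z : entire_coefs a ->
  exists2 K, 0 < K & forall w, modc (w - z) <= 1 ->
    modc (entire_value a w - entire_value a z) <= K * modc (w - z).
Proof.
move=> ea; set b := quotient_coefs a z.
have eb : entire_coefs b by exact: entire_quotient_coefs.
have s0 : 0 < (modc z + 1) * 2 by rewrite mulr_gt0// ltr_wpDl.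
have [M hM] := eb _ s0; have M0 := coef_bound_ge0 hM.
exists (2 * M + 1) => [|w wz]; first by rewrite ltr_wpDl// mulr_ge0.
rewrite (entire_value_quotient z w ea) addrC addKr modcM mulrC ler_wpM2r//.
apply: (@le_trans _ _ (2 * M)); last by rewrite lerDl.
apply: (entire_value_bound s0 eb hM); rewrite ler_pM2r//.
by rewrite -(subrK z w) (le_trans (modcD _ _))// addrC lerD2l.
Qed.

(** Divide by w - z as long as the value at z is 0. If this never stops, then f w = (w - z)^n f_n w
    for every n, where the coefficients of f_n are bounded at radius s by M (2 / s)^n. A radius s >=
    4 |w - z| then gives |f w| <= 2 M / 2^n, so f vanishes identically. *)
Lemma entire_order a z : entire_coefs a ->
  (forall w, entire_value a w = 0) \/
  exists m b, [/\ entire_coefs b, entire_value b z != 0 &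
    forall w, entire_value a w = (w - z) ^+ m * entire_value b w].
Proof.
move=> ea; pose f k := iter k (fun c : nat -> R[i] => quotient_coefs c z) a.
have ef k : entire_coefs (f k).
  by elim: k => [//|k IH]; exact: entire_quotient_coefs.
have [h|h] := pselect (forall k, entire_value (f k) z = 0); last first.
  have [k hk] : exists k, entire_value (f k) z != 0.
    apply: contra_notP h => h k; apply/eqP; apply: contra_notT h => ?.
    by exists k.
  have hmin := ex_minnP (ex_intro (fun k => entire_value (f k) z != 0) k hk).
  case: hmin => m hm mmin; right; exists m, (f m); split=> // w.
  have : forall j, (j <= m)%N ->
      entire_value a w = (w - z) ^+ j * entire_value (f j) w.
    elim=> [|j IH] jm; first by rewrite expr0 mul1r.
    rewrite IH 1?ltnW// (entire_value_quotient z w (ef j)).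
    have /eqP -> : entire_value (f j) z == 0.
      by apply: contraTT jm => /mmin; rewrite -leqNgt.
    by rewrite add0r mulrA -exprSr.
  exact.
left=> w; apply/eqP; rewrite -modc_eq0 eq_le modc_ge0 andbT.
have fact j : entire_value a w = (w - z) ^+ j * entire_value (f j) w.
  elim: j => [|j IH]; first by rewrite expr0 mul1r.
  rewrite IH (entire_value_quotient z w (ef j)) h add0r mulrA -exprSr //.
have t0 : 0 < (modc z + modc w) * 4 + 1.
  by rewrite ltr_wpDl// mulr_ge0// addr_ge0.
have [M hM] := ea _ t0; set s := _ + 1 in t0 hM.
have zs : modc z * 2 <= s.
  by rewrite /s; have := modc_ge0 z; have := modc_ge0 w; lra.
have ws : modc w * 2 <= s.
  by rewrite /s; have := modc_ge0 z; have := modc_ge0 w; lra.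
have wzs : modc (w - z) * 4 <= s.
  rewrite /s; have := modcB w z; have := modc_ge0 z; have := modc_ge0 w; lra.
have bf j : coef_bound (f j) s (M * (2 / s) ^+ j).
  elim: j => [|j IH]; first by rewrite expr0 mulr1.
  have := quotient_coef_bound t0 (ef j) IH zs.
  by rewrite exprS (_ : 2 * _ / s = M * (2 / s * (2 / s) ^+ j))//; ring.
apply: (@le_half_expn_le0 _ (2 * M)) => n.
rewrite (fact n) modcM modcX.
have hb := entire_value_bound t0 (ef n) (bf n) ws.
rewrite (le_trans (ler_wpM2l _ hb)) ?exprn_ge0//.
have -> : modc (w - z) ^+ n * (2 * (M * (2 / s) ^+ n)) =
   2 * M * (modc (w - z) * (2 / s)) ^+ n by rewrite [in RHS]exprMn; set t := (_ / _) ^+ n; ring.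
rewrite -exprVn ler_wpM2l ?mulr_ge0 ?(coef_bound_ge0 hM)//.
apply: ler_expn; first by rewrite mulr_ge0// divr_ge0// ltW.
rewrite mulrA ler_pdivrMr// ler_pdivlMl// (_ : 2 * _ = modc (w - z) * 4)//; ring.
Qed.

End PowerSeries.

(** * Maximum principle for quotients with removable singularities *)

Section MaximumPrinciple.
Variable R : realType.
Implicit Types (a b N H : nat -> R[i]) (z w v c d : R[i]) (s B e : R).

Lemma entire_value_near a z e : entire_coefs a -> 0 < e ->
  exists2 d : R, 0 < d & forall w, modc (w - z) < d ->
    modc (entire_value a w - entire_value a z) < e.
Proof.
move=> ea e0; have [K K0 hK] := entire_value_lipschitz z ea.
exists (Num.min 1 (e / K)); first by rewrite lt_min ltr01 divr_gt0.
move=> w; rewrite lt_min => /andP[w1 wK]; rewrite (le_lt_trans (hK _ (ltW w1)))//.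
by rewrite mulrC -ltr_pdivlMr.
Qed.

Lemma entire_value_near_neq0 a z : entire_coefs a -> entire_value a z != 0 ->
  exists2 d : R, 0 < d & forall w, modc (w - z) < d ->
    modc (entire_value a z) / 2 < modc (entire_value a w).
Proof.
move=> ea az; have az0 : 0 < modc (entire_value a z) / 2.
  by rewrite divr_gt0// modc_gt0.
have [d d0 hd] := entire_value_near z ea az0; exists d => // w /hd.
rewrite modc_dist => h; have := modc_lower (entire_value a z) (entire_value a w).
lra.
Qed.

(** The product (s - z)(s + z) is smaller than e^2, so one of the roots s, - s lies within e of z.
    The sign depends on w, and no branch of the root is involved. *)
Lemma sqrt_near z w e : 0 < e -> modc (w - z ^+ 2) < e ^+ 2 ->
  exists2 v, v ^+ 2 = w & modc (v - z) < e.
Proof.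
move=> e0 h; pose s : R[i] := sqrtC w; have sE : s ^+ 2 = w by exact: sqrtCK.
have [|sz] := ltP (modc (s - z)) e; first by exists s.
exists (- s); first by rewrite sqrrN.
rewrite -opprD modcN ltNge; apply/negP => sz'; move: h; rewrite -sE subr_sqr modcM.
by rewrite ltNge => /negP; apply; rewrite expr2 ler_pM// ltW.
Qed.

(* Either N / H is constant, or N / H = c + (w - z)^k Q near z with Q z <> 0, and
   the direction of w - z is chosen so that (w - z)^k Q z is a positive multiple
   of c (of 1 if c = 0). *)
Lemma quotient_increase N H z : entire_coefs N -> entire_coefs H ->
  entire_value H z != 0 ->
  (forall w, entire_value N w * entire_value H z =
             entire_value N z * entire_value H w) \/
  forall e, 0 < e -> exists2 w, modc (w - z) < e &
    modc (entire_value N z / entire_value H z) <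
    modc (entire_value N w / entire_value H w).
Proof.
move=> eN eH Hz.
(* N / H - N z / H z equals P / (H z H); the order of P at z is the exponent k of the local form. *)
pose P k := entire_value H z * N k + (- entire_value N z) * H k.
have eP : entire_coefs P by exact: entire_coefsD.
have PE w : entire_value P w = entire_value H z * entire_value N w -
    entire_value N z * entire_value H w by rewrite entire_valueD// mulNr.
have [P0|[k [Q [eQ Qz PQ]]]] := entire_order z eP.
  left=> w; apply/eqP; rewrite -subr_eq0 mulrC -PE; exact/eqP/P0.
right=> e e0.
have k0 : (0 < k)%N.
  case: k PQ => // PQ; have := PQ z; rewrite PE expr0 mul1r => h.
  by move: Qz; rewrite -h mulrC subrr eqxx.
set hz := entire_value H z in Hz PE *; set c := entire_value N z / hz.
pose th : R[i] := if c == 0 then 1 else c.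
have th0 : th != 0 by rewrite /th; case: ifPn => // _; exact: oner_neq0.
have [d1 d10 hd1] := entire_value_near_neq0 eH Hz.
pose E k := hz * Q k + (- entire_value Q z) * H k.
have eE : entire_coefs E by exact: entire_coefsD.
have EE w : entire_value E w = hz * entire_value Q w -
    entire_value Q z * entire_value H w by rewrite entire_valueD// mulNr.
have Ez : entire_value E z = 0 by rewrite EE mulrC subrr.
have e1 : 0 < modc (entire_value Q z) * (modc hz / 2).
  by rewrite mulr_gt0 ?divr_gt0 ?modc_gt0.
have [d2 d20 hd2] := entire_value_near z eE e1.
(* For w - z = t eta the increment of N / H is th t^k hz Q w / (Q z H w) = th t^k (1 + dl). The
   relative error [dl] is E w / (Q z H w), and the threshold on E together with |H w| > |hz| / 2
   gives |dl| < 1. *)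
pose eta : R[i] := k.-root (th * hz ^+ 2 / entire_value Q z).
have etaE : eta ^+ k = th * hz ^+ 2 / entire_value Q z by exact: rootCK.
pose del := Num.min e (Num.min d1 d2).
have del0 : 0 < del by rewrite !lt_min e0 d10.
pose t := del / (modc eta + 1) / 2.
have m10 : 0 < modc eta + 1 by rewrite ltr_wpDl.
have t0 : 0 < t by rewrite !divr_gt0.
pose w := z + t%:C * eta.
have wz : w - z = t%:C * eta by rewrite addrC addKr.
have wdel : modc (w - z) < del.
  have tE : t * (modc eta + 1) * 2 = del by rewrite /t; field; rewrite gt_eqF.
  rewrite wz modcM modc_real gtr0_norm//; lra.
move: (wdel); rewrite !lt_min => /and3P[we wd1 wd2].
exists w => //.
have Hw := hd1 _ wd1; have {}hd2 := hd2 _ wd2.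
have Hw0 : entire_value H w != 0.
  by rewrite -modc_gt0 (le_lt_trans _ Hw)// divr_ge0.
pose dl := entire_value E w / (entire_value Q z * entire_value H w).
have NH : entire_value N w / entire_value H w = c + th * (t%:C ^+ k * (1 + dl)).
  have /eqP : entire_value P w = (w - z) ^+ k * entire_value Q w by [].
  rewrite PE wz exprMn etaE /dl EE subr_eq => /eqP h.
  apply: (mulfI Hz); rewrite [LHS]mulrA h /c; field.
  by rewrite Hw0 Qz Hz.
have dl1 : modc dl < 1.
  rewrite /dl modcM modcV modcM ltr_pdivrMr ?mulr_gt0 ?modc_gt0// mul1r.
  rewrite Ez subr0 in hd2; rewrite (lt_trans hd2)// ltr_pM2l ?modc_gt0//.
rewrite -/c NH.
have tk0 : 0 < t ^+ k by rewrite exprn_gt0.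
have tkE : t%:C ^+ k = (t ^+ k)%:C by rewrite rmorphXn.
have dl2 : 0 < modc (1 + dl).
  have := modc_lower 1 (- dl); rewrite opprK modcN modc1; lra.
have [c0|c0] := eqVneq c 0.
  rewrite c0 modc0 add0r modc_gt0 !mulf_neq0//; last by rewrite -modc_gt0.
  by rewrite tkE -modc_gt0 modc_real normr_gt0 gt_eqF.
rewrite /th (negbTE c0) -[X in X + _]mulr1 -mulrDr modcM ltr_pMr ?modc_gt0//.
have -> : 1 + t%:C ^+ k * (1 + dl) = (1 + t ^+ k)%:C - (- (t%:C ^+ k * dl)).
  by rewrite rmorphD rmorphXn rmorph1; ring.
apply: lt_le_trans (modc_lower _ _).
rewrite modcN modcM tkE !modc_real !gtr0_norm ?addr_gt0//.
by rewrite ltrBrDr ltrD2l gtr_pMr.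
Qed.

(** Since H z is nonzero, m is the order of b at z, whereas N z may vanish: N / H extends a / b
    across z. *)
Definition divisible_at a b z := exists m N H,
  [/\ entire_coefs N, entire_coefs H, entire_value H z != 0,
      forall w, entire_value a w = (w - z) ^+ m * entire_value N w &
      forall w, entire_value b w = (w - z) ^+ m * entire_value H w].

(* The quotient is considered in the variable rho, on a square |Re rho|, |Im rho|
   <= r. *)
Lemma square_maximum_principle a b (r B : R) : 0 < r ->
  (forall z, divisible_at a b z) ->
  (forall x y, `|x| <= r -> `|y| <= r -> `|x| = r \/ `|y| = r ->
     entire_value b ((x +i* y) ^+ 2) != 0 /\
     modc (entire_value a ((x +i* y) ^+ 2)) <=
       B * modc (entire_value b ((x +i* y) ^+ 2))) ->
  forall x y, `|x| <= r -> `|y| <= r ->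
     modc (entire_value a ((x +i* y) ^+ 2)) <=
       B * modc (entire_value b ((x +i* y) ^+ 2)).
Proof.
move=> r0 dvd bdy.
pose T := (nat * (nat -> R[i]) * (nat -> R[i]))%type.
pose dvdP z (t : T) := [/\ entire_coefs t.1.2, entire_coefs t.2,
    entire_value t.2 z != 0,
    forall w, entire_value a w = (w - z) ^+ t.1.1 * entire_value t.1.2 w &
    forall w, entire_value b w = (w - z) ^+ t.1.1 * entire_value t.2 w].
have /choice[f hf] : forall z, exists t, dvdP z t.
  by move=> z; have [m [N [H h]]] := dvd z; exists (m, N, H).
pose N z := entire_value (f z).1.2; pose H z := entire_value (f z).2.
pose g z := modc (N z z / H z z).
(* The factorizations are chosen point by point. Near z, at w different from z, b w is nonzero, so
   the factorization at w has exponent 0 and gives the same quotient as the one at z. *)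
have gnear z : exists2 d : R, 0 < d & forall w, modc (w - z) < d ->
    H z w != 0 /\ g w = modc (N z w / H z w).
  have [eN eH Hz ha hb] := hf z.
  have [d d0 hd] := entire_value_near_neq0 eH Hz; exists d => // w /hd h.
  have Hw : H z w != 0 by rewrite -modc_gt0 (le_lt_trans _ h)// divr_ge0.
  split=> //; have [<-//|wz] := eqVneq z w.
  have [eN' eH' Hw' ha' hb'] := hf w.
  have wz0 : w - z != 0 by rewrite subr_eq0 eq_sym.
  have m0 : (f w).1.1 = 0%N.
    apply/eqP; have := hb' w; rewrite hb subrr expr0n.
    by case: (_ == 0%N) => // /eqP; rewrite mul0r mulf_eq0 expf_eq0 (negbTE wz0) andbF (negbTE Hw).
  have := hb' w; have := ha' w; rewrite m0 ha hb !expr0 !mul1r /g /N /H => <- <-.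
  by rewrite -mulf_div divff ?mul1r// expf_neq0.
have gcont z e : 0 < e -> exists2 d : R, 0 < d & forall w, modc (w - z) < d ->
    `|g w - g z| < e.
  move=> e0; have [eN eH Hz _ _] := hf z.
  have [d1 d10 hd1] := gnear z.
  have [d2 d20 hd2] := entire_value_near_neq0 eH Hz.
  pose P k := H z z * (f z).1.2 k + (- N z z) * (f z).2 k.
  have eP : entire_coefs P by exact: entire_coefsD.
  have PE w : entire_value P w = H z z * N z w - N z z * H z w.
    by rewrite entire_valueD// mulNr.
  have Pz : entire_value P z = 0 by rewrite PE mulrC subrr.
  have e1 : 0 < e * (modc (H z z) / 2 * modc (H z z)).
    by rewrite !mulr_gt0 ?invr_gt0 ?modc_gt0.
  have [d3 d30 hd3] := entire_value_near z eP e1.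
  exists (Num.min d1 (Num.min d2 d3)); first by rewrite !lt_min d10 d20.
  move=> w; rewrite !lt_min => /and3P[/hd1[Hw gw] /hd2 w2 /hd3].
  rewrite Pz subr0 PE => w3.
  have hh : `|g w - g z| <= modc (N z w / H z w - N z z / H z z).
    rewrite gw /g; have := modc_lower (N z w / H z w) (N z z / H z z).
    have := modc_lower (N z z / H z z) (N z w / H z w).
    rewrite [modc (N z z / _ - _)]modc_dist ler_norml => h1 h2.
    by apply/andP; split; lra.
  apply: (le_lt_trans hh).
  have -> : N z w / H z w - N z z / H z z =
      (H z z * N z w - N z z * H z w) / (H z w * H z z).
    by field; rewrite Hw Hz.
  rewrite modcM modcV modcM ltr_pdivrMr ?mulr_gt0 ?modc_gt0//.
  apply: (lt_le_trans w3); rewrite ler_pM2l// ler_pM2r ?modc_gt0//.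
  exact: ltW.
pose A : set (R * R) := `[-r, r]%classic `*` `[-r, r]%classic.
have cA : compact A by apply: compact_setX; exact: segment_compact.
have AE p : A p <-> `|p.1| <= r /\ `|p.2| <= r.
  by rewrite /A /= !in_itv/= !ler_norml.
have A0 : A !=set0 by exists (0, 0); apply/AE; rewrite normr0 ltW.
(* The modulus of the extended quotient is pulled back to rho, where the domain is a compact product
   of two intervals. *)
pose F (p : R * R) := g ((p.1 +i* p.2) ^+ 2).
have cF : {within A, continuous F}.
  apply: continuous_subspaceT => p; apply/cvgrPdist_lt => e e0.
  have [d d0 hd] := gcont ((p.1 +i* p.2) ^+ 2) e e0.
  pose K := 2 * (2 * modc (p.1 +i* p.2) + 2).
  have K0 : 0 < K by rewrite /K; have := modc_ge0 (p.1 +i* p.2); lra.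
  pose t := Num.min 1 (d / K).
  have t0 : 0 < t by rewrite lt_min ltr01 divr_gt0.
  exists (ball p.1 t, ball p.2 t) => /=; first by split; exact: nbhsx_ballx.
  move=> -[x y] [/= hx hy].
  rewrite distrC; apply: hd; rewrite subr_sqr modcM /=.
  have {}hx : `|x - p.1| < t by rewrite distrC.
  have {}hy : `|y - p.2| < t by rewrite distrC.
  have q1 : modc (x +i* y - (p.1 +i* p.2)) < 2 * t.
    apply: (le_lt_trans (modc_le_ReIm _)) => /=; lra.
  have t1 : t <= 1 by rewrite ge_min lexx.
  have tK : t <= d / K by rewrite ge_min lexx orbT.
  have q2 : modc (x +i* y + (p.1 +i* p.2)) <= 2 * modc (p.1 +i* p.2) + 2.
    have -> : x +i* y + (p.1 +i* p.2) =
       (x +i* y - (p.1 +i* p.2)) + ((p.1 +i* p.2) + (p.1 +i* p.2)) by ring.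
    rewrite (le_trans (modcD _ _))//.
    have := modcD (p.1 +i* p.2) (p.1 +i* p.2); lra.
  have k0 : 0 < 2 * modc (p.1 +i* p.2) + 2.
    by have := modc_ge0 (p.1 +i* p.2); lra.
  apply: (@le_lt_trans _ _ (modc (x +i* y - (p.1 +i* p.2)) *
    (2 * modc (p.1 +i* p.2) + 2))); first by rewrite ler_wpM2l.
  apply: (@lt_le_trans _ _ (2 * t * (2 * modc (p.1 +i* p.2) + 2))).
    by rewrite ltr_pM2r.
  rewrite (_ : _ * _ = t * K); last by rewrite /K; ring.
  by rewrite -ler_pdivlMr.
have [p0 Ap0 hp0] := compact_EVT_max A0 cA cF.
suff gB : F p0 <= B.
  move=> x y hx hy; set w := (_ ^+ 2).
  have hw : g w <= B.
    by apply: le_trans gB; apply: (hp0 (x, y)); rewrite inE; apply/AE.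
  have [_ _ Hw -> ->] := hf w; rewrite !modcM mulrCA ler_wpM2l//.
  by rewrite -ler_pdivrMr ?modc_gt0// -modcV -modcM.
have gbd x y : `|x| <= r -> `|y| <= r -> `|x| = r \/ `|y| = r ->
    g ((x +i* y) ^+ 2) <= B.
  move=> hx hy hxy; have [b0 ab] := bdy x y hx hy hxy.
  set w := (_ ^+ 2) in b0 ab *; have [_ _ Hw ha hb] := hf w.
  have m0 : (f w).1.1 = 0%N.
    apply/eqP; move: b0; rewrite hb subrr expr0n.
    by case: (_ == 0%N) => //; rewrite mul0r eqxx.
  move: ab; rewrite ha hb m0 !expr0 !mul1r /g modcM modcV ler_pdivrMr//.
  by rewrite modc_gt0.
have /AE[x0r y0r] : A p0 by move: Ap0; rewrite inE.
have [xr|xr] := eqVneq `|p0.1| r; first by apply: gbd => //; left.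
have [yr|yr] := eqVneq `|p0.2| r; first by apply: gbd => //; right.
have {}xr : `|p0.1| < r by rewrite lt_neqAle xr.
have {}yr : `|p0.2| < r by rewrite lt_neqAle yr.
set rho := p0.1 +i* p0.2; set z := rho ^+ 2.
have [eN eH Hz ha hb] := hf z.
(* At an interior maximum, a constant quotient has the same modulus at the boundary point rho = r,
   where it is at most B. Otherwise a larger value occurs arbitrarily near z, and a square root
   close to rho brings that point back into the square. *)
have [const|incr] := quotient_increase eN eH Hz.
  have rr : `|r| = r by rewrite gtr0_norm.
  have hr : `|r| <= r by rewrite rr.
  have h0 : `|0 : R| <= r by rewrite normr0 ltW.
  have [b0 ab] := bdy r 0 hr h0 (or_introl rr).
  set w := (_ ^+ 2) in b0 ab.
  have := const w; rewrite -/(N z w) -/(H z z) -/(N z z) -/(H z w) => e1.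
  have e2 : entire_value a w = N z z / H z z * entire_value b w.
    have -> : entire_value a w = (w - z) ^+ (f z).1.1 * (N z w * H z z) / H z z.
      by rewrite mulrA mulfK// ha.
    by rewrite e1 hb /H; ring.
  move: ab; rewrite e2 modcM ler_pM2r ?modc_gt0//.
have [d d0 hd] := gnear z.
pose e1 := Num.min (r - `|p0.1|) (r - `|p0.2|).
have e10 : 0 < e1 by rewrite lt_min !subr_gt0 xr.
have e20 : 0 < Num.min d (e1 ^+ 2) by rewrite lt_min d0 exprn_gt0.
have [w] := incr _ e20; rewrite lt_min => /andP[wd we] hN.
have [v vw vrho] := sqrt_near e10 we.
have Av : A (complex.Re v, complex.Im v).
  apply/AE => /=; move: vrho; rewrite lt_min => /andP[v1 v2].
  have h1 := Re_le_modcB v rho; have h2 := Im_le_modcB v rho.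
  have := lerB_normD (complex.Re v - p0.1) p0.1.
  move: h1 h2; rewrite /rho /= => h1 h2.
  have h3 := ler_normD (complex.Re v - p0.1) p0.1.
  have h4 := ler_normD (complex.Im v - p0.2) p0.2.
  rewrite subrK in h3; rewrite subrK in h4; split; lra.
have := hp0 _ (mem_set Av).
rewrite /F /= -/rho -/z (_ : _ +i* _ = v); last by case: (v).
by rewrite vw (hd _ wd).2 leNgt hN.
Qed.

End MaximumPrinciple.

(** * Multiplicity of zeros *)

Lemma order_le_eq (K : numFieldType) (g h : K -> K) (z : K) (m k : nat) :
  {for z, continuous g} -> {for z, continuous h} -> g z != 0 -> (m <= k)%N ->
  (\forall w \near z, (w - z) ^+ m * g w = (w - z) ^+ k * h w) -> m = k.
Proof.
move=> cg ch gz mk hE; apply/eqP; rewrite eqn_leq mk /=.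
rewrite -subn_eq0; apply: contraNT gz => km.
(* Cancel (w - z)^m away from z and let w tend to z: for m < k the right-hand side tends to 0. *)
suff -> : g z = (z - z) ^+ (k - m) * h z by rewrite subrr expr0n (negbTE km) mul0r.
apply: (@cvg_unique _ _ (g @ z^')); first exact: norm_hausdorff.
  by move=> A /cg; exact: nbhs_dnbhs.
suff : (fun w => (w - z) ^+ (k - m) * h w) @ z^' --> (z - z) ^+ (k - m) * h z.
  apply: cvg_trans; apply: near_eq_cvg.
  near=> w.
  have wz : w - z != 0 by rewrite subr_eq0; near: w; exact: nbhs_dnbhs_neq.
  apply: (mulfI (expf_neq0 m wz)); rewrite mulrA -exprD subnKC//.
  by apply/esym; near: w; exact: nbhs_dnbhs.
suff ch' : {for z, continuous (fun w => (w - z) ^+ (k - m) * h w)}.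
  by move=> A /ch'; exact: nbhs_dnbhs.
elim: (k - m)%N => [|n IH].
  suff -> : (fun w => (w - z) ^+ 0 * h w) = h by [].
  by apply/funext => w; rewrite expr0 mul1r.
have -> : (fun w => (w - z) ^+ n.+1 * h w) =
    (fun w => (w - z) * ((w - z) ^+ n * h w)).
  by apply/funext => w; rewrite exprS mulrA.
have cs : {for z, continuous (fun w : K => w - z)}.
  move=> A /nbhs_normP[e /= e0 hA]; apply/nbhs_normP; exists e => //= w /= wz.
  by apply: hA => /=; rewrite (_ : _ - _ = z - w)//; ring.
exact: (continuousM cs IH).
Unshelve. all: by end_near. Qed.

Section ZeroOrder.
Variable R : realType.
Implicit Types (a b : nat -> R[i]) (z w : R[i]).

Local Notation C := (R[i] : numFieldType).

Lemma entire_value_continuous a z : entire_coefs a ->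
  {for z, continuous (entire_value a : C -> C)}.
Proof.
move=> ea A /nbhs_normP[e /= e0 hA].
have eE : e = (complex.Re e)%:C by rewrite RRe_real// gtr0_real.
have e'0 : 0 < complex.Re e by rewrite -ltcR -eE.
have [d d0 hd] := entire_value_near z ea e'0.
apply/nbhs_normP; exists d%:C; rewrite /= ?ltcR//.
move=> w /=; rewrite -!modcE ltcR modc_dist => /hd h; apply: hA => /=.
by rewrite eE -modcE ltcR modc_dist.
Qed.

(** The holomorphic cofactor of [zero_of_order] and the power series cofactor are both continuous
    and nonzero at z, which forces equal exponents. *)
Lemma zero_of_order_entire (f : R[i] -> R[i]) b z (m k : nat) :
  entire_coefs b -> entire_value b z != 0 ->
  (forall w, f w = (w - z) ^+ k * entire_value b w) ->
  zero_of_order f z m -> m = k.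
Proof.
move=> eb bz fE [g [/nbhs_singleton dg gz fg]].
have cg : {for z, continuous g}.
  exact/differentiable_continuous/derivable1_diffP.
have cb := @entire_value_continuous b z eb.
case: (leqP m k) => [mk|/ltnW km].
  apply: (order_le_eq cg cb gz mk).
  by move: fg; apply: filterS => w <-; rewrite fE.
apply/esym; apply: (order_le_eq cb cg bz km).
by move: fg; apply: filterS => w <-; rewrite fE.
Qed.

(** A common order lets the same power of w - z be taken out of a - b; the points where a and b do
    not vanish exclude the degenerate case of [entire_order]. *)
Lemma same_zeros_divisible a b z (m : nat) :
  entire_coefs a -> entire_coefs b ->
  (exists w, entire_value a w != 0) -> (exists w, entire_value b w != 0) ->
  zero_of_order (entire_value a) z m -> zero_of_order (entire_value b) z m ->
  divisible_at (fun k => 1 * a k + (- 1) * b k) b z.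
Proof.
move=> ea eb [wa ha] [wb hb] za zb.
have [a0|[k [A [eA Az aA]]]] := entire_order z ea.
  by rewrite a0 eqxx in ha.
have [b0|[j [B [eB Bz bB]]]] := entire_order z eb.
  by rewrite b0 eqxx in hb.
have mk := zero_of_order_entire eA Az aA za.
have mj := zero_of_order_entire eB Bz bB zb.
exists m, (fun k => 1 * A k + (- 1) * B k), B; split=> //.
- exact: entire_coefsD.
- by move=> w; rewrite !entire_valueD// aA bB -mk -mj; ring.
- by move=> w; rewrite bB mj.
Qed.

End ZeroOrder.

(** * Integration of complex-valued functions *)

Section IntegralToolkit.
Variable R : realType.
Local Notation leb := (@lebesgue_measure R).
Implicit Types (D E : set (measurableTypeR R)) (f g : R -> R[i]) (u v : R).

Lemma ae_imp (P Q : R -> Prop) : {ae leb, forall x, P x} ->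
  (forall x, P x -> Q x) -> {ae leb, forall x, Q x}.
Proof. by move=> h PQ; apply: negligibleS h => x /=; apply: contra_not => /PQ. Qed.

Lemma ae_and (P Q : R -> Prop) : {ae leb, forall x, P x} ->
  {ae leb, forall x, Q x} -> {ae leb, forall x, P x /\ Q x}.
Proof.
move=> h1 h2; apply: negligibleS (negligibleU h1 h2) => x /= h.
by apply: contrapT => /not_orP[/contrapT ? /contrapT ?]; apply: h.
Qed.

Lemma L1_cmeasurable D f : L1 D f -> cmeasurable D f.
Proof. by move=> [/measurable_int/measurable_EFinP ? /measurable_int/measurable_EFinP ?]. Qed.

Lemma L1_sub D E f : measurable D -> measurable E -> E `<=` D -> L1 D f -> L1 E f.
Proof. by move=> mD mE ED [h1 h2]; split; exact: (integrableS mD mE ED). Qed.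

Lemma L1D D f g : measurable D -> L1 D f -> L1 D g -> L1 D (fun x => f x + g x).
Proof.
move=> mD [f1 f2] [g1 g2]; split.
- apply: (eq_integrable mD _ _ _ (integrableD mD f1 g1)) => x _ /=.
  by case: (f x) (g x) => ? ? [].
- apply: (eq_integrable mD _ _ _ (integrableD mD f2 g2)) => x _ /=.
  by case: (f x) (g x) => ? ? [].
Qed.

Lemma L1Z D (c : R[i]) f : measurable D -> L1 D f -> L1 D (fun x => c * f x).
Proof.
move=> mD [f1 f2]; case: c => a b; split.
- apply: (eq_integrable mD _ _ _ (integrableB mD (integrableZl mD a f1) (integrableZl mD b f2))).
  by move=> x _ /=; case: (f x).
- apply: (eq_integrable mD _ _ _ (integrableD mD (integrableZl mD a f2) (integrableZl mD b f1))).
  by move=> x _ /=; case: (f x).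
Qed.

Lemma cintegralD D f g : measurable D -> L1 D f -> L1 D g ->
  cintegral D (fun x => f x + g x) = cintegral D f + cintegral D g.
Proof.
move=> mD [f1 f2] [g1 g2]; rewrite /cintegral.
rewrite -[RHS]/(_ +i* _) -!RintegralD//.
by congr (_ +i* _); apply: eq_Rintegral => x _; case: (f x) (g x) => ? ? [].
Qed.

Lemma cintegralZ D (c : R[i]) f : measurable D -> L1 D f ->
  cintegral D (fun x => c * f x) = c * cintegral D f.
Proof.
move=> mD [f1 f2]; case: c => a b; rewrite /cintegral.
have ia h (r : R) : leb.-integrable D (EFin \o h) ->
   leb.-integrable D (EFin \o (fun x => r * h x)).
  move=> ih; apply: (eq_integrable mD _ _ _ (integrableZl mD r ih)) => x _ //=.
rewrite -[RHS]/(_ +i* _) -!RintegralZl// -RintegralB ?ia// -RintegralD ?ia//.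
by congr (_ +i* _); apply: eq_Rintegral => x _; case: (f x).
Qed.

Lemma cintegralB D f g : measurable D -> L1 D f -> L1 D g ->
  cintegral D (fun x => f x - g x) = cintegral D f - cintegral D g.
Proof.
move=> mD f1 g1.
have -> : (fun x => f x - g x) = (fun x => f x + (- 1) * g x).
  by apply/funext => x; rewrite mulN1r.
by rewrite cintegralD ?cintegralZ ?mulN1r//; exact: L1Z.
Qed.

Lemma L1B D f g : measurable D -> L1 D f -> L1 D g -> L1 D (fun x => f x - g x).
Proof.
move=> mD f1 g1.
have -> : (fun x => f x - g x) = (fun x => f x + (- 1) * g x).
  by apply/funext => x; rewrite mulN1r.
by apply: L1D => //; exact: L1Z.
Qed.

Lemma eq_cintegral D f g : {in D, f =1 g} -> cintegral D f = cintegral D g.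
Proof.
move=> fg; rewrite /cintegral.
by congr (_ +i* _); apply: eq_Rintegral => x /fg ->.
Qed.

Lemma eq_L1 D f g : measurable D -> (forall x, D x -> f x = g x) ->
  L1 D f -> L1 D g.
Proof.
move=> mD fg [f1 f2]; split.
- by apply: (eq_integrable mD _ _ _ f1) => x /[!inE] /fg ->.
- by apply: (eq_integrable mD _ _ _ f2) => x /[!inE] /fg ->.
Qed.

Lemma ae_eq_cintegral D f g : measurable D -> L1 D f -> L1 D g ->
  ae_eq_on D f g -> cintegral D f = cintegral D g.
Proof.
move=> mD [f1 f2] [g1 g2] fg; rewrite /cintegral /Rintegral.
congr (fine _ +i* fine _); apply: ae_eq_integral => //.
- exact: measurable_int f1.
- exact: measurable_int g1.
- apply: (ae_imp (P := fun x => D x -> f x = g x) fg) => x h Dx.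
  by rewrite /= h.
- exact: measurable_int f2.
- exact: measurable_int g2.
- apply: (ae_imp (P := fun x => D x -> f x = g x) fg) => x h Dx.
  by rewrite /= h.
Qed.

(** With |Re| + |Im| in place of the modulus, integrability reduces to that of the two parts; the
    price is a factor 2 in [l1norm_le]. *)
Definition l1norm D f : R :=
  \int[leb]_(x in D) (`|complex.Re (f x)| + `|complex.Im (f x)|).

Lemma integrable_l1norm D f : measurable D -> L1 D f ->
  leb.-integrable D
    (EFin \o (fun x => `|complex.Re (f x)| + `|complex.Im (f x)|)).
Proof.
move=> mD [f1 f2].
by apply: (eq_integrable mD _ _ _ (integrableD mD (integrable_norm f1) (integrable_norm f2))).
Qed.

Lemma l1norm_ge0 D f : 0 <= l1norm D f.
Proof. by apply: Rintegral_ge0 => x _; rewrite addr_ge0. Qed.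

Lemma cintegral_le_l1norm D f : measurable D -> L1 D f ->
  modc (cintegral D f) <= l1norm D f.
Proof.
move=> mD Lf; have [f1 f2] := Lf; apply: (le_trans (modc_le_ReIm _)) => /=.
rewrite /l1norm RintegralD ?(integrable_norm f1) ?(integrable_norm f2)//.
by apply: lerD; apply: le_normr_Rintegral.
Qed.

Lemma l1norm_le D f g (B : R) : measurable D -> L1 D f -> L1 D g -> 0 <= B ->
  (forall x, D x -> modc (g x) <= B * modc (f x)) ->
  l1norm D g <= 2 * B * l1norm D f.
Proof.
move=> mD Lf Lg B0 gf.
rewrite /l1norm -RintegralZl//; last exact: integrable_l1norm.
apply: le_Rintegral => //; first exact: integrable_l1norm.
  by apply: (eq_integrable mD _ _ _ (integrableZl mD (2 * B) (integrable_l1norm mD Lf))).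
move=> x Dx; have := gf x Dx; have := Re_le_modc (g x); have := Im_le_modc (g x).
have h := ler_wpM2l B0 (modc_le_ReIm (f x)); lra.
Qed.

Lemma cintegral_le D f g (B : R) : measurable D -> L1 D f -> L1 D g -> 0 <= B ->
  (forall x, D x -> modc (g x) <= B * modc (f x)) ->
  modc (cintegral D g) <= 2 * B * l1norm D f.
Proof.
move=> mD Lf Lg B0 gf; apply: le_trans (l1norm_le mD Lf Lg B0 gf).
exact: cintegral_le_l1norm.
Qed.

Lemma cmeasurableM D f g : measurable D -> cmeasurable D f -> cmeasurable D g ->
  cmeasurable D (fun x => f x * g x).
Proof.
move=> mD [f1 f2] [g1 g2]; split.
- apply: (eq_measurable_fun (fun x => complex.Re (f x) * complex.Re (g x) -
     complex.Im (f x) * complex.Im (g x))).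
    by move=> x _; case: (f x) (g x) => ? ? [].
  by apply: measurable_funB; exact: measurable_funM.
- apply: (eq_measurable_fun (fun x => complex.Re (f x) * complex.Im (g x) +
     complex.Im (f x) * complex.Re (g x))).
    by move=> x _; case: (f x) (g x) => ? ? [].
  by apply: measurable_funD; exact: measurable_funM.
Qed.

Lemma L1_dominated D f g (B : R) : measurable D -> L1 D f -> cmeasurable D g ->
  (forall x, D x -> modc (g x) <= B * modc (f x)) -> L1 D g.
Proof.
move=> mD Lf [g1 g2] gf.
have i := integrableZl mD `|B| (integrable_l1norm mD Lf).
have gf' x : D x -> modc (g x) <= `|B| * (`|complex.Re (f x)| + `|complex.Im (f x)|).
  move=> /gf/le_trans; apply.
  apply: (@le_trans _ _ (`|B| * modc (f x))); first by rewrite ler_wpM2r// ler_norm.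
  by rewrite ler_wpM2l// modc_le_ReIm.
split.
- apply: (le_integrable mD _ _ i); first exact/measurable_EFinP.
  move=> x Dx /=; rewrite lee_fin normrM normr_id ger0_norm ?addr_ge0//.
  exact: le_trans (Re_le_modc _) (gf' _ Dx).
- apply: (le_integrable mD _ _ i); first exact/measurable_EFinP.
  move=> x Dx /=; rewrite lee_fin normrM normr_id ger0_norm ?addr_ge0//.
  exact: le_trans (Im_le_modc _) (gf' _ Dx).
Qed.

Lemma L1_bounded_mul D f g (B : R) : measurable D -> cmeasurable D g ->
  (forall x, D x -> modc (g x) <= B) -> L1 D f -> L1 D (fun x => g x * f x).
Proof.
move=> mD mg gB Lf; apply: (L1_dominated (B := B) mD Lf).
  by apply: cmeasurableM => //; exact: L1_cmeasurable.
by move=> x Dx; rewrite modcM ler_wpM2r// gB.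
Qed.

Lemma integrable_oo_cc (u v : R) (h : R -> R) :
  leb.-integrable `]u, v[ (EFin \o h) -> leb.-integrable `[u, v] (EFin \o h).
Proof.
move=> /integrableP[mh ih].
have mh1 : measurable_fun `]u, v] (EFin \o h).
  exact/emeasurable_fun_itv_bndo_bndcP.
have mh2 : measurable_fun `[u, v] (EFin \o h).
  exact/emeasurable_fun_itv_obnd_cbndP.
apply/integrableP; split => //; move: ih.
rewrite integral_itv_bndo_bndc; last exact: measurableT_comp.
by rewrite integral_itv_obnd_cbnd//; exact: measurableT_comp.
Qed.

Lemma Rintegral_chasles (u v w : R) (h : R -> R) : u <= v -> v <= w ->
  leb.-integrable `]u, w[ (EFin \o h) ->
  \int[leb]_(x in `]u, w[) h x =
  \int[leb]_(x in `]u, v[) h x + \int[leb]_(x in `]v, w[) h x.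
Proof.
move=> uv vw ih.
have [->|uv'] := eqVneq u v; first by rewrite set_itvoo0 Rintegral_set0 add0r.
have {uv'}uv : u < v by rewrite lt_neqAle uv'.
have [<-|vw'] := eqVneq v w; first by rewrite set_itvoo0 Rintegral_set0 addr0.
have {vw'}vw : v < w by rewrite lt_neqAle vw'.
have s1 : `]u, v]%classic `<=` `]u, w[.
  by move=> x /=; rewrite !in_itv/= => /andP[-> /le_lt_trans]; apply.
have s2 : `]v, w[%classic `<=` `]u, w[.
  by move=> x /=; rewrite !in_itv/= => /andP[/(lt_trans uv)-> ->].
have E : `]u, w[%classic = `]u, v] `|` `]v, w[.
  by apply: (@itv_bndbnd_setU _ _ (BRight u) (BRight v) (BLeft w)); rewrite bnd_simp ?ltW.
rewrite E Rintegral_setU -?E//; last first.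
  rewrite disj_set2E; apply/eqP/seteqP; split=> // x [] /=.
  by rewrite !in_itv/= => /andP[_ xv] /andP[/(le_lt_trans xv)]; rewrite ltxx.
congr (_ + _); rewrite [RHS]Rintegral_itv_bndo_bndc//.
by apply: integrableS ih => // x /= ; rewrite !in_itv/= => /andP[-> /lt_trans]; apply.
Qed.

Lemma itv_oo_sub (u u' v v' : R) : u <= u' -> v' <= v ->
  `]u', v'[%classic `<=` `]u, v[.
Proof.
move=> uu vv x /=; rewrite !in_itv/= => /andP[h1 h2].
by rewrite (le_lt_trans uu h1) (lt_le_trans h2 vv).
Qed.

Lemma L1_itv (u u' v v' : R) f : u <= u' -> v' <= v -> L1 `]u, v[ f -> L1 `]u', v'[ f.
Proof. by move=> uu vv; apply: L1_sub => //; exact: itv_oo_sub. Qed.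

Lemma cintegral_chasles (u v w : R) f : u <= v -> v <= w -> L1 `]u, w[ f ->
  cintegral `]u, w[ f = cintegral `]u, v[ f + cintegral `]v, w[ f.
Proof.
move=> uv vw [f1 f2]; rewrite /cintegral (Rintegral_chasles uv vw f1).
by rewrite (Rintegral_chasles uv vw f2).
Qed.

Lemma l1norm_chasles (u v w : R) f : u <= v -> v <= w -> L1 `]u, w[ f ->
  l1norm `]u, w[ f = l1norm `]u, v[ f + l1norm `]v, w[ f.
Proof.
by move=> uv vw Lf; rewrite /l1norm (Rintegral_chasles uv vw)//; exact: integrable_l1norm.
Qed.

Lemma integrable_glue (u v w : R) (h : R -> R) : u <= v -> v <= w ->
  leb.-integrable `]u, v[ (EFin \o h) -> leb.-integrable `]v, w[ (EFin \o h) ->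
  leb.-integrable `]u, w[ (EFin \o h).
Proof.
move=> uv vw h1 h2.
have h3 := integrable_oo_cc h1; have h4 := integrable_oo_cc h2.
have E : `[u, w]%classic = `[u, v] `|` `]v, w].
  by apply: (@itv_bndbnd_setU _ _ (BLeft u) (BRight v) (BRight w)); rewrite bnd_simp.
have {}h4 : leb.-integrable `]v, w] (EFin \o h).
  by apply: integrableS h4 => //; exact: subset_itv_oc_cc.
suff h5 : leb.-integrable `[u, w] (EFin \o h).
  by apply: integrableS h5 => //; exact: subset_itv_oo_cc.
have mh : measurable_fun `[u, w] (EFin \o h).
  rewrite E; apply/measurable_funU => //.
  by split; [exact: measurable_int h3|exact: measurable_int h4].
apply/integrableP; split => //; rewrite E ge0_integral_setU//.
- by rewrite lte_add_pinfty//; [case/integrableP: h3|case/integrableP: h4].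
- by rewrite -E; exact: measurableT_comp.
- rewrite disj_set2E; apply/eqP/seteqP; split=> // x [] /=.
  by rewrite !in_itv/= => /andP[_ xv] /andP[/(le_lt_trans xv)]; rewrite ltxx.
Qed.

End IntegralToolkit.

(** * Measure-preserving substitutions: translations and reflections *)

Section MeasurePreserving.
Variable R : realType.
Local Notation leb := (@lebesgue_measure R).
Local Notation mR := (measurableTypeR R).

Lemma lebesgue_measure_shift (c : R) (A : set mR) : measurable A ->
  leb ((fun x : mR => x + c : mR) @^-1` A) = leb A.
Proof.
move=> mA; rewrite -/(pushforward leb (fun x : mR => x + c : mR) A).
apply/esym/lebesgue_measure_unique => //=; first exact: measurable_funD.
move=> _ _ [[a b]] _ <-; rewrite /pushforward.
have -> : (fun x : mR => x + c : mR) @^-1` `]a, b] = `]a - c, b - c]%classic.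
  by apply/seteqP; split=> x /=; rewrite !in_itv/= ltrBlDr lerBrDr.
rewrite !lebesgue_measure_itv/= !lte_fin ltrD2r.
by rewrite -!EFinB opprB addrA subrK.
Qed.

Lemma lebesgue_measure_reflect (c : R) (A : set mR) : measurable A ->
  leb ((fun x : mR => c - x : mR) @^-1` A) = leb A.
Proof.
move=> mA; pose B : set mR := (fun x : mR => x + c : mR) @^-1` A.
have mB : measurable B.
  rewrite -[B]setTI; apply: (_ : measurable_fun setT (fun x : mR => x + c : mR)) => //.
  exact: measurable_funD.
have -> : (fun x : mR => c - x : mR) @^-1` A = (-%R : _ -> mR) @^-1` B.
  by apply/seteqP; split=> x /=; rewrite addrC.
rewrite -/(pushforward leb (-%R : _ -> mR) B) lebesgue_measureN//.
exact: lebesgue_measure_shift.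
Qed.

Variable phi : R -> R.
Hypothesis mphi : measurable_fun [set: mR] (phi : mR -> mR).
Hypothesis phiE : forall A : set mR, measurable A ->
  leb ((phi : mR -> mR) @^-1` A) = leb A.
Implicit Types (D : set mR) (h : R -> R) (f : R -> R[i]).

Lemma measurable_preimage D : measurable D -> measurable ((phi : mR -> mR) @^-1` D).
Proof. by move=> mD; rewrite -[X in measurable X]setTI; exact: mphi. Qed.

Lemma ae_comp (P : R -> Prop) : {ae leb, forall x, P x} ->
  {ae leb, forall x, P (phi x)}.
Proof.
move=> [N [mN N0 PN]]; exists ((phi : mR -> mR) @^-1` N); split.
- exact: measurable_preimage.
- by rewrite phiE.
- by move=> x /= h; apply: PN.
Qed.

Lemma measurable_fun_comp_preimage D h : measurable D -> measurable_fun D h ->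
  measurable_fun ((phi : mR -> mR) @^-1` D) (h \o phi).
Proof.
move=> mD mh; apply: (measurable_comp mD) => //; first by move=> _ [x Dx <-].
exact: measurable_funTS.
Qed.

Lemma integrable_comp_preimage D h : measurable D ->
  leb.-integrable D (EFin \o h) ->
  leb.-integrable ((phi : mR -> mR) @^-1` D) (EFin \o (h \o phi)).
Proof.
move=> mD /integrableP[/measurable_EFinP mh ih]; apply/integrableP; split.
  by apply/measurable_EFinP; exact: measurable_fun_comp_preimage mD mh.
apply: le_lt_trans ih.
have mabs : measurable_fun D (fun x => `|(EFin \o h) x|%E).
  by apply: measurableT_comp => //; exact/measurable_EFinP.
rewrite -(ge0_integral_pushforward mphi leb (f := fun x => `|(EFin \o h) x|%E))//.
rewrite le_eqVlt; apply/orP; left; apply/eqP.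
by apply: eq_measure_integral => A mA _; exact: phiE.
Qed.

Lemma Rintegral_comp_preimage D h : measurable D ->
  leb.-integrable D (EFin \o h) ->
  \int[leb]_(x in (phi : mR -> mR) @^-1` D) h (phi x) = \int[leb]_(x in D) h x.
Proof.
move=> mD ih; have := ih => /integrableP[/measurable_EFinP mh _].
(* Extension by zero, because the pushforward formula wants a function measurable on the whole
   line. *)
pose h0 := h \_ D.
have mh0 : measurable_fun setT (EFin \o h0).
  by apply/measurable_EFinP; apply/(measurable_restrictT _ _).1.
have ih0 : leb.-integrable ((phi : mR -> mR) @^-1` D) (EFin \o h0 \o phi).
  apply: (eq_integrable (measurable_preimage mD) _ _ _ (integrable_comp_preimage mD ih)).
  by move=> x /[!inE] /= Dx; rewrite /h0 patchE mem_set.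
have := integral_pushforward mphi mh0 ih0 mD.
rewrite /Rintegral => E.
have -> : (\int[leb]_(x in D) (h x)%:E = \int[leb]_(x in D) (EFin \o h0) x)%E.
  by apply: eq_integral => x xD; rewrite /h0 /= patchE xD.
have -> : (\int[leb]_(x in (phi : mR -> mR) @^-1` D) (h (phi x))%:E =
    \int[leb]_(x in (phi : mR -> mR) @^-1` D) (EFin \o h0 \o phi) x)%E.
  by apply: eq_integral => x /[!inE] /= xD; rewrite /h0 /= patchE mem_set.
rewrite -E; congr fine.
by apply: eq_measure_integral => A mA _; exact: phiE.
Qed.

Lemma L1_comp_preimage D f : measurable D -> L1 D f ->
  L1 ((phi : mR -> mR) @^-1` D) (f \o phi).
Proof.
by move=> mD [f1 f2]; split; [exact: integrable_comp_preimage mD f1|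
  exact: integrable_comp_preimage mD f2].
Qed.

Lemma L2_comp_preimage D f : measurable D -> L2 D f ->
  L2 ((phi : mR -> mR) @^-1` D) (f \o phi).
Proof.
move=> mD [[f1 f2] f3]; split; last exact: integrable_comp_preimage mD f3.
by split; [exact: measurable_fun_comp_preimage mD f1|
  exact: measurable_fun_comp_preimage mD f2].
Qed.

Lemma cintegral_comp_preimage D f : measurable D -> L1 D f ->
  cintegral ((phi : mR -> mR) @^-1` D) (f \o phi) = cintegral D f.
Proof.
move=> mD [f1 f2]; rewrite /cintegral.
by rewrite (Rintegral_comp_preimage mD f1) (Rintegral_comp_preimage mD f2).
Qed.

End MeasurePreserving.

(** * Absolutely continuous functions and the product rule *)

Section AbsolutelyContinuous.
Variable R : realType.
Local Notation leb := (@lebesgue_measure R).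
Implicit Types (F G f g : R -> R[i]).

Lemma l1norm_one (u v : R) : u <= v -> l1norm `]u, v[ (fun=> 1%:C : R[i]) = v - u.
Proof.
move=> uv; rewrite /l1norm /= normr1 normr0 addr0 Rintegral_cst// mul1r.
suff E : leb `]u, v[%classic = (v - u)%:E by exact: (congr1 fine E).
rewrite lebesgue_measure_itv/= lte_fin; case: ltP => //= vu.
by rewrite (le_anti (_ : u <= v <= u)) ?subrr// uv vu.
Qed.

Lemma L1_bounded (u v B : R) f : cmeasurable `]u, v[ f ->
  (forall x, `]u, v[%classic x -> modc (f x) <= B) -> L1 `]u, v[ f.
Proof.
move=> [f1 f2] fB.
have fin : (leb `]u, v[%classic < +oo)%E.
  by rewrite lebesgue_measure_itv/=; case: ifP; rewrite ltry.
split; apply: (measurable_bounded_integrable _ fin) => //.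
- exists B; split; first exact: num_real.
  move=> M BM x Dx /=; apply: le_trans (ltW BM); apply: le_trans (fB x Dx).
  exact: Re_le_modc.
- exists B; split; first exact: num_real.
  move=> M BM x Dx /=; apply: le_trans (ltW BM); apply: le_trans (fB x Dx).
  exact: Im_le_modc.
Qed.

Lemma AC_diff F f x y : AC_with_derivative F f -> 0 <= x -> x <= y -> y <= 1 ->
  F y = F x + cintegral `]x, y[ f.
Proof.
move=> [Lf hF] x0 xy y1.
rewrite (hF y); last by rewrite (le_trans x0 xy).
rewrite (hF x); last by rewrite x0 (le_trans xy y1).
rewrite -addrA; congr (_ + _); apply: (cintegral_chasles x0 xy).
exact: (L1_itv (lexx 0) y1 Lf).
Qed.

Lemma AC_diff_le F f x y : AC_with_derivative F f -> 0 <= x -> x <= y -> y <= 1 ->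
  modc (F y - F x) <= l1norm `]x, y[ f.
Proof.
move=> acF x0 xy y1; rewrite (AC_diff acF x0 xy y1) addrC addKr.
by apply: cintegral_le_l1norm => //; exact: L1_itv acF.1.
Qed.

Lemma l1norm_itv_le u u' v v' f : u <= u' -> u' <= v' -> v' <= v -> L1 `]u, v[ f ->
  l1norm `]u', v'[ f <= l1norm `]u, v[ f.
Proof.
move=> uu uv vv Lf; rewrite (l1norm_chasles uu (le_trans uv vv))//.
rewrite (l1norm_chasles uv vv); last exact: L1_itv Lf.
by have := l1norm_ge0 `]u, u'[ f; have := l1norm_ge0 `]v', v[ f; lra.
Qed.

Lemma AC_bounded F f x : AC_with_derivative F f -> 0 <= x -> x <= 1 ->
  modc (F x) <= modc (F 0) + l1norm `]0, 1[ f.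
Proof.
move=> acF x0 x1; rewrite -[F x](subrK (F 0)) addrC (le_trans (modcD _ _))//.
rewrite lerD2l (le_trans (AC_diff_le acF _ x0 x1))//.
exact: l1norm_itv_le acF.1.
Qed.

Lemma measurable_indefinite_integral (h : R -> R) :
  leb.-integrable `]0, 1[ (EFin \o h) ->
  measurable_fun (`]0, 1[%classic : set (measurableTypeR R))
    (fun x => \int[leb]_(t in `]0, x[) h t).
Proof.
move=> ih; have ih' := integrable_oo_cc ih.
have c := parameterized_integral_continuous ler01 ih'.
have m : measurable_fun (`[0, 1]%classic : set (measurableTypeR R))
    (fun x : R => \int[leb]_(t in `[0, x]) h t).
  by apply: subspace_continuous_measurable_fun.
apply: (eq_measurable_fun
  (fun x : measurableTypeR R => \int[leb]_(t in `[0, x]) h t)).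
  move=> x /[!inE] /= /[!in_itv]/= /andP[x0 x1].
  have ix : leb.-integrable `]0, x[ (EFin \o h).
    by apply: integrableS ih => //; apply: itv_oo_sub => //; exact: ltW.
  have ix' := integrable_oo_cc ix.
  rewrite -(Rintegral_itv_bndo_bndc (a := BLeft 0)); last first.
    by apply: integrableS ix' => //; exact: subset_itv_co_cc.
  by rewrite -(Rintegral_itv_obnd_cbnd (b := BLeft x)).
by apply: measurable_funS m => //; exact: subset_itv_oo_cc.
Qed.

Lemma AC_cmeasurable F f : AC_with_derivative F f -> cmeasurable `]0, 1[ F.
Proof.
move=> [[f1 f2] hF]; split.
- apply: (eq_measurable_fun (fun x : measurableTypeR R => complex.Re (F 0) +
     \int[leb]_(t in `]0, x[) complex.Re (f t))).
    move=> x /[!inE] /= /[!in_itv]/= /andP[/ltW x0 /ltW x1].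
    by rewrite (hF x) ?x0// /cintegral; case: (F 0).
  by apply: measurable_funD => //; exact: measurable_indefinite_integral.
- apply: (eq_measurable_fun (fun x : measurableTypeR R => complex.Im (F 0) +
     \int[leb]_(t in `]0, x[) complex.Im (f t))).
    move=> x /[!inE] /= /[!in_itv]/= /andP[/ltW x0 /ltW x1].
    by rewrite (hF x) ?x0// /cintegral; case: (F 0).
  by apply: measurable_funD => //; exact: measurable_indefinite_integral.
Qed.

(* Halving [x, y] n times gains a factor 2^-n, because the increments of psi add
   up. *)
Lemma additive_small_eq (H : R -> R[i]) (psi : R -> R) (K : R) :
  (forall x y, 0 <= x -> x <= y -> y <= 1 ->
     modc (H y - H x) <= (y - x) * (K * (psi y - psi x))) ->
  forall x, 0 <= x -> x <= 1 -> H x = H 0.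
Proof.
move=> hH.
have key n : forall x y, 0 <= x -> x <= y -> y <= 1 ->
    modc (H y - H x) <= (y - x) * (K * (psi y - psi x)) / 2 ^+ n.
  elim: n => [|n IH] x y x0 xy y1; first by rewrite expr0 divr1; exact: hH.
  pose z := (x + y) / 2.
  have xz : x <= z by rewrite /z; lra.
  have zy : z <= y by rewrite /z; lra.
  have -> : H y - H x = (H y - H z) + (H z - H x) by ring.
  apply: (le_trans (modcD _ _)).
  apply: (le_trans (lerD (IH z y (le_trans x0 xz) zy y1) (IH x z x0 xz (le_trans zy y1)))).
  rewrite le_eqVlt; apply/orP; left; apply/eqP; rewrite /z exprS; field.
  by rewrite expf_neq0.
move=> x x0 x1; apply/eqP; rewrite -subr_eq0 -modc_eq0 eq_le modc_ge0 andbT.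
by apply: (le_half_expn_le0 (M := (x - 0) * (K * (psi x - psi 0)))) => n; exact: key.
Qed.

(** The bound on g makes G Lipschitz. The defect H = F G - int (f G + F g) has over [x, y] the
    increment int ((G y - G t) f - (F t - F x) g) dt, which is O(y - x) times the L1 norm of f on
    [x, y]. This norm is additive in the interval, so [additive_small_eq] applies and H is
    constant. *)
Lemma AC_mul F G f g (C : R) : AC_with_derivative F f -> AC_with_derivative G g ->
  (forall t, 0 < t < 1 -> modc (g t) <= C) ->
  AC_with_derivative (fun x => F x * G x) (fun x => f x * G x + F x * g x).
Proof.
move=> acF acG gC; have [Lf hF] := acF; have [Lg hG] := acG.
have gC' t : `]0, 1[%classic t -> modc (g t) <= C by rewrite /= in_itv; exact: gC.
have mF := AC_cmeasurable acF; have mG := AC_cmeasurable acG.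
have C0 : 0 <= C.
  by apply: le_trans (gC (2^-1) _); rewrite // invr_gt0 ltr0n /= invf_lt1 ?ltr1n.
pose CF := modc (F 0) + l1norm `]0, 1[ f; pose CG := modc (G 0) + l1norm `]0, 1[ g.
have bF t : `]0, 1[%classic t -> modc (F t) <= CF.
  by rewrite /= in_itv/= => /andP[/ltW ? /ltW ?]; exact: AC_bounded acF _ _.
have bG t : `]0, 1[%classic t -> modc (G t) <= CG.
  by rewrite /= in_itv/= => /andP[/ltW ? /ltW ?]; exact: AC_bounded acG _ _.
have L1a : L1 `]0, 1[ (fun x => f x * G x).
  by apply: (eq_L1 _ _ (L1_bounded_mul _ mG bG Lf)) => // x _; rewrite mulrC.
have L1b : L1 `]0, 1[ (fun x => F x * g x) by exact: L1_bounded_mul mF bF Lg.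
have L1ab : L1 `]0, 1[ (fun x => f x * G x + F x * g x) by exact: L1D.
split => // x /andP[x0 x1].
pose H x := F x * G x - cintegral `]0, x[ (fun t => f t * G t + F t * g t).
suff : H x = H 0.
  by rewrite /H set_itvoo0 /cintegral !Rintegral_set0 subr0 => <-; rewrite subrK.
pose psi x := l1norm `]0, x[ f.
apply: (@additive_small_eq H psi (8 * C)) => // {x x0 x1} x y x0 xy y1.
have sub h : L1 `]0, 1[ h -> L1 `]x, y[ h by exact: L1_itv.
have mD : measurable (`]x, y[%classic : set (measurableTypeR R)) by [].
have insub t : `]x, y[%classic t -> `]0, 1[%classic t by apply: itv_oo_sub.
have dpsi : psi y - psi x = l1norm `]x, y[ f.
  have := l1norm_chasles x0 xy (L1_itv (lexx 0) y1 Lf).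
  by rewrite -/(psi y) -/(psi x) => ->; rewrite addrC addKr.
have Gy t : `]x, y[%classic t -> modc (G y - G t) <= 2 * C * (y - x).
  rewrite /= in_itv/= => /andP[xt ty].
  have t0 : 0 <= t by rewrite (le_trans x0)// ltW.
  rewrite (AC_diff acG t0 (ltW ty) y1) addrC addKr.
  have L1c : L1 `]t, y[ (fun=> 1%:C : R[i]).
    by apply: (L1_bounded (B := 1)) => // s _; rewrite modc_real normr1.
  have Lgt : L1 `]t, y[ g by exact: L1_itv Lg.
  have h s : `]t, y[%classic s -> modc (g s) <= C * modc (1%:C : R[i]).
    by rewrite modc_real normr1 mulr1 => ts; apply/gC'/(itv_oo_sub t0 y1).
  apply: (le_trans (cintegral_le _ L1c Lgt C0 h)) => //.
  rewrite ler_wpM2l ?mulr_ge0//.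
  by rewrite l1norm_one ?(ltW ty)// lerD2l lerN2 ltW.
have Fx t : `]x, y[%classic t -> modc (F t - F x) <= l1norm `]x, y[ f.
  rewrite /= in_itv/= => /andP[xt ty].
  apply: (le_trans (AC_diff_le acF x0 (ltW xt) (le_trans (ltW ty) y1))).
  exact: (l1norm_itv_le (lexx x) (ltW xt) (ltW ty) (sub _ Lf)).
have Lab := sub _ L1ab.
have LfG : L1 `]x, y[ (fun t => G y * f t) by apply: L1Z => //; exact: sub.
have LFg : L1 `]x, y[ (fun t => F x * g t) by apply: L1Z => //; exact: sub.
have Ht : H y - H x = cintegral `]x, y[
    (fun t => (G y * f t + F x * g t) - (f t * G t + F t * g t)).
  rewrite (cintegralB mD (L1D mD LfG LFg) Lab) (cintegralD mD LfG LFg).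
  rewrite (cintegralZ _ mD (sub _ Lf)) (cintegralZ _ mD (sub _ Lg)).
  rewrite /H (cintegral_chasles x0 xy); last exact: L1_itv L1ab.
  by rewrite (AC_diff acF x0 xy y1) (AC_diff acG x0 xy y1); ring.
have L1k1 : L1 `]x, y[ (fun t => (G y - G t) * f t).
  apply: (eq_L1 _ _ (L1B _ LfG (sub _ L1a))) => // t _; ring.
have L1k2 : L1 `]x, y[ (fun t => (F t - F x) * g t).
  apply: (eq_L1 _ _ (L1B _ (sub _ L1b) LFg)) => // t _; ring.
rewrite Ht (_ : (fun t => _) = (fun t => (G y - G t) * f t - (F t - F x) * g t)); last first.
  by apply/funext => t; ring.
rewrite cintegralB// (le_trans (modcB _ _))// dpsi.
have yx0 : 0 <= y - x by rewrite subr_ge0.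
have b1 : modc (cintegral `]x, y[ (fun t => (G y - G t) * f t)) <=
    2 * (2 * C * (y - x)) * l1norm `]x, y[ f.
  apply: cintegral_le => //; first exact: sub; first by rewrite !mulr_ge0.
  by move=> t xty; rewrite modcM ler_wpM2r// Gy.
have L1c : L1 `]x, y[ (fun=> 1%:C : R[i]).
  by apply: (L1_bounded (B := 1)) => // s _; rewrite modc_real normr1.
have b2 : modc (cintegral `]x, y[ (fun t => (F t - F x) * g t)) <=
    2 * (l1norm `]x, y[ f * C) * (y - x).
  rewrite -(l1norm_one xy).
  apply: cintegral_le => //; first by rewrite mulr_ge0 ?l1norm_ge0.
  move=> t xty; rewrite modcM modc_real normr1 mulr1.
  by apply: ler_pM => //; [exact: Fx|exact/gC'/insub].
have l0 := l1norm_ge0 `]x, y[ f.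
have p0 : 0 <= C * (y - x) * l1norm `]x, y[ f by rewrite !mulr_ge0.
move: b1 b2 p0; set c1 := modc _; set c2 := modc _; set l := l1norm _ _ => b1 b2 p0.
have -> : (y - x) * (8 * C * l) = 8 * (C * (y - x) * l) by ring.
have e1 : 2 * (2 * C * (y - x)) * l = 4 * (C * (y - x) * l) by ring.
have e2 : 2 * (l * C) * (y - x) = 2 * (C * (y - x) * l) by ring.
lra.
Qed.

End AbsolutelyContinuous.

(** * Exponential, cosine and sine with a complex frequency *)

Section ComplexExponential.
Variable R : realType.
Local Notation leb := (@lebesgue_measure R).
Implicit Types (z w k rho : R[i]) (x y t : R) (F G f g : R -> R[i]).

Definition expc z : R[i] :=
  (expR (complex.Re z) * cos (complex.Im z)) +i*
  (expR (complex.Re z) * sin (complex.Im z)).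

Lemma expcD z w : expc (z + w) = expc z * expc w.
Proof.
case: z w => a b [c d]; rewrite /expc /= expRD cosD sinD; simpc.
by congr (_ +i* _); ring.
Qed.

Lemma expc0 : expc 0 = 1.
Proof. by rewrite /expc /= expR0 cos0 sin0 mul1r mulr0. Qed.

Lemma expcN z : expc z * expc (- z) = 1.
Proof. by rewrite -expcD subrr expc0. Qed.

Lemma modc_expc z : modc (expc z) = expR (complex.Re z).
Proof.
by rewrite /modc /= !exprMn -mulrDr cos2Dsin2 mulr1 sqrtr_sqr ger0_norm// expR_ge0.
Qed.

(** Componentwise, so that the real fundamental theorem of calculus and monotonicity criterion apply
    to each part. *)
Definition is_cderive F f := forall x,
  is_derive x 1 (fun t => complex.Re (F t)) (complex.Re (f x)) /\
  is_derive x 1 (fun t => complex.Im (F t)) (complex.Im (f x)).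

Lemma is_cderiveD F G f g : is_cderive F f -> is_cderive G g ->
  is_cderive (fun x => F x + G x) (fun x => f x + g x).
Proof.
move=> dF dG x; have [F1 F2] := dF x; have [G1 G2] := dG x.
have e1 : (fun t => complex.Re (F t + G t)) =
    (fun t => complex.Re (F t)) \+ (fun t => complex.Re (G t)).
  by apply/funext => t /=; case: (F t) (G t) => ? ? [].
have e2 : (fun t => complex.Im (F t + G t)) =
    (fun t => complex.Im (F t)) \+ (fun t => complex.Im (G t)).
  by apply/funext => t /=; case: (F t) (G t) => ? ? [].
split; [rewrite e1|rewrite e2].
  by apply: is_derive_eq (is_deriveD F1 G1) _; case: (f x) (g x) => ? ? [].
by apply: is_derive_eq (is_deriveD F2 G2) _; case: (f x) (g x) => ? ? [].
Qed.

Lemma is_cderiveZ F f k : is_cderive F f ->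
  is_cderive (fun x => k * F x) (fun x => k * f x).
Proof.
case: k => a b dF x; have [F1 F2] := dF x.
have e1 : (fun t => complex.Re ((a +i* b) * F t)) =
    a \*: (fun t => complex.Re (F t)) \- b \*: (fun t => complex.Im (F t)).
  by apply/funext => t /=; case: (F t).
have e2 : (fun t => complex.Im ((a +i* b) * F t)) =
    a \*: (fun t => complex.Im (F t)) \+ b \*: (fun t => complex.Re (F t)).
  by apply/funext => t /=; case: (F t).
split; [rewrite e1|rewrite e2].
  by apply: is_derive_eq (is_deriveB (is_deriveZ a F1) (is_deriveZ b F2)) _; case: (f x).
by apply: is_derive_eq (is_deriveD (is_deriveZ a F2) (is_deriveZ b F1)) _; case: (f x).
Qed.

Lemma is_cderiveB F G f g : is_cderive F f -> is_cderive G g ->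
  is_cderive (fun x => F x - G x) (fun x => f x - g x).
Proof.
move=> dF dG; have := is_cderiveD dF (is_cderiveZ (-1) dG).
rewrite (_ : (fun x => _) = (fun x => F x - G x)).
  rewrite [X in is_cderive _ X](_ : _ = (fun x => f x - g x)) //.
  by apply/funext => x; rewrite mulN1r.
by apply/funext => x; rewrite mulN1r.
Qed.

Lemma is_cderive_real (h h' : R -> R) : (forall x, is_derive x 1 h (h' x)) ->
  is_cderive (fun x => (h x)%:C) (fun x => (h' x)%:C).
Proof. by move=> dh x; split => //=; exact: (is_derive_cst 0 x 1). Qed.

Lemma is_derive_scale (h : R -> R) (a x d : R) : is_derive (a * x) 1 h d ->
  is_derive x 1 (fun t => h (a * t)) (a * d).
Proof.
move=> dh; have d1 : is_derive x 1 (fun t => a * t) a.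
  by apply: is_derive_eq (is_deriveZ a (is_derive_id x 1)) _; rewrite /GRing.scale /= mulr1.
by apply: is_derive_eq (@is_derive1_comp _ h (fun t => a * t) x d a dh d1) _; rewrite mulrC.
Qed.

Lemma is_cderive_expc k :
  is_cderive (fun x => expc (k * x%:C)) (fun x => k * expc (k * x%:C)).
Proof.
case: k => a b x.
have kE t : (a +i* b) * t%:C = (a * t) +i* (b * t) 
  by apply/eqP; rewrite eq_complex /= !mulr0 subr0 add0r !eqxx.
have dE : is_derive x 1 (fun t => expR (a * t)) (a * expR (a * x)).
  exact: is_derive_scale.
have dC : is_derive x 1 (fun t => cos (b * t)) (b * - sin (b * x)).
  exact: is_derive_scale.
have dS : is_derive x 1 (fun t => sin (b * t)) (b * cos (b * x)).
  exact: is_derive_scale.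
split.
- rewrite (_ : (fun t => _) = (fun t => expR (a * t)) \* (fun t => cos (b * t))).
    apply: is_derive_eq (is_deriveM dE dC) _; rewrite kE /expc /GRing.scale /=; ring.
  by apply/funext => t; rewrite kE.
- rewrite (_ : (fun t => _) = (fun t => expR (a * t)) \* (fun t => sin (b * t))).
    apply: is_derive_eq (is_deriveM dE dS) _; rewrite kE /expc /GRing.scale /=; ring.
  by apply/funext => t; rewrite kE.
Qed.

Lemma is_derive_continuous (h h' : R -> R) : (forall x, is_derive x 1 h (h' x)) ->
  continuous h.
Proof.
move=> dh x; apply: differentiable_continuous; apply/derivable1_diffP.
by have [] := dh x.
Qed.

Lemma real_AC (h h' : R -> R) x : (forall x, is_derive x 1 h (h' x)) ->
  continuous h' -> 0 <= x ->
  leb.-integrable `]0, x[ (EFin \o h') /\ \int[leb]_(t in `]0, x[) h' t = h x - h 0.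
Proof.
move=> dh ch' x0.
have i1 : leb.-integrable `[0, x] (EFin \o h').
  apply: continuous_compact_integrable; first exact: segment_compact.
  exact: continuous_subspaceT.
have i2 : leb.-integrable `]0, x[ (EFin \o h').
  by apply: integrableS i1 => //; exact: subset_itv_oo_cc.
split=> //; move: x0; rewrite le_eqVlt => /predU1P[<-|x0].
  by rewrite set_itvoo0 Rintegral_set0 subrr.
have i3 : leb.-integrable `[0, x[ (EFin \o h').
  by apply: integrableS i1 => //; exact: subset_itv_co_cc.
rewrite (Rintegral_itv_obnd_cbnd (b := BLeft x) i2).
rewrite (Rintegral_itv_bndo_bndc (a := BLeft 0) i3) /Rintegral.
have ch := is_derive_continuous dh.
rewrite (continuous_FTC2 (F := h) x0)//.
- exact: continuous_subspaceT.
- split; first by move=> y _; have [] := dh y.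
    exact/cvg_at_right_filter/ch.
  exact/cvg_at_left_filter/ch.
- by move=> y _; rewrite derive1E; have [] := dh y.
Qed.

(** The second derivative supplies the continuity of f that the fundamental theorem of calculus asks
    for. *)
Lemma is_cderive_AC F f g : is_cderive F f -> is_cderive f g ->
  AC_with_derivative F f.
Proof.
move=> dF df.
have c1 : continuous (fun t => complex.Re (f t)).
  by apply: (is_derive_continuous (h' := fun t => complex.Re (g t))) => x; have [] := df x.
have c2 : continuous (fun t => complex.Im (f t)).
  by apply: (is_derive_continuous (h' := fun t => complex.Im (g t))) => x; have [] := df x.
have d1 x : is_derive x 1 (fun t => complex.Re (F t)) (complex.Re (f x)) by have [] := dF x.
have d2 x : is_derive x 1 (fun t => complex.Im (F t)) (complex.Im (f x)) by have [] := dF x.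
split; first by split; [exact: (real_AC d1 c1 ler01).1|exact: (real_AC d2 c2 ler01).1].
move=> x /andP[x0 _]; rewrite /cintegral (real_AC d1 c1 x0).2 (real_AC d2 c2 x0).2.
case: (F x) (F 0) => a b [c d]; simpc.
by rewrite !subrKC.
Qed.

(** Both b - h and b + h are nondecreasing and start from 0. Taylor remainders are integrated in
    this form. *)
Lemma real_increment_le (h h' b b' : R -> R) x :
  (forall x, is_derive x 1 h (h' x)) -> (forall x, is_derive x 1 b (b' x)) ->
  (forall t, 0 <= t <= 1 -> `|h' t| <= b' t) -> h 0 = 0 -> b 0 = 0 ->
  0 <= x <= 1 -> `|h x| <= b x.
Proof.
move=> dh db hb h0 b0 /andP[x0 x1].
have mono (k k' : R -> R) : (forall x, is_derive x 1 k (k' x)) ->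
    (forall t, 0 <= t <= 1 -> 0 <= k' t) -> k 0 <= k x.
  move=> dk k'0; apply: (@ger0_derive1_ndecr _ k 0 1) => //.
  - move=> y /[!in_itv]/= /andP[/ltW y0 /ltW y1]; rewrite derive1E.
    by have [_ ->] := dk y; rewrite k'0// y0.
  - by apply: continuous_subspaceT; exact: is_derive_continuous dk.
have m1 := mono _ _ (fun x => is_deriveB (db x) (dh x)).
have m2 := mono _ _ (fun x => is_deriveD (db x) (dh x)).
rewrite ler_norml; apply/andP; split.
- have := m2 _; rewrite /= !fctE h0 b0 addr0 -lerBlDl sub0r; apply => t /hb.
  by rewrite ler_norml; lra.
- have := m1 _; rewrite /= !fctE h0 b0 subrr subr_ge0; apply => t /hb.
  by rewrite ler_norml; lra.
Qed.

Lemma cderive_increment_le F f (b b' : R -> R) x :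
  is_cderive F f -> (forall x, is_derive x 1 b (b' x)) ->
  (forall t, 0 <= t <= 1 -> modc (f t) <= b' t) -> F 0 = 0 -> b 0 = 0 ->
  0 <= x <= 1 -> modc (F x) <= 2 * b x.
Proof.
move=> dF db hb F0 b0 x01; apply: (le_trans (modc_le_ReIm _)).
have h1 : `|complex.Re (F x)| <= b x.
  apply: (@real_increment_le (fun t => complex.Re (F t)) (fun t => complex.Re (f t)) b b') => //.
  - by move=> y; have [] := dF y.
  - by move=> t /hb; apply: le_trans; exact: Re_le_modc.
  - by rewrite F0.
have h2 : `|complex.Im (F x)| <= b x.
  apply: (@real_increment_le (fun t => complex.Im (F t)) (fun t => complex.Im (f t)) b b') => //.
  - by move=> y; have [] := dF y.
  - by move=> t /hb; apply: le_trans; exact: Im_le_modc.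
  - by rewrite F0.
lra.
Qed.

(* sinrho rho x is sin(rho x) / rho, continued by x at rho = 0. *)
Definition cosrho rho x : R[i] := (expc ('i * rho * x%:C) + expc (- ('i * rho * x%:C))) / 2.
Definition sinrho rho x : R[i] := if rho == 0 then x%:C else
  (expc ('i * rho * x%:C) - expc (- ('i * rho * x%:C))) / (2 * 'i * rho).

Let i2 : ('i : R[i]) ^+ 2 = -1. Proof. by rewrite sqr_i. Qed.
Let i0 : ('i : R[i]) != 0.
Proof.
apply/eqP => h; have := i2.
by rewrite h expr0n => /eqP; rewrite eq_sym oppr_eq0 oner_eq0.
Qed.

Lemma cosrho0 rho : cosrho rho 0 = 1.
Proof. by rewrite /cosrho mulr0 oppr0 expc0; field. Qed.

Lemma sinrho0 rho : sinrho rho 0 = 0.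
Proof. by rewrite /sinrho mulr0 oppr0 expc0 subrr mul0r; case: ifP. Qed.

Lemma cosrho_at0 x : cosrho 0 x = 1.
Proof. by rewrite /cosrho mulr0 mul0r oppr0 expc0; field. Qed.

Lemma sinrho_at0 x : sinrho 0 x = x%:C.
Proof. by rewrite /sinrho eqxx. Qed.

Lemma cosrhoN rho x : cosrho rho (- x) = cosrho rho x.
Proof. by rewrite /cosrho rmorphN mulrN opprK addrC. Qed.

Lemma sinrhoN rho x : sinrho rho (- x) = - sinrho rho x.
Proof.
have xN : (- x)%:C = - x%:C :> R[i] by rewrite rmorphN.
rewrite /sinrho xN mulrN opprK; case: ifP => // _.
by rewrite -[RHS]mulNr opprB.
Qed.

Lemma cosrhoD rho x y :
  cosrho rho (x + y) = cosrho rho x * cosrho rho y - rho ^+ 2 * (sinrho rho x * sinrho rho y).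
Proof.
have [->|r0] := eqVneq rho 0; first by rewrite !cosrho_at0 expr0n mul0r subr0 mulr1.
rewrite /cosrho /sinrho (negbTE r0) rmorphD mulrDr opprD !expcD.
set A := expc _; set B := expc _; set C := expc (- _); set D := expc (- _).
have -> : rho ^+ 2 * ((A - C) / (2 * 'i * rho) * ((B - D) / (2 * 'i * rho))) =
   ((A - C) * (B - D)) / (4 * ('i ^+ 2)) by field; rewrite i0 r0.
by rewrite i2; field.
Qed.

Lemma sinrhoD rho x y :
  sinrho rho (x + y) = sinrho rho x * cosrho rho y + cosrho rho x * sinrho rho y.
Proof.
have [->|r0] := eqVneq rho 0.
  by rewrite !cosrho_at0 !sinrho_at0 rmorphD mulr1 mul1r.
rewrite /cosrho /sinrho (negbTE r0) rmorphD mulrDr opprD !expcD.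
by field; rewrite i0 r0.
Qed.

Lemma cos2Dsin2_rho rho x :
  cosrho rho x ^+ 2 + rho ^+ 2 * sinrho rho x ^+ 2 = 1.
Proof.
have := cosrhoD rho x (- x); rewrite subrr cosrho0 cosrhoN sinrhoN => ->.
by rewrite mulrN mulrN opprK !expr2.
Qed.

Lemma is_cderive_sinrho rho : is_cderive (sinrho rho) (cosrho rho).
Proof.
have [->|r0] := eqVneq rho 0.
  have := is_cderive_real (fun x => is_derive_id x 1).
  have -> : (fun x : R => x%:C) = sinrho 0 by apply/funext => x; rewrite sinrho_at0.
  by have -> : (fun x : R => 1%:C) = cosrho 0 by apply/funext => x; rewrite cosrho_at0.
have d1 := is_cderive_expc ('i * rho).
have d2 := is_cderive_expc (- ('i * rho)).
have e x : expc (- ('i * rho) * x%:C) = expc (- ('i * rho * x%:C)) by rewrite mulNr.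
have := is_cderiveZ (2 * 'i * rho)^-1 (is_cderiveD d1 (is_cderiveZ (-1) d2)).
rewrite (_ : (fun x => _) = sinrho rho).
  rewrite (_ : (fun x => _) = cosrho rho)//.
  by apply/funext => x; rewrite /cosrho e; field; rewrite i0 r0.
by apply/funext => x; rewrite /sinrho (negbTE r0) e; field; rewrite i0 r0.
Qed.

Lemma is_cderive_cosrho rho :
  is_cderive (cosrho rho) (fun x => - rho ^+ 2 * sinrho rho x).
Proof.
have d1 := is_cderive_expc ('i * rho).
have d2 := is_cderive_expc (- ('i * rho)).
have e x : expc (- ('i * rho) * x%:C) = expc (- ('i * rho * x%:C)) by rewrite mulNr.
have := is_cderiveZ 2^-1 (is_cderiveD d1 d2).
rewrite (_ : (fun x => _) = cosrho rho); last first.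
  by apply/funext => x; rewrite /cosrho e mulrC.
rewrite (_ : (fun x => _) = (fun x => - rho ^+ 2 * sinrho rho x))//.
apply/funext => x; rewrite /sinrho; have [->|r0] := eqVneq rho 0.
  by rewrite expr0n oppr0 mul0r mulr0 oppr0 !mul0r addr0 mulr0.
rewrite e; set A := expc _; set B := expc _.
have -> : - rho ^+ 2 * ((A - B) / (2 * 'i * rho)) = - ('i ^+ 2)^-1 * ('i * rho * (A - B) / 2).
  by field; rewrite i0 r0.
by rewrite i2; field.
Qed.

Lemma modc_expc_le rho x : 0 <= x <= 1 ->
  modc (expc ('i * rho * x%:C)) <= expR `|complex.Im rho| /\
  modc (expc (- ('i * rho * x%:C))) <= expR `|complex.Im rho|.
Proof.
move=> /andP[x0 x1]; rewrite !modc_expc; case: rho => a b; simpc => /=.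
rewrite !ler_expR.
have h : `|b * x| <= `|b| by rewrite normrM (ger0_norm x0) ler_piMr.
have := ler_norm (b * x); have := ler_norm (- (b * x)); rewrite normrN.
by split; lra.
Qed.

Lemma modc_cosrho rho x : 0 <= x <= 1 ->
  modc (cosrho rho x) <= expR `|complex.Im rho|.
Proof.
move=> /(modc_expc_le rho)[h1 h2]; rewrite /cosrho modcM modcV.
have -> : modc (2 : R[i]) = 2 by rewrite (_ : 2 = 2%:C) ?modc_real ?ger0_norm ?rmorph_nat.
rewrite ler_pdivrMr// (le_trans (modcD _ _))//; lra.
Qed.

Lemma modc_sinrho rho x : 0 <= x <= 1 ->
  modc rho * modc (sinrho rho x) <= expR `|complex.Im rho|.
Proof.
have [->|r0] := eqVneq rho 0; first by rewrite modc0 mul0r expR_ge0.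
move=> /(modc_expc_le rho)[h1 h2]; rewrite /sinrho (negbTE r0) modcM modcV !modcM.
have -> : modc (2 : R[i]) = 2 by rewrite (_ : 2 = 2%:C) ?modc_real ?ger0_norm ?rmorph_nat.
rewrite modc_i mulr1; set X := modc (_ - _).
have -> : modc rho * (X / (2 * modc rho)) = X / 2 by field; rewrite modc_eq0.
rewrite ler_pdivrMr// (le_trans (modcB _ _))//; lra.
Qed.

End ComplexExponential.

(** * Power series in rho^2 of the cosine, the sine and the sine integral *)

Section TaylorExpansion.
Variable R : realType.
Implicit Types (rho : R[i]) (x t : R) (f w : R -> R[i]).

(** Divided powers: differentiation lowers the index without producing a factor. *)
Definition monomial (n : nat) x : R := x ^+ n / n`!%:R.

Lemma monomial0 x : monomial 0 x = 1.
Proof. by rewrite /monomial expr0 fact0 divr1. Qed.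

Lemma monomialS0 n : monomial n.+1 0 = 0.
Proof. by rewrite /monomial expr0n mul0r. Qed.

Lemma monomial_ge0 n x : 0 <= x -> 0 <= monomial n x.
Proof. by move=> x0; rewrite /monomial divr_ge0 ?exprn_ge0. Qed.

Lemma is_derive_monomial n x : is_derive x 1 (monomial n.+1) (monomial n x).
Proof.
have d m : is_derive x 1 (fun t : R => t ^+ m.+1) (m.+1%:R * x ^+ m).
  elim: m => [|m IH].
    rewrite (_ : (fun t : R => t ^+ 1) = id); last by apply/funext => t; rewrite expr1.
    by apply: is_derive_eq (is_derive_id x 1) _; rewrite expr0 mulr1.
  have -> : (fun t : R => t ^+ m.+2) = (fun t => t) \* (fun t => t ^+ m.+1).
    by apply/funext => t; rewrite exprS.
  apply: is_derive_eq (is_deriveM (is_derive_id x 1) IH) _.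
  by rewrite /GRing.scale /= -[m.+2%:R]natr1 exprS; ring.
have -> : monomial n.+1 = (n.+1`!%:R)^-1 \*: (fun t : R => t ^+ n.+1).
  by apply/funext => t; rewrite /monomial /= mulrC.
apply: is_derive_eq (is_deriveZ _ (d n)) _.
rewrite /GRing.scale /= /monomial factS natrM; field.
by rewrite nat1r !pnatr_eq0 -lt0n fact_gt0.
Qed.

Lemma monomial_le n x : 0 <= x <= 1 -> monomial n x <= n`!%:R^-1.
Proof.
move=> /andP[x0 x1]; rewrite /monomial -[leRHS]mul1r ler_wpM2r ?invr_ge0//.
exact: exprn_ile1.
Qed.

Lemma leq_fact (m n : nat) : (m <= n)%N -> (m`! <= n`!)%N.
Proof.
elim: n => [|n IH]; first by rewrite leqn0 => /eqP->.
rewrite leq_eqVlt => /predU1P[->//|]; rewrite ltnS => /IH h.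
by rewrite factS (leq_trans h)// leq_pmull.
Qed.

Lemma inv_fact_le (m n : nat) : (m <= n)%N -> n`!%:R^-1 <= m`!%:R^-1 :> R.
Proof.
by move=> mn; rewrite lef_pV2 ?posrE ?ltr0n ?fact_gt0// ler_nat leq_fact.
Qed.

Lemma expn_div_fact_le x n : 0 <= x -> x ^+ n / n`!%:R <= expR x.
Proof.
move=> x0; case: n => [|n].
  by rewrite expr0 fact0 divr1 -expR0 ler_expR.
by apply: le_trans (expR_ge1Dxn n x0); rewrite lerDr.
Qed.

Lemma entire_coefs_fact (a : nat -> R[i]) (M : R) : 0 <= M ->
  (forall n, modc (a n) <= M / n`!%:R) -> entire_coefs a.
Proof.
move=> M0 ha s s0; exists (M * expR s) => n.
apply: (@le_trans _ _ (M / n`!%:R * s ^+ n)).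
  by apply: ler_wpM2r => //; exact/exprn_ge0/ltW.
by rewrite -mulrA ler_wpM2l// mulrC expn_div_fact_le// ltW.
Qed.

(** Taylor coefficients in lambda = rho^2, at fixed x, of sin(rho x) / rho. *)
Definition sin_coefs x n : R[i] := (- 1) ^+ n * (monomial n.*2.+1 x)%:C.
Definition cos_coefs x n : R[i] := (- 1) ^+ n * (monomial n.*2 x)%:C.

Lemma is_cderive_sin_sum rho N :
  is_cderive (fun x => partial_sum (sin_coefs x) (rho ^+ 2) N)
    (fun x => partial_sum (cos_coefs x) (rho ^+ 2) N).
Proof.
elim: N => [|N IH].
  have := is_cderive_real (fun x => is_derive_cst (0 : R) x 1).
  have e1 : (fun x => partial_sum (sin_coefs x) (rho ^+ 2) 0) = (fun=> 0%:C).
    by apply/funext => x; rewrite /partial_sum big_ord0.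
  have e2 : (fun x => partial_sum (cos_coefs x) (rho ^+ 2) 0) = (fun=> 0%:C).
    by apply/funext => x; rewrite /partial_sum big_ord0.
  by rewrite e1 e2; apply.
have h := is_cderiveD IH (is_cderiveZ ((rho ^+ 2) ^+ N * (- 1) ^+ N)
  (is_cderive_real (is_derive_monomial N.*2))).
rewrite (_ : (fun x => _) = (fun x => partial_sum (sin_coefs x) (rho ^+ 2) N +
   (rho ^+ 2) ^+ N * (- 1) ^+ N * (monomial N.*2.+1 x)%:C)); last first.
  apply/funext => x; rewrite /partial_sum big_ord_recr /= /sin_coefs; ring.
rewrite [X in is_cderive _ X](_ : _ = (fun x => partial_sum (cos_coefs x) (rho ^+ 2) N +
   (rho ^+ 2) ^+ N * (- 1) ^+ N * (monomial N.*2 x)%:C)) //.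
apply/funext => x; rewrite /partial_sum big_ord_recr /= /cos_coefs; ring.
Qed.

Lemma is_cderive_cos_sum rho N :
  is_cderive (fun x => partial_sum (cos_coefs x) (rho ^+ 2) N.+1)
    (fun x => - rho ^+ 2 * partial_sum (sin_coefs x) (rho ^+ 2) N).
Proof.
elim: N => [|N IH].
  have := is_cderive_real (fun x => is_derive_cst (1 : R) x 1).
  rewrite (_ : (fun x => _) = (fun x => partial_sum (cos_coefs x) (rho ^+ 2) 1)).
    rewrite [X in is_cderive _ X](_ : _ = (fun x => - rho ^+ 2 *
      partial_sum (sin_coefs x) (rho ^+ 2) 0))//.
    by apply/funext => x; rewrite /partial_sum big_ord0 mulr0.
  apply/funext => x; rewrite /partial_sum big_ord1 /cos_coefs monomial0.
  by rewrite !expr0 mulr1 mul1r.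
have h := is_cderiveD IH (is_cderiveZ ((rho ^+ 2) ^+ N.+1 * (- 1) ^+ N.+1)
  (is_cderive_real (is_derive_monomial N.*2.+1))).
rewrite (_ : (fun x => _) = (fun x => partial_sum (cos_coefs x) (rho ^+ 2) N.+1 +
   (rho ^+ 2) ^+ N.+1 * (- 1) ^+ N.+1 * (monomial N.*2.+2 x)%:C)); last first.
  apply/funext => x; rewrite {1}/partial_sum big_ord_recr /= /cos_coefs doubleS.
  rewrite /partial_sum /cos_coefs.
  ring.
rewrite [X in is_cderive _ X](_ : _ =
    (fun x => - rho ^+ 2 * partial_sum (sin_coefs x) (rho ^+ 2) N +
   (rho ^+ 2) ^+ N.+1 * (- 1) ^+ N.+1 * (monomial N.*2.+1 x)%:C)) //.
apply/funext => x; rewrite {1}/partial_sum big_ord_recr /= /sin_coefs /partial_sum /sin_coefs.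
by rewrite !exprS; ring.
Qed.

(** The two remainders are integrated alternately, from S' = C and C' = - rho^2 S, starting from
    |cos rho x| <= e^|Im rho|. Each integration raises the degree in x by one and costs the factor 2
    of [cderive_increment_le]; a full round gives 4 |rho^2|. *)
Lemma cos_sin_remainder rho N :
  (forall x, 0 <= x <= 1 ->
    modc (cosrho rho x - partial_sum (cos_coefs x) (rho ^+ 2) N) <=
    expR `|complex.Im rho| * (4 * modc (rho ^+ 2)) ^+ N * monomial N.*2 x) /\
  (forall x, 0 <= x <= 1 ->
    modc (sinrho rho x - partial_sum (sin_coefs x) (rho ^+ 2) N) <=
    2 * (expR `|complex.Im rho| * (4 * modc (rho ^+ 2)) ^+ N * monomial N.*2.+1 x)).
Proof.
set E := expR _; set L := modc _.
have sin0 n : partial_sum (sin_coefs 0) (rho ^+ 2) n = 0.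
  by rewrite /partial_sum big1// => i _; rewrite /sin_coefs monomialS0 (_ : 0%:C = 0)// mulr0 mul0r.
have cos0 n : partial_sum (cos_coefs 0) (rho ^+ 2) n.+1 = 1.
  rewrite /partial_sum big_ord_recl big1 ?addr0 /cos_coefs.
    by rewrite monomial0 !expr0 mulr1 mul1r.
  by move=> i _; rewrite lift0 doubleS monomialS0 (_ : 0%:C = 0)// mulr0 mul0r.
have step n : (forall x, 0 <= x <= 1 ->
    modc (cosrho rho x - partial_sum (cos_coefs x) (rho ^+ 2) n) <=
    E * (4 * L) ^+ n * monomial n.*2 x) ->
   forall x, 0 <= x <= 1 ->
    modc (sinrho rho x - partial_sum (sin_coefs x) (rho ^+ 2) n) <=
    2 * (E * (4 * L) ^+ n * monomial n.*2.+1 x).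
  move=> h x x01.
  have d := is_cderiveB (is_cderive_sinrho rho) (is_cderive_sin_sum rho n).
  have db y := is_deriveZ (E * (4 * L) ^+ n) (is_derive_monomial n.*2 y).
  apply: (cderive_increment_le d db _ _ _ x01).
  - by move=> t t01; exact: h.
  - by rewrite sinrho0 sin0 subrr.
  - by rewrite /= monomialS0 scaler0.
elim: N => [|N [IHc IHs]].
  have h0 x : 0 <= x <= 1 ->
    modc (cosrho rho x - partial_sum (cos_coefs x) (rho ^+ 2) 0) <=
    E * (4 * L) ^+ 0 * monomial 0.*2 x.
    move=> x01; rewrite /partial_sum big_ord0 subr0 expr0 mulr1 monomial0 mulr1.
    exact: modc_cosrho.
  by split; [exact: h0|exact: step h0].
have hS x : 0 <= x <= 1 ->
    modc (cosrho rho x - partial_sum (cos_coefs x) (rho ^+ 2) N.+1) <=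
    E * (4 * L) ^+ N.+1 * monomial N.+1.*2 x.
  move=> x01.
  have d := is_cderiveB (is_cderive_cosrho rho) (is_cderive_cos_sum rho N).
  have db y := is_deriveZ (L * (2 * (E * (4 * L) ^+ N))) (is_derive_monomial N.*2.+1 y).
  have -> : E * (4 * L) ^+ N.+1 * monomial N.+1.*2 x =
     2 * (L * (2 * (E * (4 * L) ^+ N)) * monomial N.*2.+2 x).
    by rewrite doubleS exprS; ring.
  apply: (cderive_increment_le d db _ _ _ x01).
  - move=> t t01; rewrite (_ : _ - _ =
      - rho ^+ 2 * (sinrho rho t - partial_sum (sin_coefs t) (rho ^+ 2) N)); last by ring.
    rewrite modcM modcN -/L.
    apply: (le_trans (ler_wpM2l (modc_ge0 _ : 0 <= L) (IHs t t01))).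
    by rewrite /GRing.scale /= !mulrA.
  - by rewrite cosrho0 cos0 subrr.
  - by rewrite /= monomialS0 scaler0.
by split; [exact: hS|exact: step hS].
Qed.

(** The number (4 |rho^2|)^N / N! is 2^-N times (8 |rho^2|)^N / N!, which is at most exp(8 |rho^2|);
    this produces the rate required by [sums_to]. *)
Definition remainder_bound rho : R :=
  2 * (expR `|complex.Im rho| * expR (8 * modc (rho ^+ 2))).

Lemma remainder_boundE (rho : R[i]) (N k : nat) x : (N <= k)%N -> 0 <= x <= 1 ->
  2 * (expR `|complex.Im rho| * (4 * modc (rho ^+ 2)) ^+ N * monomial k x) <=
  remainder_bound rho / 2 ^+ N.
Proof.
move=> Nk x01; rewrite /remainder_bound -!mulrA ler_wpM2l// ler_wpM2l ?expR_ge0//.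
set L := modc _; have L0 : 0 <= L by exact: modc_ge0.
apply: (@le_trans _ _ ((4 * L) ^+ N / N`!%:R)).
  rewrite ler_wpM2l ?exprn_ge0 ?mulr_ge0//.
  exact: le_trans (monomial_le _ x01) (inv_fact_le Nk).
rewrite ler_pdivlMr ?exprn_gt0// mulrAC -exprMn.
have -> : 4 * L * 2 = 8 * L by ring.
by apply: expn_div_fact_le; rewrite mulr_ge0.
Qed.

Lemma sinrho_remainder rho N x : 0 <= x <= 1 ->
  modc (sinrho rho x - partial_sum (sin_coefs x) (rho ^+ 2) N) <=
  remainder_bound rho / 2 ^+ N.
Proof.
move=> x01; apply: (le_trans ((cos_sin_remainder rho N).2 x x01)).
by apply: remainder_boundE => //; rewrite -addnn leqW// leq_addr.
Qed.

Lemma cosrho_remainder rho N x : 0 <= x <= 1 ->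
  modc (cosrho rho x - partial_sum (cos_coefs x) (rho ^+ 2) N) <=
  remainder_bound rho / 2 ^+ N.
Proof.
move=> x01; apply: (le_trans ((cos_sin_remainder rho N).1 x x01)).
have h : (N <= N.*2)%N by rewrite -addnn leq_addr.
apply: le_trans (remainder_boundE rho h x01).
have m0 : 0 <= monomial N.*2 x by apply: monomial_ge0; case/andP: x01.
set X := _ * _ * _; suff X0 : 0 <= X by lra.
rewrite /X mulr_ge0// mulr_ge0 ?expR_ge0// exprn_ge0// mulr_ge0//.
Qed.

Lemma sin_coefs_le x n : 0 <= x <= 1 -> modc (sin_coefs x n) <= n`!%:R^-1.
Proof.
move=> x01; have m0 : 0 <= monomial n.*2.+1 x by apply: monomial_ge0; case/andP: x01.
rewrite /sin_coefs modcM modcX modcN modc1 expr1n mul1r modc_real ger0_norm//.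
apply: (le_trans (monomial_le _ x01)); apply: inv_fact_le.
by rewrite -addnn leqW// leq_addr.
Qed.

Lemma cos_coefs_le x n : 0 <= x <= 1 -> modc (cos_coefs x n) <= n`!%:R^-1.
Proof.
move=> x01; have m0 : 0 <= monomial n.*2 x by apply: monomial_ge0; case/andP: x01.
rewrite /cos_coefs modcM modcX modcN modc1 expr1n mul1r modc_real ger0_norm//.
apply: (le_trans (monomial_le _ x01)); apply: inv_fact_le.
by rewrite -addnn leq_addr.
Qed.

Lemma entire_cos_coefs x : 0 <= x <= 1 -> entire_coefs (cos_coefs x).
Proof.
move=> x01; apply: (entire_coefs_fact ler01) => n.
by rewrite mul1r; exact: cos_coefs_le.
Qed.

Lemma entire_value_cos rho x : 0 <= x <= 1 ->
  entire_value (cos_coefs x) (rho ^+ 2) = cosrho rho x.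
Proof.
move=> x01; apply: entire_valueE; first exact: entire_cos_coefs.
by exists (remainder_bound rho) => n; exact: cosrho_remainder.
Qed.

Lemma is_cderive_cmeasurable F f (D : set (measurableTypeR R)) : measurable D ->
  @is_cderive R F f -> cmeasurable D F.
Proof.
move=> mD dF; split; apply: measurable_funTS; apply: continuous_measurable_fun.
- by apply: (is_derive_continuous (h' := fun t => complex.Re (f t))) => x; have [] := dF x.
- by apply: (is_derive_continuous (h' := fun t => complex.Im (f t))) => x; have [] := dF x.
Qed.

Definition sin_integral_coefs w n : R[i] :=
  cintegral `]0, 1[ (fun x => sin_coefs x n * w x).

Lemma itv01_bound x : `]0, 1[%classic x -> 0 <= x <= 1.
Proof. by rewrite /= in_itv/= => /andP[/ltW-> /ltW->]. Qed.

Lemma is_cderive_sin_coef n :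
  is_cderive (fun x => sin_coefs x n) (fun x => cos_coefs x n).
Proof.
exact: is_cderiveZ ((- 1) ^+ n) (is_cderive_real (is_derive_monomial n.*2)).
Qed.

Lemma L1_sin_coef_mul w n : L1 `]0, 1[ w -> L1 `]0, 1[ (fun x => sin_coefs x n * w x).
Proof.
move=> Lw; apply: (L1_bounded_mul (B := n`!%:R^-1)) => //.
  exact: is_cderive_cmeasurable (is_cderive_sin_coef n).
by move=> x /itv01_bound; exact: sin_coefs_le.
Qed.

Lemma entire_sin_integral_coefs w : L1 `]0, 1[ w -> entire_coefs (sin_integral_coefs w).
Proof.
move=> Lw; apply: (entire_coefs_fact (M := 2 * l1norm `]0, 1[ w)) => [|n].
  by rewrite mulr_ge0// l1norm_ge0.
rewrite mulrAC; apply: cintegral_le => //; first exact: L1_sin_coef_mul.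
by move=> x /itv01_bound x01; rewrite modcM ler_wpM2r// sin_coefs_le.
Qed.

Lemma L1_sinrho_mul rho w : L1 `]0, 1[ w -> L1 `]0, 1[ (fun x => sinrho rho x * w x).
Proof.
move=> Lw; have m := @is_cderive_cmeasurable _ _ `]0, 1[%classic _ (is_cderive_sinrho rho).
have ac := is_cderive_AC (is_cderive_sinrho rho) (is_cderive_cosrho rho).
apply: (L1_bounded_mul _ _ _ Lw (B := modc (sinrho rho 0) + l1norm `]0, 1[ (cosrho rho))) => //.
  exact: m.
by move=> x /itv01_bound /andP[x0 x1]; exact: AC_bounded ac x0 x1.
Qed.

(** Sum and integral are exchanged by the Taylor remainder, which is uniform in x on [0, 1]. *)
Lemma entire_value_sin_integral rho w : L1 `]0, 1[ w ->
  entire_value (sin_integral_coefs w) (rho ^+ 2) =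
  cintegral `]0, 1[ (fun x => sinrho rho x * w x).
Proof.
move=> Lw; apply: entire_valueE; first exact: entire_sin_integral_coefs.
have mD : measurable (`]0, 1[%classic : set (measurableTypeR R)) by [].
exists (2 * remainder_bound rho * l1norm `]0, 1[ w) => N.
have [LN EN] : L1 `]0, 1[ (fun x => partial_sum (sin_coefs x) (rho ^+ 2) N * w x) /\
    partial_sum (sin_integral_coefs w) (rho ^+ 2) N =
    cintegral `]0, 1[ (fun x => partial_sum (sin_coefs x) (rho ^+ 2) N * w x).
  elim: N => [|N [IL IE]].
    have -> : (fun x => partial_sum (sin_coefs x) (rho ^+ 2) 0 * w x) = (fun x => 0 * w x).
      by apply/funext => x; rewrite /partial_sum big_ord0.
    by split; [exact: L1Z|rewrite cintegralZ// /partial_sum big_ord0 mul0r].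
  have -> : (fun x => partial_sum (sin_coefs x) (rho ^+ 2) N.+1 * w x) =
     (fun x => partial_sum (sin_coefs x) (rho ^+ 2) N * w x +
       (rho ^+ 2) ^+ N * (sin_coefs x N * w x)).
    by apply/funext => x; rewrite /partial_sum big_ord_recr /=; ring.
  have LS := L1_sin_coef_mul N Lw.
  split; first by apply: L1D => //; exact: L1Z.
  rewrite cintegralD//; last exact: L1Z.
  by rewrite cintegralZ// -IE {1}/partial_sum big_ord_recr /= [X in _ + X]mulrC.
have LS := L1_sinrho_mul rho Lw.
rewrite EN -cintegralB//.
have -> : 2 * remainder_bound rho * l1norm `]0, 1[ w / 2 ^+ N =
  2 * (remainder_bound rho / 2 ^+ N) * l1norm `]0, 1[ w.
  by field; rewrite expf_neq0.
apply: cintegral_le => //; first exact: L1B.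
  by rewrite /remainder_bound !mulr_ge0 ?expR_ge0 ?invr_ge0 ?exprn_ge0.
move=> x /itv01_bound x01; rewrite -mulrBl modcM ler_wpM2r//.
exact: sinrho_remainder.
Qed.

End TaylorExpansion.

(** * Explicit form of the characteristic function *)

Section CharacteristicFunction.
Variable R : realType.
Local Notation leb := (@lebesgue_measure R).
Local Notation mR := (measurableTypeR R).
Implicit Types (rho gam : R[i]) (x t a : R) (q f w k : R -> R[i]).

(** On a bounded interval 1 is integrable, and |y| <= 1 + y^2. *)
Lemma L2_L1 f (u v : R) : L2 `]u, v[ f -> L1 `]u, v[ f.
Proof.
move=> [[m1 m2] i2].
have i1 : leb.-integrable `]u, v[ (EFin \o (fun=> 1 : R)).
  suff [] : L1 `]u, v[ (fun=> 1%:C : R[i]) by [].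
  by apply: (L1_bounded (B := 1)) => // x _; rewrite modc_real normr1.
have mD : measurable (`]u, v[%classic : set mR) by [].
have i3 := integrableD mD i1 i2.
have sq (y z : R) : `|y| <= 1 + (y ^+ 2 + z ^+ 2).
  have := sqr_ge0 (`|y| - 1); have := sqr_ge0 z.
  rewrite sqrrB real_normK ?num_real// expr1n mulr1; have := normr_ge0 y; lra.
split; apply: (le_integrable mD _ _ i3).
- exact/measurable_EFinP.
- move=> x _ /=; rewrite lee_fin; apply: le_trans (ler_norm _).
  exact: sq.
- exact/measurable_EFinP.
- move=> x _ /=; rewrite lee_fin; apply: le_trans (ler_norm _).
  have := sq (complex.Im (f x)) (complex.Re (f x)); lra.
Qed.

Lemma L1_smooth_mul f g k (u v : R) : 0 <= u -> v <= 1 ->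
  is_cderive f g -> is_cderive g k ->
  forall q, L1 `]u, v[ q -> L1 `]u, v[ (fun x => f x * q x).
Proof.
move=> u0 v1 df dg q Lq; have ac := is_cderive_AC df dg.
apply: (L1_bounded_mul (B := modc (f 0) + l1norm `]0, 1[ g)) => //.
  exact: is_cderive_cmeasurable df.
move=> x ux; have /itv01_bound/andP[x0 x1] := itv_oo_sub u0 v1 ux.
exact: AC_bounded ac x0 x1.
Qed.

Lemma solution_transform q a rho y y' : L1 `]0, 1[ q ->
  solution q a (rho ^+ 2) y y' -> forall x, 0 <= x <= 1 ->
  y x * cosrho rho x - y' x * sinrho rho x =
    y 0 - y a * cintegral `]0, x[ (fun t => sinrho rho t * q t) /\
  y' x * cosrho rho x + rho ^+ 2 * (y x * sinrho rho x) =
    y' 0 + y a * cintegral `]0, x[ (fun t => cosrho rho t * q t).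
Proof.
move=> Lq [y'' [[acy acy' Ly''] eq]] x /andP[x0 x1].
have dS := is_cderive_sinrho rho; have dC := is_cderive_cosrho rho.
have dC2 := is_cderiveZ (- rho ^+ 2) dS.
have acS := is_cderive_AC dS dC; have acC := is_cderive_AC dC dC2.
have bC t : 0 < t < 1 -> modc (cosrho rho t) <= expR `|complex.Im rho|.
  by move=> /andP[/ltW t0 /ltW t1]; apply: modc_cosrho; rewrite t0.
have bS t : 0 < t < 1 -> modc (- rho ^+ 2 * sinrho rho t) <=
    modc rho * expR `|complex.Im rho|.
  move=> /andP[/ltW t0 /ltW t1]; rewrite modcM modcN expr2 modcM -mulrA ler_wpM2l//.
  by apply: modc_sinrho; rewrite t0.
have P1 := AC_mul acy acC bS; have P2 := AC_mul acy' acS bC.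
have P3 := AC_mul acy' acC bS; have P4 := AC_mul acy acS bC.
have sub h : L1 `]0, 1[ h -> L1 `]0, x[ h by exact: (L1_itv (lexx 0) x1).
have mD : measurable (`]0, x[%classic : set mR) by [].
have [L1_ E1] := P1; have [L2_ E2] := P2; have [L3_ E3] := P3; have [L4_ E4] := P4.
have {}E1 := E1 x; have {}E2 := E2 x; have {}E3 := E3 x; have {}E4 := E4 x.
have x01 : 0 <= x <= 1 by rewrite x0.
have LSq : L1 `]0, x[ (fun t => sinrho rho t * q t) by apply/sub/L1_sinrho_mul.
have LCq : L1 `]0, x[ (fun t => cosrho rho t * q t).
  exact/sub/(L1_smooth_mul _ _ dC dC2).
have ae : {ae leb, forall t, `]0, x[%classic t -> y'' t + rho ^+ 2 * y t = q t * y a}.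
  apply: (ae_imp eq) => t h tx; have {}h := h (itv_oo_sub (lexx 0) x1 tx).
  by rewrite -h; ring.
split.
- rewrite (E1 x01) (E2 x01) cosrho0 sinrho0 mulr1 mulr0 add0r -addrA; congr (_ + _).
  rewrite -cintegralB; [|by []|exact: sub|exact: sub].
  transitivity (cintegral `]0, x[ (fun t => - y a * (sinrho rho t * q t))); last first.
    by rewrite cintegralZ// mulNr.
  apply: ae_eq_cintegral => //.
  + by apply: L1B => //; exact: sub.
  + exact: L1Z.
  + apply: (ae_imp ae) => t h tx; have {}h := h tx.
    rewrite (_ : _ - _ = - (y'' t + rho ^+ 2 * y t) * sinrho rho t); last by ring.
    by rewrite h; ring.
- rewrite (E3 x01) (E4 x01) cosrho0 sinrho0 mulr1 mulr0 add0r -addrA; congr (_ + _).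
  rewrite -cintegralZ; [|by []|exact: sub].
  rewrite -cintegralD; [|by []|exact: sub|by apply: L1Z => //; exact: sub].
  rewrite -cintegralZ//; apply: ae_eq_cintegral => //.
  + by apply: L1D => //; [exact: sub|apply: L1Z => //; exact: sub].
  + exact: L1Z.
  + apply: (ae_imp ae) => t h tx; have {}h := h tx.
    transitivity ((y'' t + rho ^+ 2 * y t) * cosrho rho t); first by ring.
    by rewrite h; ring.
Qed.

Lemma preimage_shift_itv (u v c : R) :
  (fun x : mR => x + c : mR) @^-1` `]u, v[ = `]u - c, v - c[%classic.
Proof. by apply/seteqP; split=> x /=; rewrite !in_itv/= ltrBlDr ltrBrDr. Qed.

Lemma preimage_reflect_itv (u v c : R) :
  (fun x : mR => c - x : mR) @^-1` `]u, v[ = `]c - v, c - u[%classic.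
Proof.
by apply/seteqP; split=> x /=; rewrite !in_itv/= => /andP[h1 h2]; apply/andP; split; lra.
Qed.

Lemma measurable_shift (c : R) : measurable_fun [set: mR] (fun x : mR => x + c : mR).
Proof. exact: measurable_funD. Qed.

Lemma measurable_reflect (c : R) : measurable_fun [set: mR] (fun x : mR => c - x : mR).
Proof. exact: measurable_funB. Qed.

Lemma L1_shift (u v c : R) f : L1 `]u, v[ f ->
  L1 `]u - c, v - c[ (fun x => f (x + c)).
Proof.
move=> Lf; rewrite -preimage_shift_itv.
exact: (L1_comp_preimage (measurable_shift c) (@lebesgue_measure_shift R c)).
Qed.

Lemma cintegral_shift (u v c : R) f : L1 `]u, v[ f ->
  cintegral `]u - c, v - c[ (fun x => f (x + c)) = cintegral `]u, v[ f.
Proof.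
move=> Lf; rewrite -preimage_shift_itv.
exact: (cintegral_comp_preimage (measurable_shift c) (@lebesgue_measure_shift R c)).
Qed.

Lemma L1_reflect (u v c : R) f : L1 `]u, v[ f ->
  L1 `]c - v, c - u[ (fun x => f (c - x)).
Proof.
move=> Lf; rewrite -preimage_reflect_itv.
exact: (L1_comp_preimage (measurable_reflect c) (@lebesgue_measure_reflect R c)).
Qed.

Lemma cintegral_reflect (u v c : R) f : L1 `]u, v[ f ->
  cintegral `]c - v, c - u[ (fun x => f (c - x)) = cintegral `]u, v[ f.
Proof.
move=> Lf; rewrite -preimage_reflect_itv.
exact: (cintegral_comp_preimage (measurable_reflect c) (@lebesgue_measure_reflect R c)).
Qed.

Lemma shifted_left q a gam x : `]0, 1 - a[%classic x ->
  shifted q a gam x = q (x + a).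
Proof. by rewrite /= in_itv/= /shifted => /andP[_ ->]. Qed.

Lemma shifted_right q a gam x : `]1 - a, 1[%classic x ->
  shifted q a gam x = gam^-1 * q (x + (a - 1)).
Proof.
rewrite /= in_itv/= /shifted => /andP[/ltW]; rewrite leNgt => /negbTE -> _.
by rewrite addrA.
Qed.

Lemma L1_shifted_pieces q a gam : 0 <= a <= 1 -> L1 `]0, 1[ q ->
  L1 `]0, 1 - a[ (shifted q a gam) /\ L1 `]1 - a, 1[ (shifted q a gam).
Proof.
move=> /andP[a0 a1] Lq; split.
- have := L1_shift a (L1_itv a0 (lexx 1) Lq); rewrite subrr.
  by apply: eq_L1 => // x /shifted_left ->.
- have := L1_shift (a - 1) (L1_itv (lexx 0) a1 Lq).
  rewrite (_ : 0 - (a - 1) = 1 - a) 1?(_ : a - (a - 1) = 1); [|ring|ring].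
  move=> /(L1Z gam^-1 (measurable_itv _)); apply: eq_L1 => // x.
  by move=> /shifted_right ->.
Qed.

Lemma L1_glue (u v w : R) f : u <= v -> v <= w -> L1 `]u, v[ f -> L1 `]v, w[ f ->
  L1 `]u, w[ f.
Proof.
move=> uv vw [f1 f2] [g1 g2].
by split; [exact: (integrable_glue uv vw f1 g1)|exact: (integrable_glue uv vw f2 g2)].
Qed.

Lemma L1_shifted q a gam : 0 <= a <= 1 -> L1 `]0, 1[ q -> L1 `]0, 1[ (shifted q a gam).
Proof.
move=> a01 Lq; have [h1 h2] := L1_shifted_pieces gam a01 Lq; case/andP: a01 => a0 a1.
by apply: (@L1_glue _ (1 - a)) => //; rewrite ?subr_ge0// gerBl.
Qed.

Lemma cintegral_shifted q a gam k : 0 <= a <= 1 -> L1 `]0, 1[ q ->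
  L1 `]0, 1[ (fun x => k x * shifted q a gam x) ->
  L1 `]a, 1[ (fun t => k (t - a) * q t) -> L1 `]0, a[ (fun t => k (t + 1 - a) * q t) ->
  cintegral `]0, 1[ (fun x => k x * shifted q a gam x) =
  cintegral `]a, 1[ (fun t => k (t - a) * q t) +
  gam^-1 * cintegral `]0, a[ (fun t => k (t + 1 - a) * q t).
Proof.
move=> /andP[a0 a1] Lq Lk k1 k2.
rewrite (@cintegral_chasles _ 0 (1 - a))//; last 2 first.
  by rewrite subr_ge0.
  by rewrite gerBl.
congr (_ + _).
- rewrite -(cintegral_shift a k1) subrr; apply: eq_cintegral => x /[!inE] h.
  by rewrite (shifted_left _ _ h) addrK.
- rewrite -(cintegral_shift (a - 1) k2).
  rewrite (_ : 0 - (a - 1) = 1 - a) 1?(_ : a - (a - 1) = 1); [|ring|ring].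
  rewrite -cintegralZ//.
    apply: eq_cintegral => x /[!inE] h.
    rewrite (shifted_right _ _ h) (_ : x + (a - 1) + 1 - a = x); last by ring.
    by rewrite mulrCA.
  have := L1_shift (a - 1) k2.
  rewrite (_ : 0 - (a - 1) = 1 - a) 1?(_ : a - (a - 1) = 1); [|ring|ring].
  exact.
Qed.

(* w = gam q_a + q_a(1 - .) carries all the dependence of the characteristic
   function on q. *)
Definition symmetrized q a gam : R -> R[i] :=
  fun x => gam * shifted q a gam x + shifted q a gam (1 - x).

Lemma L1_symmetrized q a gam : 0 <= a <= 1 -> L1 `]0, 1[ q ->
  L1 `]0, 1[ (symmetrized q a gam).
Proof.
move=> a01 Lq; have Ls := L1_shifted gam a01 Lq.
apply: L1D => //; first exact: L1Z.
by have := L1_reflect 1 Ls; rewrite subrr subr0.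
Qed.

(** The transforms at a and at 1 express the boundary values of C and S by the integrals P1, P2 over
    ]0, a[ and Q1, Q2 over ]a, 1[. S solves the free equation, as S(a) = 0, but C does not, so the
    Wronskian C S' - S C' is not constant: its values at 0 and 1 are [W0] and [W1'], and they
    contribute to the term linear in q. *)
Lemma characteristic_functionE q a gam Delta rho : 0 <= a <= 1 -> gam != 0 ->
  L1 `]0, 1[ q -> characteristic_function q a gam Delta ->
  Delta (rho ^+ 2) = 1 + gam ^+ 2 - 2 * gam * cosrho rho 1 -
    gam * cintegral `]0, 1[ (fun x => sinrho rho x * symmetrized q a gam x).
Proof.
move=> a01 g0 Lq /(_ (rho ^+ 2))[C [C' [S [S' [[solC [Ca C'a]] [solS [Sa S'a]] ->]]]]].
have /andP[a0 a1] := a01.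
have tC := solution_transform Lq solC; have tS := solution_transform Lq solS.
have h1 : 0 <= (1 : R) <= 1 by rewrite ler01/=.
have [C1 C2] := tC a a01; have [C3 C4] := tC 1 h1.
have [S1 S2] := tS a a01; have [S3 S4] := tS 1 h1.
move: C1 C2 C3 C4 S1 S2 S3 S4; rewrite Ca C'a Sa S'a.
have dS := is_cderive_sinrho rho; have dC := is_cderive_cosrho rho.
have dC2 := is_cderiveZ (- rho ^+ 2) dS.
have LSq : L1 `]0, 1[ (fun t => sinrho rho t * q t) by exact: L1_sinrho_mul.
have LCq : L1 `]0, 1[ (fun t => cosrho rho t * q t) by exact: (L1_smooth_mul _ _ dC dC2).
rewrite (cintegral_chasles a0 a1 LSq) (cintegral_chasles a0 a1 LCq).
set P1 := cintegral `]0, a[ (fun t => sinrho rho t * q t).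
set P2 := cintegral `]0, a[ (fun t => cosrho rho t * q t).
set Q1 := cintegral `]a, 1[ (fun t => sinrho rho t * q t).
set Q2 := cintegral `]a, 1[ (fun t => cosrho rho t * q t).
set sa := sinrho rho a; set ca := cosrho rho a.
set s1 := sinrho rho 1; set c1 := cosrho rho 1.
have pa : ca ^+ 2 + rho ^+ 2 * sa ^+ 2 = 1 by exact: cos2Dsin2_rho.
have p1 : c1 ^+ 2 + rho ^+ 2 * s1 ^+ 2 = 1 by exact: cos2Dsin2_rho.
have la h : L1 `]0, 1[ h -> L1 `]0, a[ h by exact: (L1_itv (lexx 0) a1).
have ra h : L1 `]0, 1[ h -> L1 `]a, 1[ h by exact: (L1_itv a0 (lexx 1)).
have m1 : measurable (`]0, a[%classic : set mR) by [].
have m2 : measurable (`]a, 1[%classic : set mR) by [].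
have comb (D : set mR) (A B : R[i]) : measurable D ->
    L1 D (fun t => sinrho rho t * q t) -> L1 D (fun t => cosrho rho t * q t) ->
    L1 D (fun t => A * (sinrho rho t * q t) + B * (cosrho rho t * q t)) /\
    cintegral D (fun t => A * (sinrho rho t * q t) + B * (cosrho rho t * q t)) =
    A * cintegral D (fun t => sinrho rho t * q t) +
    B * cintegral D (fun t => cosrho rho t * q t).
  move=> mD l1 l2; split; first by apply: L1D => //; exact: L1Z.
  by rewrite cintegralD ?cintegralZ//; exact: L1Z.
have Ls := L1_shifted gam a01 Lq.
have Lss := L1_sinrho_mul rho Ls.
have Lsr : L1 `]0, 1[ (fun x => sinrho rho (1 - x) * shifted q a gam x).
  have := L1D (measurable_itv _) (L1Z s1 (measurable_itv _) (L1_smooth_mul (lexx 0) (lexx 1) dC dC2 Ls))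
    (L1Z (- c1) (measurable_itv _) Lss).
  by apply: eq_L1 => // x _; rewrite sinrhoD sinrhoN cosrhoN -/s1 -/c1; ring.
(* Going back from q_a to q moves the kernels to t - a and t + 1 - a, together with their
   reflections; the addition formulas reduce all four to P1, P2, Q1 and Q2. *)
have e1 t : sinrho rho (t - a) * q t = ca * (sinrho rho t * q t) + - sa * (cosrho rho t * q t).
  by rewrite sinrhoD sinrhoN cosrhoN -/sa -/ca; ring.
have e2 t : sinrho rho (t + 1 - a) * q t =
   (c1 * ca + rho ^+ 2 * (s1 * sa)) * (sinrho rho t * q t) +
   (s1 * ca - c1 * sa) * (cosrho rho t * q t).
  by rewrite -addrA sinrhoD sinrhoD cosrhoD sinrhoN cosrhoN -/sa -/ca -/s1 -/c1; ring.
have e3 t : sinrho rho (1 - (t - a)) * q t =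
   - (c1 * ca - rho ^+ 2 * (s1 * sa)) * (sinrho rho t * q t) +
   (s1 * ca + c1 * sa) * (cosrho rho t * q t).
  rewrite (_ : 1 - (t - a) = (1 + a) + - t); last by ring.
  by rewrite !sinrhoD cosrhoD sinrhoN cosrhoN -/sa -/ca -/s1 -/c1; ring.
have e4 t : sinrho rho (1 - (t + 1 - a)) * q t =
   - ca * (sinrho rho t * q t) + sa * (cosrho rho t * q t).
  rewrite (_ : 1 - (t + 1 - a) = a + - t); last by ring.
  by rewrite !sinrhoD sinrhoN cosrhoN -/sa -/ca; ring.
have fE (f g : R -> R[i]) : (forall t, f t = g t) -> f = g by move=> h; apply/funext.
have I1 : cintegral `]0, 1[ (fun x => sinrho rho x * shifted q a gam x) =
    ca * Q1 - sa * Q2 + gam^-1 * ((c1 * ca + rho ^+ 2 * (s1 * sa)) * P1 + (s1 * ca - c1 * sa) * P2).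
  rewrite (cintegral_shifted a01 Lq Lss); first last.
    by rewrite (fE _ _ e2); apply: (comb _ _ _ m1 (la _ LSq) (la _ LCq)).1.
    by rewrite (fE _ _ e1); apply: (comb _ _ _ m2 (ra _ LSq) (ra _ LCq)).1.
  rewrite (fE _ _ e1) (fE _ _ e2) (comb _ _ _ m2 (ra _ LSq) (ra _ LCq)).2.
  by rewrite (comb _ _ _ m1 (la _ LSq) (la _ LCq)).2 mulNr.
have I2 : cintegral `]0, 1[ (fun x => sinrho rho (1 - x) * shifted q a gam x) =
    - (c1 * ca - rho ^+ 2 * (s1 * sa)) * Q1 + (s1 * ca + c1 * sa) * Q2 +
    gam^-1 * (- ca * P1 + sa * P2).
  rewrite (cintegral_shifted (k := fun x => sinrho rho (1 - x)) a01 Lq Lsr); first last.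
    by rewrite (fE _ _ e4); apply: (comb _ _ _ m1 (la _ LSq) (la _ LCq)).1.
    by rewrite (fE _ _ e3); apply: (comb _ _ _ m2 (ra _ LSq) (ra _ LCq)).1.
  rewrite (fE _ _ e3) (fE _ _ e4) (comb _ _ _ m2 (ra _ LSq) (ra _ LCq)).2.
  by rewrite (comb _ _ _ m1 (la _ LSq) (la _ LCq)).2.
have I3 : cintegral `]0, 1[ (fun x => sinrho rho x * symmetrized q a gam x) =
   gam * cintegral `]0, 1[ (fun x => sinrho rho x * shifted q a gam x) +
   cintegral `]0, 1[ (fun x => sinrho rho (1 - x) * shifted q a gam x).
  have := cintegral_reflect 1 Lsr; rewrite subrr subr0 => <-.
  have := L1_reflect 1 Lsr; rewrite subrr subr0 => Lr.
  rewrite -cintegralZ// -cintegralD//; last exact: L1Z.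
  apply: eq_cintegral => x _; rewrite /symmetrized subKr; ring.
rewrite I3 I1 I2 => C1 C2 C3 C4 S1 S2 S3 S4.
have hC0 : C 0 = ca + P1 by move: C1; rewrite mul1r mul0r subr0 mul1r => ->; rewrite subrK.
have hC'0 : C' 0 = rho ^+ 2 * sa - P2.
  by move: C2; rewrite !mul1r mul0r add0r => ->; rewrite addrK.
have hS0 : S 0 = - sa by move: S1; rewrite !mul0r mul1r sub0r subr0 => <-.
have hS'0 : S' 0 = ca by move: S2; rewrite !mul0r mul1r mulr0 !addr0 => <-.
rewrite !mul0r subr0 addr0 in S3 S4; rewrite !mul1r in C3 C4.
(* Initial data at 0 of the free solution that has the value and the derivative of C at 1. *)
pose A := C 0 - (P1 + Q1); pose B := C' 0 + (P2 + Q2).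
have hC1 : C 1 = c1 * A + s1 * B.
  by rewrite /A /B -C3 -C4 -[LHS]mul1r -p1; ring.
have hC'1 : C' 1 = c1 * B - rho ^+ 2 * (s1 * A).
  by rewrite /A /B -C3 -C4 -[LHS]mul1r -p1; ring.
have hS1 : S 1 = c1 * S 0 + s1 * S' 0.
  by rewrite -S3 -S4 -[LHS]mul1r -p1; ring.
have hS'1 : S' 1 = c1 * S' 0 - rho ^+ 2 * (s1 * S 0).
  by rewrite -S3 -S4 -[LHS]mul1r -p1; ring.
have W0 : C 0 * S' 0 - S 0 * C' 0 = 1 + ca * P1 - sa * P2.
  by rewrite hC0 hC'0 hS0 hS'0 -pa; ring.
have W1 : C 1 * S' 1 - S 1 * C' 1 = A * S' 0 - B * S 0.
  rewrite hC1 hC'1 hS1 hS'1 -[RHS]mul1r -p1; ring.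
have W1' : A * S' 0 - B * S 0 = 1 - ca * Q1 + sa * Q2.
  by rewrite /A /B hC0 hC'0 hS0 hS'0 -pa; ring.
have -> : (C 0 - gam * C 1) * (S' 0 - gam * S' 1) - (S 0 - gam * S 1) * (C' 0 - gam * C' 1) =
   (C 0 * S' 0 - S 0 * C' 0) + gam ^+ 2 * (C 1 * S' 1 - S 1 * C' 1) -
   gam * (C 0 * S' 1 + C 1 * S' 0 - S 0 * C' 1 - S 1 * C' 0) by ring.
rewrite W0 W1 W1'.
have -> : C 0 * S' 1 + C 1 * S' 0 - S 0 * C' 1 - S 1 * C' 0 =
   2 * c1 * (ca ^+ 2 + rho ^+ 2 * sa ^+ 2) + (c1 * ca + rho ^+ 2 * (s1 * sa)) * P1 + (s1 * ca - c1 * sa) * P2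
   - (c1 * ca - rho ^+ 2 * (s1 * sa)) * Q1 + (s1 * ca + c1 * sa) * Q2.
  by rewrite hC1 hC'1 hS1 hS'1 /A /B hC0 hC'0 hS0 hS'0; ring.
by rewrite pa; field.
Qed.

End CharacteristicFunction.

(** * Vanishing odd moments force a null function *)

Section Moments.
Variable R : realType.
Local Notation leb := (@lebesgue_measure R).
Local Notation mR := (measurableTypeR R).
Implicit Types (h F : R -> R) (x y r : R).

(** The coefficient [a n] is the value at 0 of the n-th shift. If that shift vanishes identically,
    Horner's rule makes the next one vanish away from 0, and by continuity also at 0. *)
Lemma entire_value_eq0 (a : nat -> R[i]) : entire_coefs a ->
  (forall w, entire_value a w = 0) -> forall n, a n = 0.
Proof.
move=> ea a0.
suff key n w : entire_value (shift_coefs n a) w = 0.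
  by move=> n; have := entire_value_shift n 0 ea; rewrite key mul0r addr0 => <-.
elim: n w => [|n IH] w; first exact: a0.
have an : a n = 0 by have := entire_value_shift n 0 ea; rewrite IH mul0r addr0 => <-.
have nz z : z != 0 -> entire_value (shift_coefs n.+1 a) z = 0.
  move=> z0; have /esym/eqP := entire_value_shift n z ea; rewrite IH an add0r.
  by rewrite mulf_eq0 (negbTE z0) => /eqP.
have [->|] := eqVneq w 0; last exact: nz.
apply/eqP; apply: contraT => b0.
have [d d0 hd] := entire_value_near_neq0 (entire_shift_coefs n.+1 ea) b0.
have d2 : (d / 2)%:C != 0 :> R[i].
  by rewrite -modc_eq0 modc_real normr_eq0 mulf_neq0 ?gt_eqF.
have := hd (d / 2)%:C; rewrite subr0 modc_real gtr0_norm ?divr_gt0//.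
rewrite (nz _ d2) modc0 => /(_ _)/wrap[].
  by rewrite ltr_pdivrMr// ltr_pMr// ltr1n.
by rewrite ltNge divr_ge0.
Qed.

Lemma one_sub_expn_ge y (K : nat) : 0 <= y <= 1 -> 1 - K%:R * y <= (1 - y) ^+ K.
Proof.
move=> /andP[y0 y1]; elim: K => [|K IH]; first by rewrite mul0r subr0 expr0.
rewrite exprS; apply: (@le_trans _ _ ((1 - y) * (1 - K%:R * y))).
  rewrite -natr1; have : 0 <= K%:R * y * y by rewrite !mulr_ge0.
  by move: (K%:R) => k; lra.
by rewrite ler_wpM2l// subr_ge0.
Qed.

(** Bernoulli's inequality bounds K y by (1 + y)^K, and (1 - y^2)^K <= 1. *)
Lemma one_sub_expn_le y (K : nat) : 0 <= y <= 1 -> (1 - y) ^+ K * (K%:R * y) <= 1.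
Proof.
move=> /andP[y0 y1].
have h : 1 + K%:R * y <= (1 + y) ^+ K.
  elim: K => [|K IH]; first by rewrite mul0r addr0 expr0.
  rewrite exprS; apply: (@le_trans _ _ ((1 + y) * (1 + K%:R * y))).
    rewrite -natr1; have : 0 <= K%:R * y * y by rewrite !mulr_ge0.
    by move: (K%:R) => k; lra.
  by rewrite ler_wpM2l// addr_ge0.
have e0 : 0 <= (1 - y) ^+ K by rewrite exprn_ge0// subr_ge0.
apply: (@le_trans _ _ ((1 - y) ^+ K * (1 + y) ^+ K)).
  by rewrite ler_wpM2l// (le_trans _ h)// lerDr.
rewrite -exprMn exprn_ile1//; first by rewrite mulr_ge0 ?subr_ge0 ?addr_ge0.
by have := sqr_ge0 y; lra.
Qed.

(* Tends to 1 on [0, r[ and to 0 on ]r, 1], as n tends to infinity: the exponent is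
   about r^(-2n). *)
Definition cutoff r n x : R :=
  (1 - x ^+ n.*2) ^+ (Num.truncn (r ^+ n.*2)^-1).+1.

Lemma cutoff_bounds r n x : 0 <= x <= 1 -> 0 <= cutoff r n x <= 1.
Proof.
move=> /andP[x0 x1]; have y0 : 0 <= x ^+ n.*2 by exact: exprn_ge0.
have y1 : x ^+ n.*2 <= 1 by exact: exprn_ile1.
apply/andP; split; first by rewrite exprn_ge0// subr_ge0.
by apply: exprn_ile1; rewrite ?subr_ge0// gerBl.
Qed.

(** The exponent K of the cutoff satisfies r^(-2n) <= K <= r^(-2n) + 1. For x < r, Bernoulli gives 1
    - cutoff <= K x^(2n) <= 2 (x / r)^(2n); for x > r, [one_sub_expn_le] gives cutoff <= (r /
    x)^(2n). *)
Lemma cutoff_near r x : 0 < r < 1 -> 0 < x < 1 -> x != r ->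
  exists2 th : R, `|th| < 1 & forall n, `|cutoff r n x - (x < r)%R%:R| <= 2 * th ^+ n.
Proof.
move=> /andP[r0 r1] /andP[x0 x1] xr.
have y01 n : 0 <= x ^+ n.*2 <= 1 by rewrite exprn_ge0 ?exprn_ile1 ?ltW.
have rn n : 0 < r ^+ n.*2 by rewrite exprn_gt0.
have sqE (u : R) n : u ^+ n.*2 = (u ^+ 2) ^+ n by rewrite -exprM mul2n.
have ri n : 0 <= (r ^+ n.*2)^-1 by rewrite invr_ge0 ltW.
have K1 n : (Num.truncn (r ^+ n.*2)^-1).+1%:R <= (r ^+ n.*2)^-1 + 1.
  by rewrite -natr1 lerD2r; case/andP: (truncn_itv (ri n)).
have K2 n : (r ^+ n.*2)^-1 <= (Num.truncn (r ^+ n.*2)^-1).+1%:R.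
  by case/andP: (truncn_itv (ri n)) => _ /ltW.
have [xltr|rltx] := ltP x r.
  exists ((x / r) ^+ 2).
    rewrite ger0_norm ?sqr_ge0// exprn_ilt1// ?divr_ge0 ?ltW// ltr_pdivrMr//.
    by rewrite mul1r.
  move=> n; have x01 : 0 <= x <= 1 by rewrite !ltW.
  have /andP[c0 c1] := cutoff_bounds r n x01.
  rewrite distrC ger0_norm ?subr_ge0//.
  rewrite lerBlDr -lerBlDl; apply: le_trans (one_sub_expn_ge _ (y01 n)).
  rewrite lerD2l lerN2 -sqE expr_div_n.
  have /andP[y0 y1] := y01 n; have rr := rn n.
  have rle : r ^+ n.*2 <= 1 by rewrite exprn_ile1// ltW.
  apply: (le_trans (ler_wpM2r y0 (K1 n))).
  rewrite mulrDl mul1r mulrC.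
  have : x ^+ n.*2 <= x ^+ n.*2 / r ^+ n.*2 by rewrite ler_peMr// invf_ge1.
  by lra.
have {}rltx : r < x by rewrite lt_neqAle eq_sym xr.
exists ((r / x) ^+ 2).
  rewrite ger0_norm ?sqr_ge0// exprn_ilt1// ?divr_ge0 ?ltW// ltr_pdivrMr//.
  by rewrite mul1r.
move=> n; have x01 : 0 <= x <= 1 by rewrite !ltW.
have /andP[c0 c1] := cutoff_bounds r n x01.
rewrite subr0 ger0_norm// -sqE expr_div_n.
have := one_sub_expn_le (Num.truncn (r ^+ n.*2)^-1).+1 (y01 n).
rewrite -/(cutoff r n x) => h.
have xn : 0 < x ^+ n.*2 by rewrite exprn_gt0.
have h2 : cutoff r n x * ((r ^+ n.*2)^-1 * x ^+ n.*2) <= 1.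
  by apply: le_trans h; rewrite ler_wpM2l// ler_wpM2r// ltW.
have h3 : cutoff r n x <= r ^+ n.*2 / x ^+ n.*2.
  rewrite ler_pdivlMr//; have := ler_wpM2l (ltW (rn n)) h2; rewrite mulr1.
  by rewrite mulrCA mulVKf ?gt_eqF.
have : 0 <= r ^+ n.*2 / x ^+ n.*2 by rewrite divr_ge0// ltW.
by lra.
Qed.

Lemma integrable_bounded_mul (D : set mR) (g h : R -> R) : measurable D ->
  measurable_fun D g -> (forall x, D x -> `|g x| <= 1) ->
  leb.-integrable D (EFin \o h) -> leb.-integrable D (EFin \o (fun x => g x * h x)).
Proof.
move=> mD mg g1 ih; have /measurable_EFinP mh := measurable_int _ ih.
apply: (le_integrable mD _ _ ih).
  by apply/measurable_EFinP; exact: measurable_funM.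
by move=> x Dx /=; rewrite lee_fin normrM ler_piMl// g1.
Qed.

(** The free exponent j carries the induction on N: expanding one factor 1 - x^(2n) replaces j by j
    and j + n. *)
Lemma integral_even_poly_mul (F : R -> R) (n N j : nat) :
  leb.-integrable `]0, 1[ (EFin \o F) ->
  (forall j, \int[leb]_(x in `]0, 1[) (x ^+ j.*2 * F x) = 0) ->
  leb.-integrable `]0, 1[ (EFin \o (fun x => (1 - x ^+ n.*2) ^+ N * (x ^+ j.*2 * F x))) /\
  \int[leb]_(x in `]0, 1[) ((1 - x ^+ n.*2) ^+ N * (x ^+ j.*2 * F x)) = 0.
Proof.
move=> iF F0.
have mD : measurable (`]0, 1[%classic : set mR) by [].
have ix k : leb.-integrable `]0, 1[ (EFin \o (fun x => x ^+ k * F x)).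
  apply: (integrable_bounded_mul (g := fun x => x ^+ k)) => //.
  move=> x /itv01_bound/andP[x0 x1].
  by rewrite ger0_norm ?exprn_ge0// exprn_ile1.
elim: N j => [|N IH] j.
  have -> : (fun x => (1 - x ^+ n.*2) ^+ 0 * (x ^+ j.*2 * F x)) = (fun x => x ^+ j.*2 * F x).
    by apply/funext => x; rewrite expr0 mul1r.
  by split.
have [i1 z1] := IH j; have [i2 z2] := IH (j + n)%N.
have -> : (fun x => (1 - x ^+ n.*2) ^+ N.+1 * (x ^+ j.*2 * F x)) =
  (fun x => (1 - x ^+ n.*2) ^+ N * (x ^+ j.*2 * F x) -
            (1 - x ^+ n.*2) ^+ N * (x ^+ (j + n).*2 * F x)).
  by apply/funext => x; rewrite exprS doubleD exprD; ring.
split; last by rewrite RintegralB// z1 z2 subrr.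
by apply: (eq_integrable mD _ _ _ (integrableB mD i1 i2)) => x _ /=.
Qed.

(** Cutoffs are polynomials in x^2 with values in [0, 1] on the unit interval. Their integrals
    against F vanish, and dominated convergence, with bound |F| and exceptional point r, passes to
    the indicator of ]0, r[. *)
Lemma even_moments_integral0 (F : R -> R) r :
  leb.-integrable `]0, 1[ (EFin \o F) ->
  (forall j, \int[leb]_(x in `]0, 1[) (x ^+ j.*2 * F x) = 0) ->
  0 < r < 1 -> \int[leb]_(x in `]0, r[) F x = 0.
Proof.
move=> iF F0 r01; have /andP[r0 r1] := r01.
have mD : measurable (`]0, 1[%classic : set mR) by [].
have /measurable_EFinP mF := measurable_int _ iF.
have icut n : leb.-integrable `]0, 1[ (EFin \o (fun x => cutoff r n x * F x)) /\
    \int[leb]_(x in `]0, 1[) (cutoff r n x * F x) = 0.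
  have -> : (fun x => cutoff r n x * F x) = (fun x => (1 - x ^+ n.*2) ^+
      (Num.truncn (r ^+ n.*2)^-1).+1 * (x ^+ 0.*2 * F x)).
    by apply/funext => x; rewrite /cutoff expr0 mul1r.
  exact: integral_even_poly_mul.
pose chi x : R := (x < r)%R%:R.
have mchi : measurable_fun (`]0, 1[%classic : set mR) chi.
  have -> : chi = \1_(`]-oo, r[%classic : set mR).
    apply/funext => x; rewrite indicE /chi; congr ((nat_of_bool _)%:R).
    by apply/idP/idP; rewrite inE/= in_itv.
  exact: measurable_indic.
have mchiF : measurable_fun (`]0, 1[%classic : set mR) (fun x => chi x * F x).
  exact: measurable_funM.
have [] := @dominated_convergence _ mR R leb `]0, 1[%classic mD
  (fun n x => (cutoff r n x * F x)%:E) (fun x => (chi x * F x)%:E) (fun x => `|F x|%:E).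
- by move=> n; exact: measurable_int (icut n).1.
- exact/measurable_EFinP.
- exists [set r]; split; [exact: measurable_set1|exact: lebesgue_measure_set1|].
  move=> x /=; apply: contra_notP => /eqP xr; rewrite in_itv/= => x01.
  have [th th1 hth] := cutoff_near r01 x01 xr.
  apply: cvg_EFin; first exact: nearW.
  apply: cvgMr_tmp => //.
  apply/cvgrPdist_le => e e0.
  have : 2 * (th ^+ n) @[n --> \oo] --> 2 * (0 : R).
    by apply: cvgMr; exact: cvg_expr.
  rewrite mulr0 => /cvgrPdist_le/(_ _ e0); apply: filterS => n.
  rewrite sub0r normrN distrC; apply: le_trans.
  exact: le_trans (hth n) (ler_norm _).
- exact: integrable_norm.
- apply: aeW => x n x01; rewrite lee_fin normrM ler_piMl//.
  have /andP[c0 c1] := cutoff_bounds r n (itv01_bound x01).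
  by rewrite ger0_norm.
move=> ichi _ lim.
have : (\int[leb]_(x in `]0%R, 1%R[) (chi x * F x)%:E = 0)%E.
  apply: (cvg_unique _ lim) => //.
  rewrite (_ : [sequence _]_n = cst 0%E); first exact: cvg_cst.
  apply/funext => n /=; rewrite -[LHS]fineK; last exact: integrable_fin_num (icut n).1.
  by have := (icut n).2; rewrite /Rintegral => ->.
move=> /(congr1 fine) /= Z.
have ichi' : leb.-integrable `]0, 1[ (EFin \o (fun x => chi x * F x)) by exact: ichi.
have := Rintegral_chasles (ltW r0) (ltW r1) ichi'.
rewrite {1}/Rintegral Z.
have -> : \int[leb]_(x in `]0, r[) (chi x * F x) = \int[leb]_(x in `]0, r[) F x.
  by apply: eq_Rintegral => x /[!inE]/= /[!in_itv]/= /andP[_ xr]; rewrite /chi xr mul1r.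
have -> : \int[leb]_(x in `]r, 1[) (chi x * F x) = \int[leb]_(x in `]r, 1[) (0 : R).
  by apply: eq_Rintegral => x /[!inE]/= /[!in_itv]/= /andP[rx _]; rewrite /chi ltNge ltW// mul0r.
by rewrite Rintegral_cst// mul0r addr0 => <-.
Qed.

(** By Lebesgue differentiation F is almost everywhere the derivative of its indefinite integral,
    which is locally 0 inside ]0, 1[. *)
Lemma indefinite_integral0_ae (F : R -> R) :
  leb.-integrable `]0, 1[ (EFin \o F) ->
  (forall r, 0 < r < 1 -> \int[leb]_(x in `]0, r[) F x = 0) ->
  {ae leb, forall x, `]0, 1[%classic x -> F x = 0}.
Proof.
move=> iF F0.
have mD : measurable (`]0, 1[%classic : set mR) by [].
pose G := F \_ (`]0, 1[%classic : set mR).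
have locG : locally_integrable [set: R] G by exact: integrable_locally.
have iG : leb.-integrable setT (EFin \o G).
  have /(integrable_mkcond _ mD) := iF.
  by rewrite /G restrict_EFin.
have iGy y : leb.-integrable [set` Interval (BRight 0) (BRight y)] (EFin \o G).
  by apply: integrableS iG.
have := FTC1 iGy locG; set Phi := (fun x => _).
move=> H; apply: (ae_imp H) => x hx x01; have := x01; rewrite /= in_itv/= => /andP[x0 x1].
have lx : (BRight (0 : R) < BRight x)%O by rewrite bnd_simp.
have [_ E] := hx lx.
have -> : F x = G x by rewrite /G patchE mem_set.
rewrite -E derive1E.
have d0 : is_derive x 1 Phi (0 : R).
  apply: (near_eq_is_derive (f := cst 0)) (is_derive_cst (0 : R) x 1).
  have : \forall y \near x, y \in `]0, 1[ by apply: near_in_itvoo; rewrite in_itv/= x0.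
  apply: filterS => y; rewrite in_itv/= => y01.
  have i1 : leb.-integrable `]0, y[ (EFin \o G) by exact: integrableS iG.
  transitivity (\int[leb]_(t in `]0, y[) F t); first by rewrite F0.
  rewrite /Phi /= -(Rintegral_itv_bndo_bndc (a := BRight 0) i1).
  apply: eq_Rintegral => t /[!inE]/= /[!in_itv]/= /andP[t0 ty].
  by rewrite /G patchE mem_set//= in_itv/= t0 (lt_trans ty)//; case/andP: y01.
by have [] := d0.
Qed.

(** The odd moments of h are the even moments of x h, and x is nonzero on ]0, 1[. *)
Lemma odd_moments_ae0 (h : R -> R) : leb.-integrable `]0, 1[ (EFin \o h) ->
  (forall n, \int[leb]_(x in `]0, 1[) (x ^+ n.*2.+1 * h x) = 0) ->
  {ae leb, forall x, `]0, 1[%classic x -> h x = 0}.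
Proof.
move=> ih h0; pose F x := x * h x.
have iF : leb.-integrable `]0, 1[ (EFin \o F).
  apply: integrable_bounded_mul => // x /itv01_bound/andP[x0 x1].
  by rewrite ger0_norm.
have F0 j : \int[leb]_(x in `]0, 1[) (x ^+ j.*2 * F x) = 0.
  by rewrite -[RHS](h0 j); apply: eq_Rintegral => x _; rewrite /F mulrA -exprSr.
have := indefinite_integral0_ae iF (fun r => even_moments_integral0 iF F0).
move=> H; apply: (ae_imp H) => x hx x01; have /eqP := hx x01.
move: x01; rewrite /= in_itv/= => /andP[x0 _].
by rewrite mulf_eq0 gt_eqF//= => /eqP.
Qed.

Lemma sin_integral_ae0 (w : R -> R[i]) : L1 `]0, 1[ w ->
  (forall z, entire_value (sin_integral_coefs w) z = 0) ->
  ae_eq_on `]0, 1[ w (fun=> 0).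
Proof.
move=> Lw w0; have [w1 w2] := Lw.
have m0 := entire_value_eq0 (entire_sin_integral_coefs Lw) w0.
have mD : measurable (`]0, 1[%classic : set mR) by [].
have key n : cintegral `]0, 1[ (fun x => (x ^+ n.*2.+1)%:C * w x) = 0.
  have c0 : (- 1) ^+ n * (n.*2.+1`!%:R : R)%:C != 0 :> R[i].
    rewrite mulf_neq0 ?signr_eq0// -modc_eq0 modc_real normr_eq0 pnatr_eq0.
    by rewrite -lt0n fact_gt0.
  have -> : (fun x : R => (x ^+ n.*2.+1)%:C * w x) =
    (fun x => ((- 1) ^+ n * (n.*2.+1`!%:R : R)%:C) * (sin_coefs x n * w x)).
    apply/funext => x; rewrite /sin_coefs /monomial.
    have -> : (x ^+ n.*2.+1)%:C = (n.*2.+1`!%:R : R)%:C * (x ^+ n.*2.+1 / n.*2.+1`!%:R)%:C :> R[i].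
      by rewrite -rmorphM mulrC divfK// pnatr_eq0 -lt0n fact_gt0.
    set A := _%:C; set B := _%:C.
    have s1 : (- 1) ^+ n * (- 1) ^+ n = 1 :> R[i] by rewrite -expr2 sqrr_sign.
    transitivity (((- 1) ^+ n * (- 1) ^+ n) * (A * B * w x)); last by ring.
    by rewrite s1 mul1r.
  rewrite cintegralZ//; last exact: L1_sin_coef_mul.
  by have := m0 n; rewrite /sin_integral_coefs => ->; rewrite mulr0.
have h1 := odd_moments_ae0 w1; have h2 := odd_moments_ae0 w2.
have k1 n : \int[leb]_(x in `]0, 1[) (x ^+ n.*2.+1 * complex.Re (w x)) = 0.
  apply: etrans (congr1 (@complex.Re R) (key n)).
  by apply: eq_Rintegral => x _; case: (w x) => a b /=; rewrite mul0r subr0.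
have k2 n : \int[leb]_(x in `]0, 1[) (x ^+ n.*2.+1 * complex.Im (w x)) = 0.
  apply: etrans (congr1 (@complex.Im R) (key n)).
  by apply: eq_Rintegral => x _; case: (w x) => a b /=; rewrite mul0r addr0.
apply: (ae_imp (ae_and (h1 k1) (h2 k2))) => x [e1 e2] x01.
by move: (e1 x01) (e2 x01); case: (w x) => a b /= -> ->.
Qed.

End Moments.

(** * Lower bound on the boundary of large squares *)

Section BoundaryEstimate.
Variable R : realType.
Implicit Types (gam rho w : R[i]) (x y t : R).

(** The left-hand side is the distance from 1 to the real line spanned by w, hence a bound uniform
    in the scale t. *)
Lemma modc_one_sub_ge w t : w != 0 ->
  `|complex.Im w| / modc w <= modc (1 - t%:C * w).
Proof.
move=> w0; rewrite ler_pdivrMr ?modc_gt0//.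
have -> : modc w = modc (w^*%C) by apply: complexI; rewrite !modcE normcJ.
rewrite -modcM; apply: le_trans (Im_le_modc _).
case: w w0 => a b w0 /=; rewrite le_eqVlt; apply/orP; left; apply/eqP.
by rewrite -normrN; congr `|_|; ring.
Qed.

(** The characteristic function of the zero potential. *)
Definition unperturbed gam rho : R[i] := 1 + gam ^+ 2 - 2 * gam * cosrho rho 1.

Lemma unperturbedE gam rho : unperturbed gam rho =
  (1 - gam * expc ('i * rho)) * (1 - gam * expc (- ('i * rho))).
Proof.
rewrite /unperturbed /cosrho (_ : (1 : R)%:C = 1)// mulr1.
have := expcN ('i * rho); set A := expc _; set B := expc _ => AB.
transitivity (1 + gam ^+ 2 * (A * B) - gam * (A + B)); last by ring.
by rewrite AB; field.
Qed.

(** The threshold on E makes |gam| E >= 2, so the first factor is at least |gam| E / 2, and |gam| /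
    E <= 1 / 2, so the second is at least 1 / 2. *)
Lemma unperturbed_large gam (A B : R[i]) (E : R) : gam != 0 -> modc A = E ->
  modc B = E^-1 -> 2 * (modc gam + (modc gam)^-1) <= E ->
  modc gam / 4 * E <= modc ((1 - gam * A) * (1 - gam * B)).
Proof.
move=> g0 hA hB hE; set g := modc gam in hE *.
have gp : 0 < g by rewrite modc_gt0.
have gi : 0 < g^-1 by rewrite invr_gt0.
have E0 : 0 < E by lra.
have h1 : g * E / 2 <= modc (1 - gam * A).
  have := modc_lower (gam * A) 1; rewrite modc_dist modc1 modcM hA -/g => h.
  have : g * (2 * (g + g^-1)) <= g * E by rewrite ler_pM2l.
  rewrite mulrCA mulrDr divff ?gt_eqF// => h'.
  have := sqr_ge0 g; rewrite expr2; lra.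
have h2 : 2^-1 <= modc (1 - gam * B).
  have := modc_lower 1 (gam * B); rewrite modc1 modcM hB -/g => h.
  have : g / E <= 2^-1 by rewrite ler_pdivrMr//; lra.
  lra.
rewrite modcM; apply: le_trans (ler_pM _ _ h1 h2); last 2 first.
- by rewrite !mulr_ge0// ltW.
- by [].
by rewrite le_eqVlt; apply/orP; left; apply/eqP; field.
Qed.

Lemma expc_side (x y : R) : expc ('i * (x +i* y)) = (expR (- y))%:C * expc (0 +i* x) /\
  expc (- ('i * (x +i* y))) = (expR y)%:C * expc (0 +i* - x).
Proof.
have e (a b : R) : expc (a +i* b) = (expR a)%:C * expc (0 +i* b).
  by rewrite /expc /= expR0 !mul1r; simpc; rewrite ?mulr0 ?mul0r ?subr0 ?add0r ?addr0.
have -> : 'i * (x +i* y) = (- y) +i* x :> R[i] by simpc.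
split; first exact: e.
by rewrite -e; congr expc; simpc.
Qed.

(** Where e^|y| >= L one factor dominates. Elsewhere |x| = r, since r > L excludes the horizontal
    sides; there the directions of gam e^(i x) and gam e^(-i x) are fixed away from the real axis,
    and [modc_one_sub_ge] bounds both factors whatever the height y. *)
Lemma unperturbed_lower_bound gam : gam != 0 -> exists2 c : R, 0 < c &
  forall M : R, exists r, [/\ M <= r, 0 < r &
    forall x y, `|x| = r \/ `|y| = r ->
      c * expR `|y| <= modc (unperturbed gam (x +i* y))].
Proof.
move=> g0; set g := modc gam; have gp : 0 < g by rewrite modc_gt0.
set L := 2 * (g + g^-1).
have L0 : 0 < L by rewrite mulr_gt0// addr_gt0// invr_gt0.
have [r0 [d [r00 d0 hd]]] : exists r0 d : R, [/\ 0 <= r0, 0 < d &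
    forall n x, `|x| = r0 + pi *+ 2 *+ n ->
      d <= `|complex.Im (gam * expc (0 +i* x))|].
  have ev x : gam * expc (0 +i* x) = (complex.Re gam * cos x - complex.Im gam * sin x) +i*
      (complex.Re gam * sin x + complex.Im gam * cos x).
    by rewrite /expc /= expR0 !mul1r; case: gam g0 {gp} @g @L L0 => a b /= *; simpc.
  have perc n (u : R) : cos (u + pi *+ 2 *+ n) = cos u by exact: periodicn (@cosD2pi R) n u.
  have pers n (u : R) : sin (u + pi *+ 2 *+ n) = sin u by exact: periodicn (@sinD2pi R) n u.
  have cs n x r0 : `|x| = r0 + pi *+ 2 *+ n -> cos x = cos r0 /\ `|sin x| = `|sin r0|.
    have [x0|x0] := leP 0 x; first by rewrite ger0_norm// => ->; rewrite perc pers.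
    move=> hx; have {hx}-> : x = - (r0 + pi *+ 2 *+ n) by rewrite -hx ltr0_norm ?opprK.
    by rewrite cosN sinN normrN perc pers.
  (* Im(gam e^(i x)) is Re gam sin x + Im gam cos x: in absolute value it is |Re gam| at x = pi / 2
     or - pi / 2, and |Im gam| at x = pi or - pi if Re gam = 0. *)
  have [a0|a0] := eqVneq (complex.Re gam) 0.
    exists pi, `|complex.Im gam|; split; first exact: pi_ge0.
      rewrite normr_gt0; apply: contra g0 => /eqP b0.
      by move: a0 b0; case: (gam) => a b /= -> ->.
    move=> n x /cs[hc hs]; rewrite ev /= a0 mul0r add0r hc cospi normrM normrN1.
    by rewrite mulr1.
  exists (pi / 2), `|complex.Re gam|; split.
  - by rewrite divr_ge0// pi_ge0.
  - by rewrite normr_gt0.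
  move=> n x /cs[hc hs]; rewrite ev /= hc cos_pihalf mulr0 addr0 normrM hs.
  by rewrite sin_pihalf normr1 mulr1.
have dg0 : 0 < d / g by rewrite divr_gt0.
(* The second constant is for e^|y| < L, where a bound without exponential is turned into a multiple
   of e^|y|. *)
exists (Num.min (g / 4) ((d / g) ^+ 2 / L)).
  by rewrite lt_min !divr_gt0// exprn_gt0.
move=> M.
have [n hn] : exists n : nat, `|M| + L < pi *+ 2 *+ n.
  exists (Num.bound (`|M| + L)).
  apply: (lt_le_trans (archi_boundP _)); first by rewrite addr_ge0// ltW.
  rewrite -[leRHS]mulr_natr ler_peMl//.
  by have := pi_ge2 R; rewrite mulr2n; lra.
pose r := r0 + pi *+ 2 *+ n; exists r.
have rM : `|M| + L < r by rewrite /r; lra.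
have Ml := ler_norm M; have M0 := normr_ge0 M.
split; [lra|lra|move=> x y hxy].
have [e1 e2] := expc_side x y.
have m1 : modc (expc ('i * (x +i* y))) = expR (- y).
  by rewrite e1 modcM modc_real modc_expc /= expR0 mulr1 ger0_norm ?expR_ge0.
have m2 : modc (expc (- ('i * (x +i* y)))) = expR y.
  by rewrite e2 modcM modc_real modc_expc /= expR0 mulr1 ger0_norm ?expR_ge0.
rewrite unperturbedE.
have [big|small] := leP L (expR `|y|).
  apply: (@le_trans _ _ (g / 4 * expR `|y|)).
    by rewrite ler_wpM2r ?expR_ge0// ge_min lexx.
  have [y0|y0] := leP 0 y.
    rewrite [in leRHS]mulrC; apply: unperturbed_large => //; first by rewrite m2 ger0_norm.
    by rewrite m1 ger0_norm// expRN.
  apply: unperturbed_large => //; first by rewrite m1 ltr0_norm.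
  by rewrite m2 ltr0_norm// expRN invrK.
have {hxy}xr : `|x| = r.
  case: hxy => // yr; move: small; rewrite yr ltNge => /negP[].
  by have := expR_ge1Dx r; lra.
have side u s : `|u| = r -> d / g <= modc (1 - gam * ((expR s)%:C * expc (0 +i* u))).
  move=> ur; rewrite mulrCA.
  have u1 : modc (expc (0 +i* u)) = 1 by rewrite modc_expc /= expR0.
  have gu0 : gam * expc (0 +i* u) != 0.
    by rewrite -modc_eq0 modcM u1 mulr1 modc_eq0.
  apply: le_trans (modc_one_sub_ge (expR s) gu0).
  by rewrite modcM u1 mulr1 -/g ler_pM2r ?invr_gt0//; exact: hd ur.
apply: (@le_trans _ _ ((d / g) ^+ 2)).
  apply: (@le_trans _ _ ((d / g) ^+ 2 / L * expR `|y|)).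
    by rewrite ler_wpM2r ?expR_ge0// ge_min lexx orbT.
  rewrite -mulrA ler_piMr ?sqr_ge0// mulrC ler_pdivrMr// mul1r; exact: ltW.
rewrite e1 e2 modcM expr2; apply: ler_pM; [exact: ltW|exact: ltW|exact: side|].
by apply: side; rewrite normrN.
Qed.

End BoundaryEstimate.

(** * The zeros determine the symmetrized potential *)

Section Uniqueness.
Variable R : realType.
Implicit Types (gam rho w z : R[i]) (v : R -> R[i]).

Definition const_coefs (c : R[i]) (k : nat) : R[i] := if k == 0%N then c else 0.

Lemma entire_const_coefs c : entire_coefs (const_coefs c).
Proof.
apply: (@entire_coefs_fact _ _ (modc c)) => // -[|k].
  by rewrite /const_coefs eqxx fact0 divr1.
by rewrite /const_coefs /= modc0 divr_ge0.
Qed.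

Lemma entire_value_const c w : entire_value (const_coefs c) w = c.
Proof.
apply: entire_valueE; first exact: entire_const_coefs.
exists (modc c) => -[|n]; first by rewrite /partial_sum big_ord0 subr0 expr0 divr1.
rewrite /partial_sum big_ord_recl big1 /const_coefs /=.
  by rewrite expr0 mulr1 addr0 subrr modc0 divr_ge0// exprn_ge0.
by move=> i _; rewrite /= mul0r.
Qed.

(** The factors 1 give the sum the shape c a + d b of [entire_coefsD] and [entire_valueD]. *)
Definition characteristic_coefs gam v : nat -> R[i] := fun k =>
  1 * (1 * const_coefs (1 + gam ^+ 2) k + (- (2 * gam)) * cos_coefs 1 k) +
  (- gam) * sin_integral_coefs v k.

Let h1 : 0 <= (1 : R) <= 1. Proof. by rewrite ler01/=. Qed.

Lemma entire_characteristic_coefs gam v : L1 `]0, 1[ v ->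
  entire_coefs (characteristic_coefs gam v).
Proof.
move=> Lv; apply: entire_coefsD; last exact: entire_sin_integral_coefs.
by apply: entire_coefsD; [exact: entire_const_coefs|exact: entire_cos_coefs].
Qed.

Lemma characteristic_coefsE gam v rho : L1 `]0, 1[ v ->
  entire_value (characteristic_coefs gam v) (rho ^+ 2) =
  unperturbed gam rho - gam * cintegral `]0, 1[ (fun x => sinrho rho x * v x).
Proof.
move=> Lv; rewrite entire_valueD; last exact: entire_sin_integral_coefs; last first.
  by apply: entire_coefsD; [exact: entire_const_coefs|exact: entire_cos_coefs].
rewrite entire_valueD; [|exact: entire_const_coefs|exact: entire_cos_coefs].
rewrite entire_value_const entire_value_cos// entire_value_sin_integral//.
by rewrite /unperturbed; ring.
Qed.

Lemma sin_integral_bound v (x y r : R) : L1 `]0, 1[ v -> 0 < r ->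
  `|x| = r \/ `|y| = r ->
  modc (cintegral `]0, 1[ (fun t => sinrho (x +i* y) t * v t)) <=
  2 * l1norm `]0, 1[ v / r * expR `|y|.
Proof.
move=> Lv r0 hxy; set rho := x +i* y.
have rrho : r <= modc rho.
  by case: hxy => <-; [exact: (Re_le_modc rho)|exact: (Im_le_modc rho)].
have E0 := expR_ge0 `|y|.
have -> : 2 * l1norm `]0, 1[ v / r * expR `|y| = 2 * (expR `|y| / r) * l1norm `]0, 1[ v.
  by ring.
apply: cintegral_le => //; first exact: L1_sinrho_mul.
  by rewrite divr_ge0// ltW.
move=> t /itv01_bound t01; rewrite modcM ler_wpM2r// ler_pdivlMr// mulrC.
apply: le_trans (modc_sinrho rho t01).
by rewrite ler_wpM2r.
Qed.

Lemma characteristic_uniqueness gam v1 v2 : gam != 0 ->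
  L1 `]0, 1[ v1 -> L1 `]0, 1[ v2 ->
  (forall z, exists m, zero_of_order (entire_value (characteristic_coefs gam v1)) z m /\
    zero_of_order (entire_value (characteristic_coefs gam v2)) z m) ->
  ae_eq_on `]0, 1[ v1 v2.
Proof.
move=> g0 Lv1 Lv2 hz.
have ea := entire_characteristic_coefs gam Lv1.
have eb := entire_characteristic_coefs gam Lv2.
have mD : measurable (`]0, 1[%classic : set (measurableTypeR R)) by [].
have [c c0 hc] := unperturbed_lower_bound g0.
set g := modc gam.
have gp : 0 < g by rewrite modc_gt0.
(* From this threshold on, the integral term takes away at most half of the lower bound c e^|y|. *)
have lower v (x y r : R) : L1 `]0, 1[ v -> 0 < r -> 4 * g * l1norm `]0, 1[ v / c <= r ->
    c * expR `|y| <= modc (unperturbed gam (x +i* y)) -> `|x| = r \/ `|y| = r ->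
    c / 2 * expR `|y| <= modc (entire_value (characteristic_coefs gam v) ((x +i* y) ^+ 2)).
  move=> Lv r0 hr hu hxy; rewrite characteristic_coefsE//.
  apply: le_trans (modc_lower _ _); rewrite modcM -/g.
  have h := sin_integral_bound Lv r0 hxy.
  have h' : g * modc (cintegral `]0, 1[ (fun t => sinrho (x +i* y) t * v t)) <=
     c / 2 * expR `|y|.
    apply: (le_trans (ler_wpM2l (ltW gp) h)).
    rewrite mulrA ler_wpM2r ?expR_ge0// mulrA ler_pdivrMr//.
    by move: hr; rewrite ler_pdivrMr// mulrC; lra.
  lra.
have nonzero v : L1 `]0, 1[ v -> exists w, entire_value (characteristic_coefs gam v) w != 0.
  move=> Lv; have [r [hr r0 hb]] := hc (4 * g * l1norm `]0, 1[ v / c).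
  exists ((r +i* 0) ^+ 2); rewrite -modc_gt0.
  have rr : `|r| = r \/ `|0 : R| = r by left; rewrite gtr0_norm.
  apply: lt_le_trans (lower v r 0 r Lv r0 hr (hb r 0 rr) rr).
  by rewrite mulr_gt0 ?expR_gt0// divr_gt0.
have dvd z : divisible_at (fun k => 1 * characteristic_coefs gam v1 k +
    (- 1) * characteristic_coefs gam v2 k) (characteristic_coefs gam v2) z.
  have [m [z1 z2]] := hz z.
  exact: same_zeros_divisible ea eb (nonzero _ Lv1) (nonzero _ Lv2) z1 z2.
pose v x := v1 x - v2 x.
have Lv : L1 `]0, 1[ v by exact: L1B.
have DE rho : entire_value (fun k => 1 * characteristic_coefs gam v1 k +
    (- 1) * characteristic_coefs gam v2 k) (rho ^+ 2) =
    - (gam * cintegral `]0, 1[ (fun x => sinrho rho x * v x)).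
  rewrite entire_valueD// !characteristic_coefsE//.
  have -> : (fun x => sinrho rho x * v x) =
     (fun x => sinrho rho x * v1 x - sinrho rho x * v2 x).
    by apply/funext => x; rewrite mulrBr.
  rewrite cintegralB//; [by ring|exact: L1_sinrho_mul|exact: L1_sinrho_mul].
have D0 rho : entire_value (fun k => 1 * characteristic_coefs gam v1 k +
    (- 1) * characteristic_coefs gam v2 k) (rho ^+ 2) = 0.
  apply/eqP; rewrite -modc_eq0 eq_le modc_ge0 andbT leNgt; apply/negP => Dpos.
  pose T := modc (entire_value (characteristic_coefs gam v2) (rho ^+ 2)).
  (* On the boundary the difference is at most 2 g [l1norm v] e^|y| / r and the divisor at least c
     e^|y| / 2: the ratio is K / r. *)
  pose K := 4 * g * l1norm `]0, 1[ v / c.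
  have K0 : 0 <= K by rewrite divr_ge0 ?mulr_ge0 ?l1norm_ge0// ltW.
  set Dr := modc _ in Dpos.
  have l20 : 0 <= 4 * g * l1norm `]0, 1[ v2 / c by rewrite divr_ge0 ?mulr_ge0 ?l1norm_ge0// ltW.
  have T0 : 0 <= T by exact: modc_ge0.
  have KT0 : 0 <= K * T / Dr by apply: divr_ge0; [exact: mulr_ge0|exact: ltW].
  (* The three summands make [lower] available for v2, put rho inside the square, and ensure K T / r
     < Dr, which contradicts the maximum principle. *)
  have [r [hr r0 hb]] := hc (4 * g * l1norm `]0, 1[ v2 / c + modc rho + (K * T / Dr + 1)).
  have rho0 := modc_ge0 rho.
  have hr2 : 4 * g * l1norm `]0, 1[ v2 / c <= r by lra.
  have max := @square_maximum_principle R _ _ r (K / r) r0 dvd.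
  have xr : `|complex.Re rho| <= r by apply: (le_trans (Re_le_modc rho)); lra.
  have yr : `|complex.Im rho| <= r by apply: (le_trans (Im_le_modc rho)); lra.
  have := max _ _ _ xr yr.
  rewrite (_ : _ +i* _ = rho); last by case: (rho).
  rewrite -/Dr -/T => /(_ _)/wrap[|].
    move=> x y _ _ hxy; have low := lower v2 x y r Lv2 r0 hr2 (hb x y hxy) hxy.
    split; first by rewrite -modc_gt0 (lt_le_trans _ low)// mulr_gt0 ?expR_gt0// divr_gt0.
    rewrite DE modcN modcM -/g.
    apply: (le_trans (ler_wpM2l (ltW gp) (sin_integral_bound Lv r0 hxy))).
    apply: (le_trans _ (ler_wpM2l (divr_ge0 K0 (ltW r0)) low)).
    rewrite /K le_eqVlt; apply/orP; left; apply/eqP; field.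
    by rewrite !gt_eqF.
  apply/negP; rewrite -ltNge mulrAC ltr_pdivrMr// -ltr_pdivrMl// mulrC; lra.
have sv0 z : entire_value (sin_integral_coefs v) z = 0.
  have -> : z = (sqrtC z) ^+ 2 by rewrite sqrtCK.
  rewrite entire_value_sin_integral//.
  have /eqP := D0 (sqrtC z); rewrite DE oppr_eq0 mulf_eq0 (negbTE g0) /= => /eqP.
  exact.
apply: (ae_imp (sin_integral_ae0 Lv sv0)) => x h x01.
by apply/eqP; rewrite -subr_eq0; apply/eqP; exact: h x01.
Qed.

(** [characteristic_function] picks the solutions separately for each lambda; the explicit formula
    identifies the resulting [Delta] with the sum of a single power series. *)
Lemma spectrum_symmetrized (a : R) gam (q : R -> R[i]) (m : R[i] -> nat) :
  0 <= a <= 1 -> gam != 0 -> L1 `]0, 1[ q -> spectrum q a gam m ->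
  forall z, zero_of_order
    (entire_value (characteristic_coefs gam (symmetrized q a gam))) z (m z).
Proof.
move=> a01 g0 Lq [Delta [hD hm]] z.
have -> : entire_value (characteristic_coefs gam (symmetrized q a gam)) = Delta; last exact: hm.
apply/funext => w; have -> : w = (sqrtC w) ^+ 2 by rewrite sqrtCK.
rewrite characteristic_coefsE; last exact: L1_symmetrized.
by rewrite (characteristic_functionE _ a01 g0 Lq hD).
Qed.

End Uniqueness.

(** * From the symmetrized function back to the potential *)

Section ShiftedPotential.
Variable R : realType.
Local Notation leb := (@lebesgue_measure R).
Local Notation mR := (measurableTypeR R).
Implicit Types (a : R) (gam : R[i]) (q f : R -> R[i]).

Lemma L2_shift (u v c : R) f : L2 `]u, v[ f ->
  L2 `]u - c, v - c[ (fun x => f (x + c)).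
Proof.
move=> Lf; rewrite -preimage_shift_itv.
exact: (L2_comp_preimage (measurable_shift c) (@lebesgue_measure_shift R c)).
Qed.

Lemma L2_itv (u u' v v' : R) f : u <= u' -> v' <= v -> L2 `]u, v[ f -> L2 `]u', v'[ f.
Proof.
move=> uu vv [[m1 m2] i]; have s := itv_oo_sub uu vv.
split; last by apply: integrableS i.
by split; [exact: measurable_funS m1|exact: measurable_funS m2].
Qed.

Lemma L2Z (u v : R) (c : R[i]) f : L2 `]u, v[ f -> L2 `]u, v[ (fun x => c * f x).
Proof.
move=> Lf; have [mf i] := Lf; have mD : measurable (`]u, v[%classic : set mR) by [].
split; first exact: L1_cmeasurable (L1Z c mD (L2_L1 Lf)).
apply: (eq_integrable mD _ _ _ (integrableZl mD (complex.Re c ^+ 2 + complex.Im c ^+ 2) i)).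
move=> x _; rewrite /= -EFinM; congr EFin.
by case: c (f x) => a b [y z] /=; ring.
Qed.

Lemma eq_L2 (u v : R) f g : (forall x, `]u, v[%classic x -> f x = g x) ->
  L2 `]u, v[ f -> L2 `]u, v[ g.
Proof.
move=> fg Lf; have [mf i] := Lf; have mD : measurable (`]u, v[%classic : set mR) by [].
split; first exact: L1_cmeasurable (eq_L1 mD fg (L2_L1 Lf)).
by apply: (eq_integrable mD _ _ _ i) => x /[!inE] /fg ->.
Qed.

Lemma L2_shifted q a gam : 0 <= a <= 1 -> L2 `]0, 1[ q -> L2 `]0, 1[ (shifted q a gam).
Proof.
move=> a01 Lq; have /andP[a0 a1] := a01.
have h1 : L2 `]0, 1 - a[ (shifted q a gam).
  have := L2_shift a (L2_itv a0 (lexx 1) Lq); rewrite subrr.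
  by apply: eq_L2 => x /shifted_left ->.
have h2 : L2 `]1 - a, 1[ (shifted q a gam).
  have := L2Z gam^-1 (L2_shift (a - 1) (L2_itv (lexx 0) a1 Lq)).
  rewrite (_ : 0 - (a - 1) = 1 - a) 1?(_ : a - (a - 1) = 1); [|ring|ring].
  by apply: eq_L2 => x /shifted_right ->.
split; first exact/L1_cmeasurable/L1_shifted/L2_L1.
apply: (@integrable_glue _ 0 (1 - a) 1 (fun x =>
    complex.Re (shifted q a gam x) ^+ 2 + complex.Im (shifted q a gam x) ^+ 2)).
- by rewrite subr_ge0.
- by rewrite gerBl.
- exact: h1.2.
- exact: h2.2.
Qed.

Lemma ae_shift (P : R -> Prop) (c : R) : {ae leb, forall x, P x} ->
  {ae leb, forall x, P (x + c)}.
Proof. exact: (ae_comp (measurable_shift c) (@lebesgue_measure_shift R c)). Qed.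

Lemma ae_reflect (P : R -> Prop) (c : R) : {ae leb, forall x, P x} ->
  {ae leb, forall x, P (c - x)}.
Proof. exact: (ae_comp (measurable_reflect c) (@lebesgue_measure_reflect R c)). Qed.

Lemma ae_neq (c : R) : {ae leb, forall x, x != c}.
Proof.
exists [set c]; split; [exact: measurable_set1|exact: lebesgue_measure_set1|].
by move=> x /= /negP; rewrite negbK => /eqP.
Qed.

Lemma shifted_ae_eq q qt a gam : 0 <= a <= 1 -> gam != 0 ->
  ae_eq_on `]0, 1[ (shifted q a gam) (shifted qt a gam) -> ae_eq_on `]0, 1[ q qt.
Proof.
move=> /andP[a0 a1] g0 h.
have h1 := ae_shift (- a) h; have h2 := ae_shift (1 - a) h.
apply: (ae_imp (ae_and (ae_neq a) (ae_and h1 h2))) => x [xa [e1 e2]].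
rewrite /= in_itv/= => /andP[x0 x1].
have [ax|xlt] := leP a x.
  have {}ax : a < x by rewrite lt_neqAle eq_sym xa.
  have i1 : `]0, 1 - a[%classic (x - a) by rewrite /= in_itv/= subr_gt0 ax ltrD2r.
  have := e1 (itv_oo_sub (lexx 0) (_ : 1 - a <= 1) i1).
  by rewrite !(shifted_left _ _ i1) subrK; apply; rewrite gerBl.
have i2 : `]1 - a, 1[%classic (x + (1 - a)).
  by rewrite /= in_itv/= ltrDr x0 addrCA gtrDl subr_lt0.
have := e2 (itv_oo_sub (_ : 0 <= 1 - a) (lexx 1) i2).
rewrite !(shifted_right _ _ i2) (_ : x + (1 - a) + (a - 1) = x); last by ring.
by move=> /(_ _)/wrap[|/mulfI->]//; rewrite ?subr_ge0// invr_eq0.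
Qed.

(** The values at x and 1 - x satisfy a linear system of determinant gam^2 - 1. *)
Lemma symmetrized_ae_eq q qt a gam : gam != 1 -> gam != -1 ->
  ae_eq_on `]0, 1[ (symmetrized q a gam) (symmetrized qt a gam) ->
  ae_eq_on `]0, 1[ (shifted q a gam) (shifted qt a gam).
Proof.
move=> g1 gN1 h; have h' := ae_reflect 1 h.
apply: (ae_imp (ae_and h h')) => x [e1 e2] x01.
have x01' : `]0, 1[%classic (1 - x).
  by move: x01; rewrite /= !in_itv/= subr_gt0 gtrBl => /andP[-> ->].
move: {e1 e2} (e1 x01) (e2 x01'); rewrite /symmetrized subKr.
set u := shifted q a gam x; set u' := shifted q a gam (1 - x).
set v := shifted qt a gam x; set v' := shifted qt a gam (1 - x) => e1 e2.
have g2 : gam ^+ 2 - 1 != 0 by rewrite subr_eq0 sqrf_eq1 negb_or g1 gN1.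
apply: (mulfI g2).
transitivity (gam * (gam * u + u') - (gam * u' + u)); first by ring.
by rewrite e1 e2; ring.
Qed.

Lemma symmetrized_K_ae_eq q qt a gam (K : (R -> R[i]) -> (R -> R[i])) :
  0 <= a <= 1 -> gam ^+ 2 = 1 -> L2 `]0, 1[ q -> L2 `]0, 1[ qt ->
  L2_operator `]0, 2^-1[ K ->
  L2_injective `]0, 2^-1[ (fun f x => f x + gam * K f x) ->
  ae_eq_on `]0, 2^-1[ (fun x => shifted q a gam (2^-1 - x))
    (K (fun x => shifted q a gam (2^-1 + x))) ->
  ae_eq_on `]0, 2^-1[ (fun x => shifted qt a gam (2^-1 - x))
    (K (fun x => shifted qt a gam (2^-1 + x))) ->
  ae_eq_on `]0, 1[ (symmetrized q a gam) (symmetrized qt a gam) ->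
  ae_eq_on `]0, 1[ (shifted q a gam) (shifted qt a gam).
Proof.
move=> a01 gg Lq Lqt [KL Kae] Kinj hq hqt h.
have half : (2^-1 : R) + 2^-1 = 1 by field.
have L2h f : L2 `]0, 1[ f -> L2 `]0, 2^-1[ (fun x => shifted f a gam (2^-1 + x)).
  move=> /(L2_shifted gam a01) /(L2_itv (_ : 0 <= 2^-1) (lexx 1)) Lf.
  have := L2_shift 2^-1 (Lf _); rewrite subrr (_ : 1 - 2^-1 = 2^-1); last by lra.
  move=> /(_ _)/wrap[|]; first by rewrite invr_ge0.
  by apply: eq_L2 => x _; rewrite addrC.
have hs := ae_shift 2^-1 h.
have e : ae_eq_on `]0, 2^-1[
    (fun x => shifted q a gam (2^-1 + x) + gam * K (fun x => shifted q a gam (2^-1 + x)) x)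
    (fun x => shifted qt a gam (2^-1 + x) + gam * K (fun x => shifted qt a gam (2^-1 + x)) x).
  apply: (ae_imp (ae_and hs (ae_and hq hqt))) => x [e1 [e2 e3]] x01.
  have xx : `]0, 1[%classic (x + 2^-1).
    move: x01; rewrite /= !in_itv/= => /andP[x0 x1].
    by rewrite addr_gt0//= -[ltRHS]half ltrD2r.
  rewrite -(e2 x01) -(e3 x01); move: (e1 xx); rewrite /symmetrized.
  have -> : 1 - (x + 2^-1) = 2^-1 - x by rewrite -{1}half; ring.
  rewrite [x + _]addrC => e4.
  have g0 : gam != 0.
    apply/eqP => g0; move: gg; rewrite g0 expr0n => /eqP.
    by rewrite eq_sym oner_eq0.
  apply: (mulfI g0); rewrite !mulrDr !mulrA -expr2 gg !mul1r; exact: e4.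
have f_eq := Kinj _ _ (L2h _ Lq) (L2h _ Lqt) e.
(* Injectivity has settled the right half of the interval; as K respects equality almost everywhere,
   the left half follows from it. *)
have Kf_eq := Kae _ _ (L2h _ Lq) (L2h _ Lqt) f_eq.
have r1 : ae_eq_on `]0, 2^-1[ (fun x => shifted q a gam (2^-1 - x))
    (fun x => shifted qt a gam (2^-1 - x)).
  apply: (ae_imp (ae_and Kf_eq (ae_and hq hqt))) => x [e1 [e2 e3]] x01.
  by rewrite (e2 x01) (e3 x01); exact: e1.
have s1 := ae_shift (- 2^-1) f_eq; have s2 := ae_reflect 2^-1 r1.
apply: (ae_imp (ae_and (ae_neq 2^-1) (ae_and s1 s2))) => x [xh [e1 e2]].
rewrite /= in_itv/= => /andP[x0 x1].
have [hx|xltx] := leP 2^-1 x.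
  have {}hx : 2^-1 < x by rewrite lt_neqAle eq_sym xh.
  have xe : 2^-1 + (x - 2^-1) = x by ring.
  by rewrite xe in e1; apply: e1; rewrite /= in_itv/= subr_gt0 hx ltrBlDr half x1.
rewrite subKr in e2; apply: e2.
by rewrite /= in_itv/= subr_gt0 xltx gtrBl.
Qed.

End ShiftedPotential.

Theorem theorem2 (R : realType) (a : R) (gam : R[i]) (q qt : R -> R[i])
    (m mt : R[i] -> nat) :
  0 <= a <= 1 -> gam != 0 ->
  L2 `]0, 1[ q -> L2 `]0, 1[ qt ->
  spectrum q a gam m -> spectrum qt a gam mt ->
  (gam != 1 -> gam != -1 ->
     m =1 mt -> ae_eq_on `]0, 1[ q qt)
  /\
  (gam = 1 \/ gam = -1 ->
     (exists K : (R -> R[i]) -> (R -> R[i]),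
        [/\ L2_operator `]0, 2^-1[ K,
            L2_injective `]0, 2^-1[ (fun f x => f x + gam * K f x),
            ae_eq_on `]0, 2^-1[
              (fun x => shifted q a gam (2^-1 - x))
              (K (fun x => shifted q a gam (2^-1 + x)))
          & ae_eq_on `]0, 2^-1[
              (fun x => shifted qt a gam (2^-1 - x))
              (K (fun x => shifted qt a gam (2^-1 + x)))]) ->
     m =1 mt -> ae_eq_on `]0, 1[ q qt).
Proof.
move=> a01 g0 Lq Lqt Sq Sqt.
have L1q := L2_L1 Lq; have L1qt := L2_L1 Lqt.
have sym : m =1 mt ->
    ae_eq_on `]0, 1[ (symmetrized q a gam) (symmetrized qt a gam).
  move=> mm; apply: (characteristic_uniqueness g0).
  - exact: L1_symmetrized.
  - exact: L1_symmetrized.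
  move=> z; exists (m z); split; first exact: spectrum_symmetrized.
  by rewrite mm; exact: spectrum_symmetrized.
split=> [g1 gN1 /sym h|g1 [K [KL Kinj hq hqt]] /sym h].
  exact/(shifted_ae_eq a01 g0)/symmetrized_ae_eq.
apply: (shifted_ae_eq a01 g0).
apply: (symmetrized_K_ae_eq a01 _ Lq Lqt KL Kinj hq hqt h).
by case: g1 => ->; rewrite ?sqrrN expr1n.
Qed.
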